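(* Let $\mathcal{M}=\langle M,\in^{\mathcal M}\rangle$ be countable with $\mathcal{M}\models\mathrm{MOST}+\Delta_0^{\mathcal P}\text{-collection}$, and let $I\subseteq M$ be an $H$-cut of $\mathcal{M}$. If $\mathbb{L}$ is a linear order, then there is an $\mathcal L$-structure $\mathcal{N}$ with $\mathcal{M}\subseteq_{\mathrm{cf}}\mathcal{N}$ and $\mathcal{N}\models\mathrm{MOST}$, and an embedding $j\mapsto\check{j}$ (injective group homomorphism) of $\mathrm{Aut}(\mathbb{L})$ into $\mathrm{Aut}(\mathcal{N})$, such that whenever $j\in\mathrm{Aut}(\mathbb L)$ has no fixed points, $\mathcal{I}_{\mathrm{fix}}(\check{j})=\langle I,\in^{\mathcal M}\rangle$ and $\mathrm{fix}(\check{j})=M$.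
   Context: $\mathcal{L}$ is the language with one binary relation $\in$; for $a\in M$, $a^*=\{x\in M:\mathcal M\models x\in a\}$. $\mathrm{Mac}$: extensionality, pairing, emptyset, union, infinity, powerset, transitive containment ($\forall x\exists y(\bigcup y\subseteq y\wedge x\subseteq y)$), $\Delta_0$-separation, set foundation, and ''every set can be well-ordered''. $\mathrm{MOST}=\mathrm{Mac}+\Sigma_1$-separation$+\Delta_0$-collection. $\Delta_0^{\mathcal P}$ is the smallest class of $\mathcal L$-formulae containing atomic formulae, closed under connectives and quantifiers $\exists x\in y,\forall x\in y,\exists x\subseteq y,\forall x\subseteq y$; $\Delta_0^{\mathcal P}$-collection is the collection scheme restricted to $\Delta_0^{\mathcal P}$ formulae. For $\mathcal{L}$-structures $\mathcal{A}\subseteq\mathcal{B}$: end-extension means members (in $\mathcal B$) of elements of $A$ lie in $A$; powerset-preserving means additionally every $x\in B$ with $\mathcal B\models x\subseteq y$ for some $y\in A$ lies in $A$; topless means end-extension, $A\ne B$, and every $C\in B$ with $C^*\subseteq\mathrm{Ord}^{\mathcal A}$ lies in $A$. For $\mathcal M\models\mathrm{MOST}$, $I\subseteq M$ is an $H$-cut if $\mathcal M$ is a topless powerset-preserving end-extension of the substructure $\langle I,\in^{\mathcal M}\rangle$ and $\langle I,\in^{\mathcal M}\rangle\models\mathrm{MOST}$. $\mathcal M\subseteq_{\mathrm{cf}}\mathcal N$ means $\mathcal M$ is a substructure of $\mathcal N$ and for every $x\in N$ there is $y\in M$ with $\mathcal N\models x\in y$. For an automorphism $j$ of a model $\mathcal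 N$, $\mathrm{fix}(j)=\{x\in N:j(x)=x\}$ and $\mathcal I_{\mathrm{fix}}(j)$ is the substructure of $\mathcal N$ with domain $\{x\in N: j(y)=y\text{ for all }y \text{ with }\mathcal N\models y\in\mathrm{TC}(\{x\})\}$, $\mathrm{TC}$ computed in $\mathcal N$. $\mathrm{Aut}(\cdot)$ denotes the automorphism group.
   Formalization: The linear order L is assumed nonempty: for the empty order the identity vacuously has no fixed points, so the conclusion would force I = N = M, contradicting that I is a proper (topless) cut. *)

(* Defs.v *)
From HB Require Import structures.
From mathcomp Require Import all_boot.
From mathcomp Require Import boolp classical_sets functions cardinality.

Set Implicit Arguments.
Unset Strict Implicit.
Unset Printing Implicit Defensive.

Local Open Scope classical_set_scope.

(* One binary relation: used both for models of set theory, where [bin] is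
   membership, and for linear orders, where it is the strict order. *)
Record structure := Structure {
  carrier :> Type;
  bin : carrier -> carrier -> Prop
}.

Declare Scope st_scope.
Delimit Scope st_scope with st.
Notation "x ∈ y" := (bin x y) (at level 70, no associativity) : st_scope.
Local Open Scope st_scope.

(* First-order formulas with named variables; variables are natural numbers. *)
Inductive formula : Type :=
| fMem of nat & nat
| fEq of nat & nat
| fNot of formula
| fAnd of formula & formula
| fOr of formula & formula
| fImp of formula & formula
| fEx of nat & formula
| fAll of nat & formula.

Fixpoint sat (A : structure) (v : nat -> A) (f : formula) : Prop :=
  match f with
  | fMem i j => v i ∈ v j
  | fEq i j => v i = v j
  | fNot g => ~ sat v g
  | fAnd g h => sat v g /\ sat v h
  | fOr g h => sat v g \/ sat v h
  | fImp g h => sat v g -> sat v h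
  | fEx i g => exists a : A, sat [eta v with i |-> a] g
  | fAll i g => forall a : A, sat [eta v with i |-> a] g
  end.

Inductive delta0 : formula -> Prop :=
| delta0_mem i j : delta0 (fMem i j)
| delta0_eq i j : delta0 (fEq i j)
| delta0_not f of delta0 f : delta0 (fNot f)
| delta0_and f g of delta0 f & delta0 g : delta0 (fAnd f g)
| delta0_or f g of delta0 f & delta0 g : delta0 (fOr f g)
| delta0_imp f g of delta0 f & delta0 g : delta0 (fImp f g)
| delta0_ex x y f of x <> y & delta0 f : delta0 (fEx x (fAnd (fMem x y) f))
| delta0_all x y f of x <> y & delta0 f : delta0 (fAll x (fImp (fMem x y) f)).

(* A possibly empty block of existential quantifiers before a [delta0] matrix *)
Inductive sigma1 : formula -> Prop :=
| sigma1_delta0 f of delta0 f : sigma1 f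
| sigma1_ex x f of sigma1 f : sigma1 (fEx x f).

(* [x ⊆ y], where the bound variable [z] must differ from [x] and [y] *)
Definition fSub (z x y : nat) : formula := fAll z (fImp (fMem z x) (fMem z y)).

Inductive delta0P : formula -> Prop :=
| delta0P_mem i j : delta0P (fMem i j)
| delta0P_eq i j : delta0P (fEq i j)
| delta0P_not f of delta0P f : delta0P (fNot f)
| delta0P_and f g of delta0P f & delta0P g : delta0P (fAnd f g)
| delta0P_or f g of delta0P f & delta0P g : delta0P (fOr f g)
| delta0P_imp f g of delta0P f & delta0P g : delta0P (fImp f g)
| delta0P_ex x y f of x <> y & delta0P f : delta0P (fEx x (fAnd (fMem x y) f))
| delta0P_all x y f of x <> y & delta0P f :
    delta0P (fAll x (fImp (fMem x y) f))
| delta0P_exsub x y z f of x <> y & z <> x & z <> y & delta0P f :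
    delta0P (fEx x (fAnd (fSub z x y) f))
| delta0P_allsub x y z f of x <> y & z <> x & z <> y & delta0P f :
    delta0P (fAll x (fImp (fSub z x y) f)).

Section SetTheory.
Variable A : structure.
Implicit Types x y z a b p r s t u w : A.

Definition subs x y := forall z, z ∈ x -> z ∈ y.

Definition is_empty x := forall z, ~ z ∈ x.

Definition is_upair z x y := forall w, w ∈ z <-> w = x \/ w = y.

Definition is_opair p x y :=
  forall w, w ∈ p <-> is_upair w x x \/ is_upair w x y.

Definition is_succ s x := forall w, w ∈ s <-> w ∈ x \/ w = x.

Definition is_trans x := forall y, y ∈ x -> subs y x.

(* The set [x] is strictly well-ordered by [R]; minimal elements are only
   required for subsets of [x] that are elements of the structure. *)
Definition well_orders (R : A -> A -> Prop) x :=
  [/\ forall a, a ∈ x -> ~ R a a,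
      forall a b u, a ∈ x -> b ∈ x -> u ∈ x -> R a b -> R b u -> R a u,
      forall a b, a ∈ x -> b ∈ x -> [\/ R a b, a = b | R b a]
    & forall s, subs s x -> ~ is_empty s ->
        exists2 a, a ∈ s & forall b, b ∈ s -> b = a \/ R a b].

Definition graph r x y := exists2 p, is_opair p x y & p ∈ r.

Definition is_ordinal x := is_trans x /\ well_orders (@bin A) x.

Definition separation (C : formula -> Prop) :=
  forall (f : formula) (i : nat) (v : nat -> A) a, C f ->
    exists b, forall x, x ∈ b <-> x ∈ a /\ sat [eta v with i |-> x] f.

Definition collection (C : formula -> Prop) :=
  forall (f : formula) (i j : nat) (v : nat -> A) w, C f -> i <> j ->
    (forall x, x ∈ w -> exists y, sat [eta v with i |-> x, j |-> y] f) ->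
    exists c, forall x, x ∈ w ->
      exists2 y, y ∈ c & sat [eta v with i |-> x, j |-> y] f.

Record Mac : Prop := {
  mac_ext : forall x y, (forall z, z ∈ x <-> z ∈ y) -> x = y;
  mac_pairing : forall x y, exists z, is_upair z x y;
  mac_emptyset : exists x, is_empty x;
  mac_union : forall x, exists y, forall z,
    z ∈ y <-> exists2 w, w ∈ x & z ∈ w;
  mac_infinity : exists x,
    (exists2 z, is_empty z & z ∈ x) /\
    (forall y, y ∈ x -> exists2 s, is_succ s y & s ∈ x);
  mac_powerset : forall x, exists y, forall z, z ∈ y <-> subs z x;
  mac_tc : forall x, exists2 y, is_trans y & subs x y;
  mac_separation : separation delta0;
  mac_foundation : forall x, ~ is_empty x ->
    exists2 y, y ∈ x & forall z, z ∈ y -> ~ z ∈ x;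
  mac_wo : forall x, exists r, well_orders (graph r) x
}.

Record MOST : Prop := {
  most_mac : Mac;
  most_separation : separation sigma1;
  most_collection : collection delta0
}.

(* [t = TC(a)], the least transitive set including [a] *)
Definition is_TC t a :=
  [/\ is_trans t, subs a t & forall u, is_trans u -> subs a u -> subs t u].

(* [y ∈ TC({x})] *)
Definition in_TC1 y x :=
  exists s t, [/\ is_upair s x x, is_TC t s & y ∈ t].

Definition star a : set A := [set x | x ∈ a].

Definition Ord : set A := [set x | is_ordinal x].

End SetTheory.

Definition substr (B : structure) (A : set B) : structure :=
  @Structure {x : B | A x} (fun x y => sval x ∈ sval y).

Section Extensions.
Variables (B : structure) (A : set B).

Definition end_extension := forall x y, A y -> x ∈ y -> A x.

Definition powerset_preserving :=
  end_extension /\ forall x y, A y -> subs x y -> A x.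

Definition topless :=
  [/\ end_extension, A <> [set: B]
    & forall c : B, star c `<=` (fun x : substr A => sval x) @` @Ord (substr A) ->
        A c].

Definition H_cut := [/\ powerset_preserving, topless & MOST (substr A)].

End Extensions.

(* [A] is identified with the substructure of [B] on the range of [e]. *)
Definition embedding (A B : structure) (e : A -> B) :=
  injective e /\ forall x y, e x ∈ e y <-> x ∈ y.

Definition cofinal_embedding (A B : structure) (e : A -> B) :=
  embedding e /\ forall x : B, exists y : A, x ∈ e y.

Definition linear_order (L : structure) :=
  [/\ forall x : L, ~ bin x x,
      forall x y z : L, bin x y -> bin y z -> bin x z
    & forall x y : L, [\/ bin x y, x = y | bin y x]].

Record aut (A : structure) := Aut {
  aut_fun :> A -> A;
  aut_inv : A -> A;
  aut_funK : cancel aut_fun aut_inv;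
  aut_invK : cancel aut_inv aut_fun;
  aut_bin : forall x y, aut_fun x ∈ aut_fun y <-> x ∈ y
}.

Section AutGroup.
Variable A : structure.
Implicit Types f g h : aut A.

Lemma aut_eq f g : f =1 g -> f = g.
Proof.
case: f g => [f f' fK f'K fE] [g g' gK g'K gE] /= /funext fg; subst g.
have e : f' = g' by apply/funext => x; rewrite -[in LHS](g'K x) fK.
subst g'; congr Aut; exact: Prop_irrelevance.
Qed.

Definition aut_one : aut A :=
  @Aut A id id (fun=> erefl) (fun=> erefl) (fun _ _ => iff_refl _).

Fact aut_mul_bin f g x y : (f \o g) x ∈ (f \o g) y <-> x ∈ y.
Proof. by rewrite /= !aut_bin. Qed.

Definition aut_mul f g : aut A :=
  Aut (can_comp (aut_funK f) (aut_funK g)) (can_comp (aut_invK g) (aut_invK f))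
      (aut_mul_bin f g).

Fact aut_V_bin f x y : aut_inv f x ∈ aut_inv f y <-> x ∈ y.
Proof. by rewrite -(aut_bin f) !aut_invK. Qed.

Definition aut_V f : aut A := Aut (aut_invK f) (aut_funK f) (aut_V_bin f).

Lemma aut_mulA : associative aut_mul.
Proof. by move=> f g h; apply: aut_eq. Qed.

Lemma aut_mul1g : left_id aut_one aut_mul.
Proof. by move=> f; apply: aut_eq. Qed.

Lemma aut_mulg1 : right_id aut_one aut_mul.
Proof. by move=> f; apply: aut_eq. Qed.

Lemma aut_mulVg : left_inverse aut_one aut_V aut_mul.
Proof. by move=> f; apply: aut_eq => x /=; rewrite aut_funK. Qed.

Lemma aut_mulgV : right_inverse aut_one aut_V aut_mul.
Proof. by move=> f; apply: aut_eq => x /=; rewrite aut_invK. Qed.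

HB.instance Definition _ := gen_eqMixin (aut A).
HB.instance Definition _ := gen_choiceMixin (aut A).
HB.instance Definition _ :=
  isGroup.Build (aut A) aut_mulA aut_mul1g aut_mulg1 aut_mulVg aut_mulgV.

End AutGroup.

Definition fixpts (N : structure) (j : aut N) : set N := [set x | j x = x].

Definition Ifix (N : structure) (j : aut N) : set N :=
  [set x | forall y, in_TC1 y x -> j y = y].

(* Main.v *)
Require Import Defs.
From HB Require Import structures.
From mathcomp Require Import all_boot.
From mathcomp Require Import boolp classical_sets functions cardinality.

Set Implicit Arguments.
Unset Strict Implicit.
Unset Printing Implicit Defensive.

Local Open Scope classical_set_scope.
Local Open Scope st_scope.

(** In [M] one builds, by Erdős–Rado trees, a decreasing sequence of sets [X k]
of ordinals below a fixed [c] outside [I], each too large to be covered from an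
element of [I], on which every function of [M] on decreasing tuples is
homogeneous in the required sense.  Toplessness of [I] enters here: if all
branches of a tree were covered from elements of [I], their ordinal sizes would
form a set of ordinals of [I], hence an element of [I], and the tree itself
would be covered from an element of [I].  As [M] is countable, the sequence can
serve all its elements, and it determines an ultrapower [N] iterated along [L]:
its elements are terms [f(l_1, ..., l_n)] with [f] in [M] and the [l_i] in [L]
behaving as order indiscernibles.  Łoś's theorem for [sigma1] formulas gives
[MOST] in [N], and an automorphism of [L] acts on the indices.

A term fixed by a fixed-point free [j] is also fixed by a power of [j] that
moves its indices off themselves, and moving one point at a time then shows
that the term is constant.  Terms bounded by an element of [I] are constant,
while for [d] outside [I] some [X k] injects into the transitive closure of
[d], which therefore contains a moved point. *)

(** * Renaming variables *)

(** The weakness of [MOST] shapes the proof: separation is available for [sigma1] and collection for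
    [delta0] only. A function of [M] is an arbitrary element [f], evaluated by the total operation
    [app], and a predicate about such values must be [delta0] with parameters before a scheme
    applies. The calculus of [def] and [good] reads this off the shape of the predicate, and
    quantifiers over functions and subsets are bounded by powersets to stay within it.

    Size is measured by coverings from elements of [I]. As [I] is closed under products and
    powersets, the number of types counted in the tree argument stays in [I]. Tuples are decreasing
    because a tuple is coded with its head first and the tree eliminates the largest entry; dually,
    foundation lets least elements be split off a large set, which yields tuples lying below all
    that remains.

    The filter on assignments of the indices decides only conditions given by elements of [M]. By
    [sigma1]-separation in [M] this includes every [sigma1] condition on finitely many terms, and
    the axioms of [MOST] in [N] need no more. *)

Fixpoint bd (f : formula) : nat :=
  match f with
  | fMem i j | fEq i j => (maxn i j).+1
  | fNot g => bd g
  | fAnd g h | fOr g h | fImp g h => maxn (bd g) (bd h)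
  | fEx i g | fAll i g => maxn i.+1 (bd g)
  end.

Lemma sat_ext (A : structure) f (v w : nat -> A) :
  (forall i, i < bd f -> v i = w i) -> sat v f <-> sat w f.
Proof.
elim: f v w => [i j|i j|g IH|g IHg h IHh|g IHg h IHh|g IHg h IHh|i g IH|i g IH] v w /= e.
- by rewrite !e // ltnS ?leq_maxl ?leq_maxr.
- by rewrite !e // ltnS ?leq_maxl ?leq_maxr.
- by have := IH v w e; tauto.
- have := IHg v w (fun k l => e k (leq_trans l (leq_maxl _ _))).
  by have := IHh v w (fun k l => e k (leq_trans l (leq_maxr _ _))); tauto.
- have := IHg v w (fun k l => e k (leq_trans l (leq_maxl _ _))).
  by have := IHh v w (fun k l => e k (leq_trans l (leq_maxr _ _))); tauto.
- have := IHg v w (fun k l => e k (leq_trans l (leq_maxl _ _))).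
  by have := IHh v w (fun k l => e k (leq_trans l (leq_maxr _ _))); tauto.
- have E a : sat [eta v with i |-> a] g <-> sat [eta w with i |-> a] g.
    apply: IH => k l /=; case: eqP => // _; apply: e; exact: leq_trans l (leq_maxr _ _).
  by split=> -[a /E]; exists a.
- have E a : sat [eta v with i |-> a] g <-> sat [eta w with i |-> a] g.
    apply: IH => k l /=; case: eqP => // _; apply: e; exact: leq_trans l (leq_maxr _ _).
  by split=> H a; apply/E.
Qed.

Lemma sat_eq (A : structure) f (v w : nat -> A) : v =1 w -> sat v f <-> sat w f.
Proof. by move=> e; apply: sat_ext. Qed.

Definition fresh (h : nat -> nat) n := (\max_(j < n) h j).+1.

Lemma fresh_neq h n j : j < n -> h j != fresh h n.
Proof.
move=> jn; rewrite neq_ltn; apply/orP; left; rewrite ltnS.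
exact: (leq_bigmax (Ordinal jn)).
Qed.

(** Bound variables move to a variable above the images of all variables of the body, so [h] may
    identify variables without capture. *)
Fixpoint rename (h : nat -> nat) (f : formula) : formula :=
  match f with
  | fMem i j => fMem (h i) (h j)
  | fEq i j => fEq (h i) (h j)
  | fNot g => fNot (rename h g)
  | fAnd g k => fAnd (rename h g) (rename h k)
  | fOr g k => fOr (rename h g) (rename h k)
  | fImp g k => fImp (rename h g) (rename h k)
  | fEx i g => let k := fresh h (bd g) in fEx k (rename [eta h with i |-> k] g)
  | fAll i g => let k := fresh h (bd g) in fAll k (rename [eta h with i |-> k] g)
  end.

Lemma sat_rename (A : structure) f h (v : nat -> A) :
  sat v (rename h f) <-> sat (v \o h) f.
Proof.
elim: f h v => [i j|i j|g IH|g IHg k IHk|g IHg k IHk|g IHg k IHk|i g IH|i g IH] h v //=.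
- by have := IH h v; tauto.
- by have := IHg h v; have := IHk h v; tauto.
- by have := IHg h v; have := IHk h v; tauto.
- by have := IHg h v; have := IHk h v; tauto.
- have E a : sat [eta v with fresh h (bd g) |-> a]
      (rename [eta h with i |-> fresh h (bd g)] g) <-> sat [eta v \o h with i |-> a] g.
    rewrite IH; apply: sat_ext => j jl /=; case: (j =P i) => [_|_]; first by rewrite eqxx.
    by rewrite (negbTE (fresh_neq h jl)).
  by split=> -[a /E]; exists a.
- have E a : sat [eta v with fresh h (bd g) |-> a]
      (rename [eta h with i |-> fresh h (bd g)] g) <-> sat [eta v \o h with i |-> a] g.
    rewrite IH; apply: sat_ext => j jl /=; case: (j =P i) => [_|_]; first by rewrite eqxx.
    by rewrite (negbTE (fresh_neq h jl)).
  by split=> H a; apply/E.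
Qed.

Lemma delta0_rename f h : delta0 f -> delta0 (rename h f).
Proof.
move=> d; elim: d h => /=; try by move=> *; constructor; auto.
- move=> x y g xy dg IH h; rewrite eqxx.
  have -> : (y == x) = false by apply/eqP => e; apply: xy.
  apply: delta0_ex; last exact: IH.
  apply/eqP; rewrite eq_sym; apply: fresh_neq.
  by rewrite !leq_max ltnS leq_max leqnn orbT.
- move=> x y g xy dg IH h; rewrite eqxx.
  have -> : (y == x) = false by apply/eqP => e; apply: xy.
  apply: delta0_all; last exact: IH.
  apply/eqP; rewrite eq_sym; apply: fresh_neq.
  by rewrite !leq_max ltnS leq_max leqnn orbT.
Qed.

(** * Definable predicates *)

Section Definability.
Variable A : structure.

(** A context is a type of environments with its coordinate functions singled out, so that
    predicates are functions of an environment and carry no variable names. *)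
Record ctx := Ctx { csort :> Type; cvar : (csort -> A) -> Prop }.

Definition c0 := @Ctx unit (fun=> False).
Definition ext (G : ctx) := @Ctx (G * A)%type
  (fun t => t = snd \/ exists2 u, @cvar G u & t = u \o fst).

Definition cterm (G : ctx) (t : G -> A) := cvar t \/ exists m, t = fun=> m.

Definition def (G : ctx) (P : G -> Prop) := exists f (r : nat -> G -> A),
  [/\ delta0 f, forall k, cterm (r k) & forall e, P e <-> sat (r^~ e) f].

Definition csub (D G : ctx) (s : D -> G) := forall u, cvar u -> cterm (u \o s).

Lemma csub_fst (G : ctx) : @csub (ext G) G fst.
Proof. by move=> u cu; left; right; exists u. Qed.

Lemma csub_id (G : ctx) : @csub G G id.
Proof. by move=> u cu; left. Qed.

Lemma csub_term (D G : ctx) (s : D -> G) t : csub s -> cterm t -> cterm (t \o s).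
Proof. by move=> ss [/ss //|[m ->]]; right; exists m. Qed.

Lemma csub_comp (E D G : ctx) (s : D -> G) (s' : E -> D) :
  csub s -> csub s' -> csub (s \o s').
Proof. by move=> H H' u /H; apply: (csub_term H'). Qed.

Lemma def_csub (D G : ctx) (s : D -> G) P : csub s -> def P -> def (P \o s).
Proof.
move=> ss [f [r [df tr E]]]; exists f, (fun k => r k \o s); split=> //.
  by move=> k; apply: csub_term.
by move=> e; exact: E.
Qed.

Lemma def_iff (G : ctx) (P Q : G -> Prop) : (forall e, P e <-> Q e) -> def Q -> def P.
Proof. by move=> E [f [r [df tr H]]]; exists f, r; split=> // e; rewrite E. Qed.

Lemma def_not (G : ctx) (P : G -> Prop) : def P -> def (fun e => ~ P e).
Proof.
move=> [f [r [df tr H]]]; exists (fNot f), r; split=> //; first by constructor.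
by move=> e /=; have := H e; tauto.
Qed.

(** The two formulas receive disjoint variables, even ones and odd ones, so that one valuation
    serves both. *)
Lemma def_join (G : ctx) (P Q : G -> Prop) : def P -> def Q ->
  exists f g (r : nat -> G -> A), [/\ delta0 f, delta0 g, forall k, cterm (r k)
    & forall e, (P e <-> sat (r^~ e) f) /\ (Q e <-> sat (r^~ e) g)].
Proof.
move=> [f [r [df tr H]]] [g [s [dg ts K]]].
exists (rename double f), (rename (fun k => k.*2.+1) g).
exists (fun k => if odd k then s k./2 else r k./2); split.
- exact: delta0_rename.
- exact: delta0_rename.
- by move=> k; case: ifP.
move=> e; rewrite H K !sat_rename; split; apply: sat_eq => k /=.
  by rewrite odd_double doubleK.
by rewrite odd_double uphalf_double.
Qed.

Lemma def_and (G : ctx) (P Q : G -> Prop) : def P -> def Q -> def (fun e => P e /\ Q e).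
Proof.
move=> dP dQ; have [f [g [r [df dg tr H]]]] := def_join dP dQ.
exists (fAnd f g), r; split=> //; first by constructor.
by move=> e; have [] := H e => /=; tauto.
Qed.

Lemma def_or (G : ctx) (P Q : G -> Prop) : def P -> def Q -> def (fun e => P e \/ Q e).
Proof.
move=> dP dQ; have [f [g [r [df dg tr H]]]] := def_join dP dQ.
exists (fOr f g), r; split=> //; first by constructor.
by move=> e; have [] := H e => /=; tauto.
Qed.

Lemma def_imp (G : ctx) (P Q : G -> Prop) : def P -> def Q -> def (fun e => P e -> Q e).
Proof.
move=> dP dQ; have [f [g [r [df dg tr H]]]] := def_join dP dQ.
exists (fImp f g), r; split=> //; first by constructor.
by move=> e; have [] := H e => /=; tauto.
Qed.

Lemma def_equiv (G : ctx) (P Q : G -> Prop) : def P -> def Q -> def (fun e => P e <-> Q e).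
Proof. by move=> dP dQ; apply: def_and; apply: def_imp. Qed.

(* A term is good when it can be substituted into definable predicates, also
   after a change of context. *)
Definition good (G : ctx) (t : G -> A) := forall (D : ctx) (s : D -> G), csub s ->
  forall P, @def (ext D) P -> def (fun d => P (d, t (s d))).

Lemma good_cterm (G : ctx) (t : G -> A) : cterm t -> good t.
Proof.
move=> ct D s ss P [f [r [df tr E]]].
exists f, (fun k d => r k (d, t (s d))); split=> // k.
case: (tr k) => [[->|[u cu ->]]|[m ->]]; last by right; exists m.
- exact: (csub_term ss ct).
- by left.
Qed.

Lemma good_const (G : ctx) (m : A) : good (fun e : G => m).
Proof. by apply: good_cterm; right; exists m. Qed.

Lemma good_csub (D G : ctx) (s : D -> G) (t : G -> A) : csub s -> good t -> good (t \o s).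
Proof. by move=> ss gt E s' ss' P dP; apply: (gt _ (s \o s')) => //; apply: csub_comp. Qed.

Lemma good_var0 (G : ctx) : @good (ext G) (fun e => e.2).
Proof. by apply: good_cterm; left; left. Qed.

Lemma good_fst (G : ctx) (t : G -> A) : good t -> @good (ext G) (fun e => t e.1).
Proof. exact: good_csub (@csub_fst G). Qed.

Lemma good_subst (G : ctx) (t : G -> A) (P : G -> A -> Prop) :
  good t -> @def (ext G) (fun e => P e.1 e.2) -> def (fun e => P e (t e)).
Proof. by move=> gt dP; exact: (gt G id (@csub_id G) _ dP). Qed.

Lemma def_fst (G : ctx) (P : G -> Prop) : def P -> @def (ext G) (fun e => P e.1).
Proof. exact: def_csub (@csub_fst G). Qed.

Lemma csub_skip (G : ctx) :
  @csub (ext (ext G)) (ext G) (fun e => (e.1.1, e.2)).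
Proof.
move=> u [->|[w cw ->]]; first by left; left.
by left; right; exists (w \o fst) => //; right; exists w.
Qed.

Lemma def_skip (G : ctx) (Q : G -> A -> Prop) : @def (ext G) (fun e => Q e.1 e.2) ->
  @def (ext (ext G)) (fun e => Q e.1.1 e.2).
Proof. by move=> dQ; exact: (def_csub (@csub_skip G) dQ). Qed.

Lemma def_mem (G : ctx) (t u : G -> A) : good t -> good u -> def (fun e => t e ∈ u e).
Proof.
move=> gt gu.
apply: (good_subst (P := fun e x => x ∈ u e)) => //.
apply: (good_subst (G := ext G) (t := fun e => u e.1) (P := fun e y => e.2 ∈ y)).
  exact: good_fst.
exists (fMem 0 1), (fun k => if k is 0 then (fun e : ext (ext G) => e.1.2) else snd).
split=> //; first by constructor.
by case=> [|k]; left; [right; exists snd => //; left|left].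
Qed.

Lemma def_eq (G : ctx) (t u : G -> A) : good t -> good u -> def (fun e => t e = u e).
Proof.
move=> gt gu.
apply: (good_subst (P := fun e x => x = u e)) => //.
apply: (good_subst (G := ext G) (t := fun e => u e.1) (P := fun e y => e.2 = y)).
  exact: good_fst.
exists (fEq 0 1), (fun k => if k is 0 then (fun e : ext (ext G) => e.1.2) else snd).
split=> //; first by constructor.
by case=> [|k]; left; [right; exists snd => //; left|left].
Qed.

Lemma def_exvar (G : ctx) (Q : G -> A -> Prop) : @def (ext G) (fun e => Q e.1 e.2) ->
  @def (ext G) (fun e => exists2 x, x ∈ e.2 & Q e.1 x).
Proof.
move=> [f [r [df tr E]]].
(* Variable 0 becomes the bound element and variable 1 its bound; the others shift by two. A term
   other than [snd] does not read the last coordinate, so it keeps its value when that coordinate is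
   the bounding set. *)
pose h k := if `[< r k = snd >] then 0 else k.+2.
exists (fEx 0 (fAnd (fMem 0 1) (rename h f))).
exists (fun k => if k is k'.+2 then r k' else snd); split.
- by apply: delta0_ex => //; apply: delta0_rename.
- by case=> [|[|k]] //; left; left.
have K e x : sat [eta (fun k => (if k is k'.+2 then r k' else snd) e) with 0 |-> x]
    (rename h f) <-> Q e.1 x.
  rewrite sat_rename (E (e.1, x)); apply: sat_eq => k /=; rewrite /h.
  case: asboolP => [->//|ns] /=.
  by case: (tr k) => [[//|[u cu ->]]|[m ->]].
move=> e; split=> [[x xe q]|[x [xe /K q]]]; exists x => //=; split=> //.
exact/K.
Qed.

Lemma def_ex2 (G : ctx) (t : G -> A) (Q : G -> A -> Prop) : good t ->
  @def (ext G) (fun e => Q e.1 e.2) -> def (fun e => exists2 x, x ∈ t e & Q e x).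
Proof.
move=> gt dQ; apply: (good_subst (P := fun e y => exists2 x, x ∈ y & Q e x)) => //.
exact: def_exvar.
Qed.

Lemma def_ex (G : ctx) (t : G -> A) (Q : G -> A -> Prop) : good t ->
  @def (ext G) (fun e => Q e.1 e.2) -> def (fun e => exists x, x ∈ t e /\ Q e x).
Proof.
move=> gt dQ; apply: def_iff (def_ex2 gt dQ) => e.
by split=> [[x []]|[x]]; exists x.
Qed.

Lemma def_all (G : ctx) (t : G -> A) (Q : G -> A -> Prop) : good t ->
  @def (ext G) (fun e => Q e.1 e.2) -> def (fun e => forall x, x ∈ t e -> Q e x).
Proof.
move=> gt dQ; apply: def_iff (def_not (def_ex2 gt (Q := fun e x => ~ Q e x) (def_not dQ))).
move=> e; split=> [H [x xt]|H x xt]; first by apply; apply: H.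
by apply: contrapT => nq; apply: H; exists x.
Qed.


Lemma def_sat f : delta0 f -> forall (G : ctx) (t : nat -> G -> A),
  (forall i, good (t i)) -> def (fun e => sat (t^~ e) f).
Proof.
elim=> {f}.
- by move=> i j G t gt; apply: def_mem.
- by move=> i j G t gt; apply: def_eq.
- by move=> f _ IH G t gt; apply: def_not; apply: IH.
- by move=> f g _ IHf _ IHg G t gt; apply: def_and; [apply: IHf|apply: IHg].
- by move=> f g _ IHf _ IHg G t gt; apply: def_or; [apply: IHf|apply: IHg].
- by move=> f g _ IHf _ IHg G t gt; apply: def_imp; [apply: IHf|apply: IHg].
- move=> x y f /eqP xy _ IH G t gt /=.
  apply: (@def_iff _ _ (fun e => exists a, a ∈ t y e /\ sat [eta t^~ e with x |-> a] f)).
    by move=> e; rewrite eqxx eq_sym (negbTE xy).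
  apply: def_ex => //.
  apply: def_iff (IH (ext G) (fun i e => if i == x then e.2 else t i e.1) _) => [e|i].
    by apply: sat_eq => i /=.
  case: (i == x); [exact: good_var0|exact: good_fst].
- move=> x y f /eqP xy _ IH G t gt /=.
  apply: (@def_iff _ _ (fun e => forall a, a ∈ t y e -> sat [eta t^~ e with x |-> a] f)).
    by move=> e; rewrite eqxx eq_sym (negbTE xy).
  apply: def_all => //.
  apply: def_iff (IH (ext G) (fun i e => if i == x then e.2 else t i e.1) _) => [e|i].
    by apply: sat_eq => i /=.
  case: (i == x); [exact: good_var0|exact: good_fst].
Qed.

Definition def1 (P : A -> Prop) := @def (ext c0) (fun e => P e.2).
Definition def2 (P : A -> A -> Prop) := @def (ext (ext c0)) (fun e => P e.1.2 e.2).
Definition good1 (t : A -> A) := @good (ext c0) (fun e => t e.2).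

(** The way back to syntax, needed to apply the schemes: variables 0 and 1 are the arguments, and
    the constants sit at the variables from 2 on. *)
Lemma def2_formula (x0 : A) (P : A -> A -> Prop) : def2 P ->
  exists f v, delta0 f /\ forall x y, P x y <-> sat [eta v with 0 |-> x, 1 |-> y] f.
Proof.
move=> [f [r [df tr E]]].
have /choice[h Hh] k : exists hm : nat * A, (hm.1 = k.+2 -> r k = fun=> hm.2) /\
    (hm.1 <> k.+2 -> forall e : ext (ext c0), r k e = if hm.1 is 0 then e.1.2 else e.2) /\
    (hm.1 = 0 \/ hm.1 = 1 \/ hm.1 = k.+2).
  case: (tr k) => [[->|[u [->|[w []]] -> //]]|[m ->]].
  - by exists (1, x0); split=> //=; split=> //; right; left.
  - by exists (0, x0); split=> //=; split=> //; left.
  - by exists (k.+2, m); split=> //=; split=> //; right; right.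
exists (rename (fun k => (h k).1) f), (fun k => (h k.-2).2); split.
  exact: delta0_rename.
move=> x y; rewrite (E (tt, x, y)) sat_rename; apply: sat_eq => k /=.
have [H1 [H2 H3]] := Hh k.
case: H3 => [H|[H|H]].
- by rewrite H2 H.
- by rewrite H2 H.
- by rewrite H1 // H.
Qed.

Lemma def2_ext (P : A -> Prop) : def1 P -> def2 (fun x _ => P x).
Proof. by move=> dP; exact: def_fst dP. Qed.

Lemma def2_subst (P : A -> A -> Prop) (G : ctx) (t u : G -> A) :
  def2 P -> good t -> good u -> def (fun e => P (t e) (u e)).
Proof.
move=> dP gt gu.
apply: (good_subst (P := fun e y => P (t e) y)) => //.
apply: (good_subst (G := ext G) (t := fun e => t e.1) (P := fun e x => P x e.2)).
  exact: good_fst.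
pose s (e : ext (ext G)) : ext (ext c0) := (tt, e.2, e.1.2).
have ss : csub s.
  move=> w [->|[z [->|[? []]] -> //]]; left; last by left.
  by right; exists snd => //; left.
exact: (def_csub ss dP).
Qed.

Lemma def1_subst (P : A -> Prop) (G : ctx) (t : G -> A) :
  def1 P -> good t -> def (fun e => P (t e)).
Proof. by move=> dP gt; apply: (def2_subst (def2_ext dP) gt gt). Qed.

Lemma good1_subst (f : A -> A) (G : ctx) (t : G -> A) :
  good1 f -> good t -> good (fun e => f (t e)).
Proof.
move=> gf gt D s ss P dP.
apply: (good_subst (t := fun d => t (s d)) (P := fun d x => P (d, f x))).
  exact: good_csub ss gt.
pose s' (d : ext D) : ext c0 := (tt, d.2).
have ss' : csub s' by move=> u [->|[? []]//]; left; left.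
have := gf (ext D) s' ss' (fun d => P (d.1.1, d.2)); apply.
exact: (def_csub (@csub_skip D) dP).
Qed.

End Definability.

(** * Syntax-directed proofs of definability *)

Ltac good_app_hook := fail.
Ltac good_tac := first
  [ assumption
  | match goal with
    | |- good (fun _ => ?m) => exact: good_const
    end
  | exact: good_var0
  | good_app_hook
  | match goal with
    | H : good1 ?f |- good (fun _ => ?f _) => apply: (good1_subst H)
    end
  | match goal with
    | |- @good ?A (ext ?G) (fun e => ?t (fst e)) => refine (@good_fst A G t _)
    | |- @good ?A (ext ?G) (fun e => ?t (fst (fst e))) =>
        refine (@good_fst A G (fun e : G => t (fst e)) _)
    | |- @good ?A (ext ?G) (fun e => ?t (fst (fst (fst e)))) =>
        refine (@good_fst A G (fun e : G => t (fst (fst e))) _)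
    | |- @good ?A (ext ?G) (fun e => ?t (fst (fst (fst (fst e))))) =>
        refine (@good_fst A G (fun e : G => t (fst (fst (fst e)))) _)
    | |- @good ?A (ext ?G) (fun e => ?t (fst (fst (fst (fst (fst e)))))) =>
        refine (@good_fst A G (fun e : G => t (fst (fst (fst (fst e))))) _)
    | |- @good ?A (ext ?G) (fun e => ?t (fst (fst (fst (fst (fst (fst e))))))) =>
        refine (@good_fst A G (fun e : G => t (fst (fst (fst (fst (fst e)))))) _)
    | |- @good ?A (ext ?G) (fun e => ?t (fst (fst (fst (fst (fst (fst (fst e)))))))) =>
        refine (@good_fst A G (fun e : G => t (fst (fst (fst (fst (fst (fst e))))))) _)
    | |- @good ?A (ext ?G) (fun e => ?t (fst (fst (fst (fst (fst (fst (fst (fst e))))))))) =>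
        refine (@good_fst A G (fun e : G => t (fst (fst (fst (fst (fst (fst (fst e)))))))) _)
    | |- @good ?A (ext ?G) (fun e => ?t (fst (fst (fst (fst (fst (fst (fst (fst (fst e)))))))))) =>
        refine (@good_fst A G (fun e : G => t (fst (fst (fst (fst (fst (fst (fst (fst e))))))))) _)
    | |- @good ?A (ext ?G) (fun e => ?t (fst (fst (fst (fst (fst (fst (fst (fst (fst (fst e))))))))))) =>
        refine (@good_fst A G (fun e : G => t (fst (fst (fst (fst (fst (fst (fst (fst (fst e)))))))))) _)
    end; good_tac ].

Ltac dfn_hook := fail.
Ltac dfn1 := rewrite /def1 /def2; cbv beta; match goal with
  | H : ?P |- ?P => exact: H
  | H : def2 ?P |- def (fun _ => ?P _ _) => apply: (def2_subst H)
  | H : def1 ?P |- def (fun _ => ?P _) => apply: (def1_subst H)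
  | |- _ => dfn_hook
  | |- def (fun _ => _ /\ _) => apply: def_and
  | |- def (fun _ => _ \/ _) => apply: def_or
  | |- def (fun _ => ~ _) => apply: def_not
  | |- def (fun _ => _ <-> _) => apply: def_equiv
  | |- def (fun _ => exists2 x, x ∈ _ & _) => apply: def_ex2
  | |- def (fun _ => exists x, x ∈ _ /\ _) => apply: def_ex
  | |- def (fun _ => forall x, x ∈ _ -> _) => apply: def_all
  | |- def (fun _ => _ -> _) => apply: def_imp
  | |- def (fun _ => bin _ _) => apply: def_mem
  | |- def (fun _ => subs _ _) => apply: def_all
  | |- def (fun _ => _ = _) => apply: def_eq
  | |- good _ => good_tac
  end.
Ltac dfn := repeat dfn1.

(** * Set operations *)

Section MacTheory.
Variables (A : structure) (mA : Mac A).
Implicit Types a b f p q r u v w x y z : A.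

Lemma subs_anti a b : subs a b -> subs b a -> a = b.
Proof. by move=> ab ba; apply: (mac_ext mA) => z; split; [apply: ab|apply: ba]. Qed.

Definition upair x y := projT1 (cid (mac_pairing mA x y)).
Lemma in_upair w x y : w ∈ upair x y <-> w = x \/ w = y.
Proof. exact: (projT2 (cid (mac_pairing mA x y))). Qed.

Definition un x := projT1 (cid (mac_union mA x)).
Lemma in_un z x : z ∈ un x <-> exists2 w, w ∈ x & z ∈ w.
Proof. exact: (projT2 (cid (mac_union mA x))). Qed.

Definition pow x := projT1 (cid (mac_powerset mA x)).
Lemma in_pow z x : z ∈ pow x <-> subs z x.
Proof. exact: (projT2 (cid (mac_powerset mA x))). Qed.

Definition e0 := projT1 (cid (mac_emptyset mA)).
Lemma in_e0 z : ~ z ∈ e0.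
Proof. exact: (projT2 (cid (mac_emptyset mA))). Qed.

Definition un2 a b := un (upair a b).
Lemma in_un2 z a b : z ∈ un2 a b <-> z ∈ a \/ z ∈ b.
Proof.
rewrite in_un; split=> [[w /in_upair[]->]|[]]; [by left|by right| |].
  by exists a => //; apply/in_upair; left.
by exists b => //; apply/in_upair; right.
Qed.

Lemma is_upairE z x y : is_upair z x y <-> z = upair x y.
Proof.
split=> [H|-> w]; last exact: in_upair.
by apply: (mac_ext mA) => w; rewrite in_upair.
Qed.

Lemma upair_inj1 x y : upair x x = upair y y -> x = y.
Proof.
move=> e; have : x ∈ upair y y by rewrite -e; apply/in_upair; left.
by case/in_upair.
Qed.

Definition opair x y := upair (upair x x) (upair x y).

Lemma is_opairE p x y : is_opair p x y <-> p = opair x y.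
Proof.
split=> [H|-> w]; last by rewrite in_upair !is_upairE.
by apply: (mac_ext mA) => w; rewrite H in_upair !is_upairE.
Qed.

Lemma opair_inj x y x' y' : opair x y = opair x' y' -> x = x' /\ y = y'.
Proof.
move=> e.
have xx : x = x'.
  have : upair x x ∈ opair x' y' by rewrite -e; apply/in_upair; left.
  case/in_upair; first exact: upair_inj1.
  move=> e2; have : x' ∈ upair x x by rewrite e2; apply/in_upair; left.
  by case/in_upair.
subst x'; split=> //.
have key u v : opair x u = opair x v -> v = x \/ v = u.
  move=> e'; have : upair x v ∈ opair x u by rewrite e'; apply/in_upair; right.
  case/in_upair => e2.
    have : v ∈ upair x x by rewrite -e2; apply/in_upair; right.
    by case/in_upair; left.
  have : v ∈ upair x u by rewrite -e2; apply/in_upair; right.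
  by case/in_upair; [left|right].
case: (key _ _ e) => // e'; subst y'.
by case: (key _ _ (esym e)).
Qed.

Lemma graphE r x y : graph r x y <-> opair x y ∈ r.
Proof.
by split=> [[p /is_opairE -> //]|H]; exists (opair x y) => //; apply/is_opairE.
Qed.

Lemma def_upair (G : ctx A) (z x y : G -> A) : good z -> good x -> good y ->
  def (fun e => z e = upair (x e) (y e)).
Proof.
move=> gz gx gy; apply: (@def_iff _ _ _ (fun e => [/\ x e ∈ z e, y e ∈ z e &
   forall w, w ∈ z e -> w = x e \/ w = y e])).
  move=> e; rewrite -is_upairE; split=> [H|[? ? H] w].
    by split; [apply/H; left|apply/H; right|move=> w /H].
  by split; [exact: H|case=> ->].
apply: (@def_iff _ _ _ (fun e => x e ∈ z e /\ (y e ∈ z e /\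
   forall w, w ∈ z e -> w = x e \/ w = y e))); first by move=> e; split; [case|move=> [? []]].
by dfn.
Qed.

Lemma def_opair (G : ctx A) (z x y : G -> A) : good z -> good x -> good y ->
  def (fun e => z e = opair (x e) (y e)).
Proof.
move=> gz gx gy; apply: (@def_iff _ _ _ (fun e =>
   (exists2 w, w ∈ z e & w = upair (x e) (x e)) /\
   (exists2 w, w ∈ z e & w = upair (x e) (y e)) /\
   forall w, w ∈ z e -> w = upair (x e) (x e) \/ w = upair (x e) (y e))).
  move=> e; split=> [->|[[u xz eu] [[u2 yz eu2] H]]].
    split; first by exists (upair (x e) (x e)) => //; apply/in_upair; left.
    split; first by exists (upair (x e) (y e)) => //; apply/in_upair; right.
    by move=> w /in_upair.
  subst u u2; apply/is_upairE => w; split; first exact: H.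
  by case=> ->.
apply: def_and; last apply: def_and.
- apply: def_ex2 => //; apply: def_upair; dfn.
- apply: def_ex2 => //; apply: def_upair; dfn.
- apply: def_all => //; apply: def_or; apply: def_upair; dfn.
Qed.

Lemma def_opairin (G : ctx A) (x y f : G -> A) : good x -> good y -> good f ->
  def (fun e => opair (x e) (y e) ∈ f e).
Proof.
move=> gx gy gf; apply: (@def_iff _ _ _ (fun e => exists2 p, p ∈ f e & p = opair (x e) (y e))).
  by move=> e; split=> [H|[p pf pe]]; [exists (opair (x e) (y e))|rewrite -pe].
apply: def_ex2 => //; apply: def_opair; dfn.
Qed.

(** Both components lie in the union of the pair, which bounds the two quantifiers. *)
Lemma def_expair (G : ctx A) (p : G -> A) (Q : G -> A -> A -> Prop) : good p ->
  @def _ (ext (ext G)) (fun e => Q e.1.1 e.1.2 e.2) ->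
  def (fun e => exists x y, p e = opair x y /\ Q e x y).
Proof.
move=> gp dQ.
apply: (@def_iff _ _ _ (fun e => exists2 x, x ∈ un (p e) & exists2 y, y ∈ un (p e) &
   p e = opair x y /\ Q e x y)).
  move=> e; split=> [[x [y [pe q]]]|[x _ [y _ pq]]]; last by exists x, y.
  exists x; last exists y => //.
    by apply/in_un; exists (upair x x); rewrite ?pe; apply/in_upair; left.
  by apply/in_un; exists (upair x y); rewrite ?pe; apply/in_upair; right.
have exun (D : ctx A) (t : D -> A) (R : D -> A -> Prop) : good t ->
    @def _ (ext D) (fun e => R e.1 e.2) -> def (fun e => exists2 x, x ∈ un (t e) & R e x).
  move=> gt dR; apply: (@def_iff _ _ _ (fun e => exists2 u, u ∈ t e &
      exists2 x, x ∈ u & R e x)).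
    move=> e; split=> [[x /in_un[u ut xu] r]|[u ut [x xu r]]].
      by exists u => //; exists x.
    by exists x => //; apply/in_un; exists u.
  by apply: def_ex2 => //; apply: def_ex2; [good_tac|exact: def_skip].
apply: (exun) => //; apply: (exun); first by good_tac.
by apply: def_and => //; apply: def_opair; good_tac.
Qed.

(** Any element acts as a total function: where no unique value is recorded the result is [f]
    itself, a default that is already a term of the context. *)
Definition app f q :=
  if pselect (exists v, opair q v ∈ f /\ forall v', opair q v' ∈ f -> v' = v) is left h
  then projT1 (cid h) else f.

Lemma app_eq f q v : opair q v ∈ f -> (forall v', opair q v' ∈ f -> v' = v) -> app f q = v.
Proof.
move=> H1 H2; rewrite /app; case: pselect => [h|[]]; last by exists v.
by case: (cid h) => v' /= [/H2].
Qed.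

(** A recorded value is a component of an element of [f], so a bounded search finds it, and
    uniqueness is a bounded statement as well. *)
Lemma def_app (D : ctx A) (f q : D -> A) P : good f -> good q -> @def _ (ext D) P ->
  def (fun d => P (d, app (f d) (q d))).
Proof.
move=> gfd gqd dP.
pose R (g k v : A) := (exists2 p, p ∈ g & p = opair k v) /\
  forall p, p ∈ g -> forall v', (exists x y, p = opair x y /\ (x = k /\ y = v')) -> v' = v.
apply: (@def_iff _ _ _ (fun d =>
   (exists2 p, p ∈ f d & exists x y, p = opair x y /\ (R (f d) (q d) y /\ P (d, y)))
   \/ (~ (exists2 p, p ∈ f d & exists x y, p = opair x y /\ R (f d) (q d) y)
      /\ P (d, f d)))).
  move=> d.
  have RE y : R (f d) (q d) y <-> opair (q d) y ∈ f d /\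
       forall v', opair (q d) v' ∈ f d -> v' = y.
    split=> [[[p H pE] K]|[H K]]; [subst p|]; split=> //.
    - by move=> v' /K; apply; exists (q d), v'.
    - by exists (opair (q d) y).
    - by move=> p pf v' [x' [y' [pE [xE yE]]]]; subst x' y' p; exact: K.
  rewrite /app; case: pselect => [h|no].
    case: (cid h) => v /= [H K].
    split=> [Pv|].
      left; exists (opair (q d) v) => //; exists (q d), v; split=> //; split=> //.
      exact/RE.
    case=> [[_ _ [x [y [_ [/RE[/K -> _]]]]]]//|[no _]]; exfalso; apply: no.
    exists (opair (q d) v) => //; exists (q d), v; split=> //; exact/RE.
  split=> [Pf|].
    right; split=> // -[_ _ [x [y [_ /RE r]]]]; by apply: no; exists y.
  by case=> [[_ _ [x [y [_ [/RE r _]]]]]|[]//]; exfalso; apply: no; exists y.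
have dR (E : ctx A) (g k v : E -> A) : good g -> good k -> good v ->
    def (fun e => R (g e) (k e) (v e)).
  move=> gg gk gv; apply: def_and.
    by apply: def_ex2 => //; apply: def_opair; dfn.
  apply: (@def_iff _ _ _ (fun e => forall p, p ∈ g e -> ~ exists x y, p = opair x y /\
       (x = k e /\ ~ y = v e))).
    move=> e; split=> H p pg; last first.
      move=> v' [x [y [pE [xk yv]]]]; apply: contrapT => nv; apply: (H p pg).
      by exists x, y; split=> //; split=> //; rewrite yv.
    move=> [x [y [pE [xk nv]]]]; apply: nv; apply: (H p pg).
    by exists x, y.
  by apply: def_all => //; apply: def_not; apply: def_expair; dfn.
apply: def_or.
  apply: def_ex2 => //; apply: def_expair; first by good_tac.
  apply: def_and; first by apply: dR; good_tac.
  pose s3 (e : ext (ext (ext D))) : ext D := (e.1.1.1, e.2).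
  have : @csub _ (ext (ext (ext D))) (ext D) s3.
    move=> u [->|[w' cw ->]]; first by left; left.
    left; right; exists (w' \o fst \o fst) => //; right; exists (w' \o fst) => //.
    by right; exists w'.
  by move/def_csub; apply.
apply: def_and; last exact: (gfd D id (@csub_id _ D) P dP).
apply: def_not; apply: def_ex2 => //; apply: def_expair; first by good_tac.
by apply: dR; good_tac.
Qed.

Lemma good_app (G : ctx A) (f q : G -> A) : good f -> good q ->
  good (fun e => app (f e) (q e)).
Proof.
move=> gf gq D s ss P dP.
exact: (def_app (good_csub ss gf) (good_csub ss gq)).
Qed.

Lemma sep_ex (P : A -> Prop) a : def1 P -> exists b, forall x, x ∈ b <-> x ∈ a /\ P x.
Proof.
move=> /def2_ext /(def2_formula a)[f [v [df E]]].
have [b bE] := mac_separation mA 0 [eta v with 1 |-> a] a df.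
exists b => x; rewrite bE (E x a); split=> -[H K]; split=> //; move: K; apply sat_eq => k /=;
  by case: k => [|[|k]].
Qed.

Lemma prod_ex a b : exists c, forall p, p ∈ c <-> exists x y, p = opair x y /\ (x ∈ a /\ y ∈ b).
Proof.
have [|c cE] := @sep_ex (fun p => exists x y, p = opair x y /\ (x ∈ a /\ y ∈ b))
  (pow (pow (un2 a b))).
  by apply: def_expair; dfn.
exists c => p; rewrite cE; split=> [[]//|H]; split=> //.
case: H => x [y [-> [xa yb]]]; apply/in_pow => u /in_upair[]->; apply/in_pow => z /in_upair[]->;
  by apply/in_un2; auto.
Qed.

Definition prod a b := projT1 (cid (prod_ex a b)).
Lemma in_prod x y a b : opair x y ∈ prod a b <-> x ∈ a /\ y ∈ b.
Proof.
have -> := (projT2 (cid (prod_ex a b))) (opair x y).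
by split=> [[x' [y' [/opair_inj[-> ->]]]]//|H]; exists x, y.
Qed.
Lemma prodP p a b : p ∈ prod a b -> exists x y, [/\ p = opair x y, x ∈ a & y ∈ b].
Proof. by move/(projT2 (cid (prod_ex a b)) p) => [x [y [-> [? ?]]]]; exists x, y. Qed.

(** Allows quantifiers over functions to be bounded by a powerset. *)
Lemma restrict_ex f w b : exists2 g, g ∈ pow (prod w b) &
  forall q, q ∈ w -> app f q ∈ b -> app g q = app f q.
Proof.
have [|g gE] := @sep_ex (fun p => exists x y, p = opair x y /\ y = app f x) (prod w b).
  by apply: def_expair; [good_tac|apply: def_eq; [good_tac|apply: good_app; good_tac]].
exists g; first by apply/in_pow => p /gE[].
move=> q qw fb; apply: app_eq.
  by apply/gE; split; [apply/in_prod|exists q, (app f q)].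
by move=> v /gE[_ [x [y [/opair_inj[-> ->]]]]].
Qed.

Lemma mem_ind (P : A -> Prop) a : def1 P ->
  (forall x, x ∈ a -> (forall y, y ∈ x -> y ∈ a -> P y) -> P x) -> forall x, x ∈ a -> P x.
Proof.
move=> dP H x xa; apply: contrapT => nP.
have [|b bE] := @sep_ex (fun x => ~ P x) a; first by dfn.
have [|y /bE[ya nPy] ymin] := @mac_foundation _ mA b.
  by move/(_ x); apply; apply/bE.
apply: nPy; apply: H => // z zy za; apply: contrapT => nPz.
by apply: (ymin z zy); apply/bE.
Qed.

Lemma mem_irr x : ~ x ∈ x.
Proof.
move=> xx; have [|y] := @mac_foundation _ mA (upair x x).
  by move/(_ x); apply; apply/in_upair; left.
move=> /in_upair yx; have -> : y = x by case: yx.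
by move/(_ x xx); apply; apply/in_upair; left.
Qed.

(** * Tuples *)

Definition tup (s : seq A) := foldr opair e0 s.

Lemma tup_inj s s' : size s = size s' -> tup s = tup s' -> s = s'.
Proof.
elim: s s' => [|x s IH] [|x' s'] //= [e] /opair_inj[-> /IH ->] //.
Qed.

Definition allin (P : A -> Prop) (s : seq A) := all (fun x => `[< P x >]) s.

Definition tupof n (P : A -> Prop) q := exists s, [/\ size s = n, allin P s & q = tup s].

Lemma tupof0 P q : tupof 0 P q <-> q = e0.
Proof. by split=> [[[|x s] [] //]|->]; exists [::]. Qed.

Lemma tupofS n P q : tupof n.+1 P q <-> exists x y, q = opair x y /\ (P x /\ tupof n P y).
Proof.
split=> [[[|x s] [//= [sn] /andP[/asboolP Px Ps] ->]]|[x [y [-> [Px [s [sn Ps ->]]]]]]].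
  by exists x, (tup s); split=> //; split=> //; exists s.
exists (x :: s); split=> //=; first by rewrite sn.
by apply/andP; split=> //; apply/asboolP.
Qed.

Lemma def_tupof n (G : ctx A) (P : G -> A -> Prop) (q : G -> A) : good q ->
  @def _ (ext G) (fun e => P e.1 e.2) -> def (fun e => tupof n (P e) (q e)).
Proof.
elim: n G P q => [|n IH] G P q gq dP.
  apply: (@def_iff _ _ _ (fun e => q e = e0)); first by move=> e; exact: tupof0.
  by dfn.
apply: (@def_iff _ _ _ (fun e => exists x y, q e = opair x y /\ (P e x /\ tupof n (P e) y))).
  by move=> e; exact: tupofS.
apply: def_expair => //; apply: def_and; first exact: def_fst dP.
apply: (IH (ext (ext G)) (fun e => P e.1.1) (fun e => e.2)); first by good_tac.
pose s3 (e : ext (ext (ext G))) : ext G := (e.1.1.1, e.2).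
have : @csub _ (ext (ext (ext G))) (ext G) s3.
  move=> u [->|[w' cw ->]]; first by left; left.
  left; right; exists (w' \o fst \o fst) => //; right; exists (w' \o fst) => //.
  by right; exists w'.
by move=> H; exact: (def_csub H dP).
Qed.

Fixpoint tups n X := if n is m.+1 then prod X (tups m X) else upair e0 e0.

Lemma in_tups n X q : q ∈ tups n X <-> tupof n (fun x => x ∈ X) q.
Proof.
elim: n q => [|n IH] q; first by rewrite tupof0 /= in_upair; tauto.
rewrite tupofS /=; split=> [/prodP[x [y [-> xX /IH yt]]]|[x [y [-> [xX yt]]]]].
  by exists x, y.
by apply/in_prod; split=> //; apply/IH.
Qed.

Lemma tup_in n X s : size s = n -> allin (fun x => x ∈ X) s -> tup s ∈ tups n X.
Proof. by move=> sn sX; apply/in_tups; exists s. Qed.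

End MacTheory.

Ltac good_app_hook ::= apply: good_app.
Ltac dfn_hook ::= match goal with
  | |- def (fun _ => _ = upair _ _ _) => apply: def_upair
  | |- def (fun _ => _ = opair _ _ _) => apply: def_opair
  | |- def (fun _ => bin (opair _ _ _) _) => apply: def_opairin
  | |- def (fun _ => exists x y, _ = opair _ x y /\ _) => apply: def_expair
  | |- def (fun _ => tupof _ _ _ _) => apply: def_tupof
  end.

(** * Collection, separation and uniformisation in [MOST] *)

Section MostTheory.
Variables (A : structure) (mostA : MOST A).
Let mA : Mac A := most_mac mostA.
Implicit Types a b f p q r s t u v w x y z : A.
Local Notation opair := (opair mA).
Local Notation app := (app mA).
Local Notation un := (un mA).
Local Notation prod := (prod mA).

Lemma coll_ex (P : A -> A -> Prop) w : def2 P -> (forall x, x ∈ w -> exists y, P x y) ->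
  exists c, forall x, x ∈ w -> exists2 y, y ∈ c & P x y.
Proof.
move=> /(def2_formula w)[f [v [df E]]] H.
have [//||c cE] := @most_collection _ mostA f 0 1 v w df.
  by move=> x /H[y /E Pxy]; exists y.
by exists c => x /cE[y yc /E Pxy]; exists y.
Qed.

Lemma sep_sigma (P : A -> A -> Prop) a : def2 P ->
  exists b, forall x, x ∈ b <-> x ∈ a /\ exists y, P x y.
Proof.
move=> /(def2_formula a)[f [v [df E]]].
have sf : sigma1 (fEx 1 f) by do 2!constructor.
have [b bE] := most_separation mostA 0 v a sf.
exists b => x; rewrite bE; split=> -[xa [y]] H; split=> //; exists y.
  by apply/E; move: H; apply sat_eq; case=> [|[|k]].
by move/E: H; apply sat_eq; case=> [|[|k]].
Qed.

(** [sigma1]-separation isolates the points that have a witness, collection bounds the witnesses,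
    and a well-ordering of the bound selects the least one. *)
Lemma unif (P : A -> A -> Prop) w : def2 P ->
  exists f, forall q, q ∈ w -> (exists x, P q x) -> P q (app f q).
Proof.
move=> dP; have [w' wE] := sep_sigma w dP.
have [|B BE] := @coll_ex P w' dP; first by move=> x /wE[].
have [r [irr trs tot mn]] := mac_wo mA B.
have [|f fE] := @sep_ex _ mA (fun p => exists q x, p = opair q x /\ (P q x /\
   forall x', x' ∈ B -> P q x' -> x' = x \/ opair x x' ∈ r)) (prod w' B).
  by dfn.
exists f => q qw ex; have qw' : q ∈ w' by apply/wE.
have [|S SE] := @sep_ex _ mA (fun x => P q x) B; first by dfn.
have [||x /SE[xB Px] xmin] := mn S.
- by move=> z /SE[].
- by have [x xB Px] := BE q qw'; move/(_ x); apply; apply/SE.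
have qf : opair q x ∈ f.
  apply/fE; split; first exact/in_prod.
  exists q, x; split=> //; split=> // x' x'B Px'.
  by case: (xmin x') => [|->|/(graphE mA)]; [apply/SE|left|right].
rewrite (app_eq qf) // => x' /fE[/in_prod[_ x'B] [q' [x'' [/opair_inj[<- <-] [Px' min']]]]].
case: (min' x xB Px) => // /(graphE mA) H1.
case: (xmin x') => // [|H2]; first exact/SE.
by case: (irr x xB); apply: (trs x x' x).
Qed.

Lemma fun_ex (t : A -> A) w : good1 t -> exists f, forall q, q ∈ w -> app f q = t q.
Proof.
move=> gt; have [|f fE] := @unif (fun q x => x = t q) w; first by dfn.
by exists f => q qw; apply: fE => //; exists (t q).
Qed.

Lemma range_ex f w : exists b, forall q, q ∈ w -> app f q ∈ b.
Proof.
have [||b bE] := @coll_ex (fun q x => x = app f q) w; first by dfn.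
  by move=> q _; exists (app f q).
by exists b => q /bE[_ yb <-] //.
Qed.

(** * The collapse of a well-founded relation *)

Section Collapse.
Variables w E : A.

(* An attempt relates [s] only to sets [y] whose elements are exactly the
   values related to [E]-predecessors of [s]; attempts are closed under unions. *)
Definition attempt p := forall s y, opair s y ∈ p -> s ∈ w /\
  ((forall s', s' ∈ w -> opair s' s ∈ E -> exists2 y', y' ∈ y & opair s' y' ∈ p) /\
   (forall y', y' ∈ y -> exists2 s', s' ∈ w & opair s' s ∈ E /\ opair s' y' ∈ p)).

Lemma def_attempt : def1 attempt.
Proof.
apply: (@def_iff _ (ext (c0 A)) _ (fun e => forall z, z ∈ e.2 -> ~ exists s y, z = opair s y /\ ~
 (s ∈ w /\
  ((forall s', s' ∈ w -> opair s' s ∈ E -> exists2 y', y' ∈ y & opair s' y' ∈ e.2) /\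
   (forall y', y' ∈ y -> exists2 s', s' ∈ w & opair s' s ∈ E /\ opair s' y' ∈ e.2))))).
  move=> [[] p] /=; split=> [H z zp [s [y [zE nH]]]|H s y syp].
    by apply: nH; apply: H; rewrite -zE.
  by apply: contrapT => nH; apply: (H _ syp); exists s, y.
by dfn.
Qed.

Lemma attempt_un b : (forall p, p ∈ b -> attempt p) -> attempt (un b).
Proof.
move=> H s y /in_un[p pb /(H p pb)[sw [H1 H2]]]; split=> //; split.
- move=> s' s'w /H1[] // y' y'y H'; exists y' => //.
  by apply/in_un; exists p.
- move=> y' /H2[s' s'w [H3 H4]]; exists s' => //; split=> //.
  by apply/in_un; exists p.
Qed.

Hypothesis wf : forall u, subs u w -> ~ is_empty u ->
  exists2 s, s ∈ u & forall s', s' ∈ u -> ~ opair s' s ∈ E.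

Lemma attempt_collect u : (forall s, s ∈ u -> exists p, attempt p /\ exists y, opair s y ∈ p) ->
  exists2 p, attempt p & forall s, s ∈ u -> exists y, opair s y ∈ p.
Proof.
move=> H.
have dat := def_attempt.
pose hasdom p s := exists2 z, z ∈ p & exists s' y, z = opair s' y /\ s' = s.
have hasdomE p s : hasdom p s <-> exists y, opair s y ∈ p.
  split=> [[z zp [s' [y [zE e]]]]|[y syp]]; first by exists y; rewrite -e -zE.
  by exists (opair s y) => //; exists s, y.
have [||b bE] := @coll_ex (fun s p => attempt p /\ hasdom p s) u.
- by rewrite /hasdom; dfn.
- by move=> s /H[p [? ?]]; exists p; split=> //; apply/hasdomE.
have [|b' b'E] := @sep_ex _ mA attempt b; first by [].
exists (un b'); first by apply: attempt_un => p /b'E[].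
move=> s /bE[p pb [ap /hasdomE[y syp]]]; exists y; apply/in_un; exists p => //.
exact/b'E.
Qed.

(** At an [E]-minimal point where no attempt is defined, attempts covering its predecessors can be
    collected, united and extended by one pair. Values are not claimed to be unique; each
    application proves what it needs about them. *)
Lemma collapse : exists2 p, attempt p & forall s, s ∈ w -> exists y, opair s y ∈ p.
Proof.
apply: attempt_collect => s0 s0w; apply: contrapT => ns0.
have dat := def_attempt.
have [|D DE] := @sep_sigma (fun s p => attempt p /\ exists2 z, z ∈ p &
  exists s' y, z = opair s' y /\ s' = s) w; first by dfn.
have [|D' D'E] := @sep_ex _ mA (fun s => ~ s ∈ D) w; first by dfn.
have inD s : s ∈ w -> ~ s ∈ D' -> exists p, attempt p /\ exists y, opair s y ∈ p.
  move=> sw nD'; have /DE[_ [p [ap [z zp [s' [y [zE e]]]]]]] : s ∈ D.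
    by apply: contrapT => nD; apply: nD'; apply/D'E.
  by exists p; split=> //; exists y; rewrite -e -zE.
have [||s /D'E[sw nsD] smin] := @wf D'; first by move=> z /D'E[].
  move/(_ s0); apply; apply/D'E; split=> // /DE[_ [p [ap [z zp [s' [y [zE e]]]]]]].
  by apply: ns0; exists p; split=> //; exists y; rewrite -e -zE.
have [|u uE] := @sep_ex _ mA (fun s' => opair s' s ∈ E) w; first by dfn.
have [|P aP PE] := @attempt_collect u.
  by move=> s' /uE[s'w s's]; apply: inD => // /smin.
have [|Y YE] := @sep_ex _ mA (fun y => exists2 s', s' ∈ w &
  opair s' s ∈ E /\ opair s' y ∈ P) (un (un P)); first by dfn.
have {}YE y : y ∈ Y <-> exists2 s', s' ∈ w & opair s' s ∈ E /\ opair s' y ∈ P.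
  rewrite YE; split=> [[]//|H]; split=> //; case: H => s' _ [_ syP].
  apply/in_un; exists (upair mA s' y); last by apply/in_upair; right.
  by apply/in_un; exists (opair s' y) => //; apply/in_upair; right.
pose Q := un2 mA P (upair mA (opair s Y) (opair s Y)).
have PQ z : z ∈ P -> z ∈ Q by move=> zP; apply/in_un2; left.
apply: nsD; apply/DE; split=> //; exists Q; split; last first.
  exists (opair s Y); last by exists s, Y.
  by apply/in_un2; right; apply/in_upair; left.
move=> s1 y1 /in_un2[/aP[s1w [H1 H2]]|].
  split=> //; split.
    by move=> s' s'w /H1[] // y' y'y /PQ; exists y'.
  by move=> y' /H2[s' s'w [? /PQ ?]]; exists s'.
move=> H; have {H} /opair_inj[-> ->] : opair s1 y1 = opair s Y by case/in_upair: H.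
split=> //; split.
  move=> s' s'w s's; have [|y syP] := PE s'; first exact/uE.
  by exists y; [apply/YE; exists s'|exact: PQ].
by move=> y' /YE[s' s'w [? /PQ ?]]; exists s'.
Qed.

End Collapse.

(** * Ordinals *)

Lemma ord_in a x : is_ordinal a -> x ∈ a -> is_ordinal x.
Proof.
move=> [ta [irr trs tot mn]] xa; have xsa := ta x xa.
split.
  move=> y yx z zy; apply: (trs z y x) => //; last exact: xsa.
  exact: (ta y (xsa y yx)).
split.
- by move=> y /xsa; apply: irr.
- by move=> y z u /xsa ? /xsa ? /xsa ?; apply: trs.
- by move=> y z /xsa ? /xsa ?; apply: tot.
- by move=> s sx; apply: mn => z /sx /xsa.
Qed.

Lemma ord_trans a x y : is_ordinal a -> x ∈ a -> y ∈ x -> y ∈ a.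
Proof. by move=> [ta _] xa; exact: ta. Qed.

(** If [d] is a proper subset, it equals the least element of [a] outside [d]. *)
Lemma trans_sub_ord d a : is_ordinal a -> is_trans d -> subs d a -> d = a \/ d ∈ a.
Proof.
move=> [ta [irr trs tot mn]] td da.
have [|s sE] := @sep_ex _ mA (fun x => ~ x ∈ d) a; first by dfn.
case: (pselect (is_empty s)) => [es|ns].
  left; apply: (subs_anti mA) => // x xa; apply: contrapT => nxd.
  by apply: (es x); apply/sE.
have [|//|x /sE[xa nxd] xmin] := mn s; first by move=> z /sE[].
right; suff -> : d = x by [].
apply: (subs_anti mA) => z.
  move=> zd; case: (tot z x (da z zd) xa) => // [e|xz]; first by rewrite -e in nxd.
  by case: nxd; apply: (td z).
move=> zx; apply: contrapT => nzd.
have za : z ∈ a by exact: (ta x).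
case: (xmin z) => [|e|xz]; first exact/sE.
  by apply: (irr x xa); rewrite {1}e in zx.
by apply: (irr x xa); apply: (trs x z x).
Qed.

(** The intersection is a transitive subset of both; were it an element of both, it would be an
    element of itself. *)
Lemma ord_tricho a b : is_ordinal a -> is_ordinal b -> [\/ a ∈ b, a = b | b ∈ a].
Proof.
move=> oa ob; have [ta _] := oa; have [tb _] := ob.
have [|d dE] := @sep_ex _ mA (fun x => x ∈ b) a; first by dfn.
have td : is_trans d.
  by move=> x /dE[xa xb] y yx; apply/dE; split; [apply: (ta x)|apply: (tb x)].
case: (@trans_sub_ord d a oa td) => [x /dE[]//|da|da].
  case: (@trans_sub_ord d b ob td) => [x /dE[]//|db|db].
    by constructor 2; rewrite -da.
  by constructor 1; rewrite -da.
case: (@trans_sub_ord d b ob td) => [x /dE[]//|db|db].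
  by constructor 3; rewrite -db.
by case: (@mem_irr _ mA d); apply/dE.
Qed.

(** The collapse of a well-ordering of [x] is single-valued and injective, and its range is the
    ordinal. *)
Lemma wo_bij x : exists a f g, [/\ is_ordinal a,
  forall y, y ∈ x -> app f y ∈ a /\ app g (app f y) = y &
  forall y, y ∈ a -> app g y ∈ x /\ app f (app g y) = y].
Proof.
have [r [irr trs tot mn]] := mac_wo mA x.
have {}trs a b c : a ∈ x -> b ∈ x -> c ∈ x -> opair a b ∈ r -> opair b c ∈ r -> opair a c ∈ r.
  by move=> ? ? ?; rewrite -!graphE; apply: trs.
have {}irr a : a ∈ x -> ~ opair a a ∈ r by rewrite -graphE; apply: irr.
have wfr u : subs u x -> ~ is_empty u ->
    exists2 s, s ∈ u & forall s', s' ∈ u -> ~ opair s' s ∈ r.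
  move=> ux nu; have [s su smin] := mn u ux nu; exists s => // s' s'u s's.
  case: (smin s' s'u) => [e|/(graphE mA) ss'].
    by rewrite e in s's; apply: (irr s) => //; apply: ux.
  by apply: (irr s); [apply: ux|apply: (trs s s' s) => //; apply: ux].
have [p ap pT] := collapse wfr.
have uniq s y y' : opair s y ∈ p -> opair s y' ∈ p -> y = y'.
  move=> syp sy'p.
  have [|D DE] := @sep_ex _ mA (fun s => exists2 z, z ∈ p & exists s1 y, z = opair s1 y /\
    (s1 = s /\ exists2 z', z' ∈ p & exists s2 y', z' = opair s2 y' /\ (s2 = s /\ ~ y = y'))) x.
    by dfn.
  have {}DE s1 : s1 ∈ D <-> exists y y', [/\ opair s1 y ∈ p, opair s1 y' ∈ p & y <> y'].
    rewrite DE; split.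
      move=> [_ [z zp [t1 [y1 [zE [e1 [z' z'p [t2 [y2 [z'E [e2 ne]]]]]]]]]]].
      by subst; exists y1, y2.
    move=> [y1 [y2 [H1 H2 ne]]]; split; first by have [] := ap _ _ H1.
    exists (opair s1 y1) => //; exists s1, y1; split=> //; split=> //.
    by exists (opair s1 y2) => //; exists s1, y2.
  apply: contrapT => ne.
  have [||s1 /DE[y1 [y2 [H1 H2 ne']]] min1] := wfr D.
  - by move=> z /DE[y1 [y2 [/ap[]]]].
  - by move/(_ s); apply; apply/DE; exists y, y'.
  have key u v : opair s1 u ∈ p -> opair s1 v ∈ p -> subs u v.
    move=> /ap[_ [_ K1]] /ap[_ [K2 _]] z /K1[s' s'x [s's1 s'z]].
    have [z' z'v s'z'] := K2 s' s'x s's1.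
    suff -> : z = z' by [].
    apply: contrapT => nz; apply: (min1 s') => //; apply/DE; by exists z, z'.
  by apply: ne'; apply: (subs_anti mA); apply: key.
have inj s s' y : opair s y ∈ p -> opair s' y ∈ p -> s = s'.
  have half t t' z : opair t z ∈ p -> opair t' z ∈ p -> ~ opair t t' ∈ r.
    move=> tz t'z tt'; have [tx _] := ap _ _ tz; have [_ [K _]] := ap _ _ t'z.
    have [y' y'z ty'] := K t tx tt'.
    by rewrite (uniq _ _ _ ty' tz) in y'z; exact: (@mem_irr _ mA z).
  move=> sy s'y; have [sx _] := ap _ _ sy; have [s'x _] := ap _ _ s'y.
  by case: (tot s s' sx s'x) => // /(graphE mA) H; [case: (half _ _ _ sy s'y)|case: (half _ _ _ s'y sy)].
have [|a aE] := @sep_ex _ mA (fun y => exists2 s, s ∈ x & opair s y ∈ p) (un (un p)).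
  by dfn.
have {}aE y : y ∈ a <-> exists2 s, s ∈ x & opair s y ∈ p.
  rewrite aE; split=> [[]//|H]; split=> //; case: H => s _ syp.
  apply/in_un; exists (upair mA s y); last by apply/in_upair; right.
  by apply/in_un; exists (opair s y) => //; apply/in_upair; right.
have ta : is_trans a.
  move=> y /aE[s sx /ap[_ [_ K]]] z /K[s' s'x [_ s'z]]; apply/aE; by exists s'.
have oa : is_ordinal a.
  have tota y z : y ∈ a -> z ∈ a -> [\/ y ∈ z, y = z | z ∈ y].
    move=> /aE[s sx sy] /aE[s' s'x s'z].
    have [_ [K1 _]] := ap _ _ sy; have [_ [K2 _]] := ap _ _ s'z.
    case: (tot s s' sx s'x) => [/(graphE mA) H|e|/(graphE mA) H].
    - by have [y' y'z sy'] := K2 s sx H; constructor 1; rewrite (uniq _ _ _ sy sy').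
    - by subst s'; constructor 2; apply: uniq sy s'z.
    - by have [y' y'z sy'] := K1 s' s'x H; constructor 3; rewrite (uniq _ _ _ s'z sy').
  split=> //; split=> //.
  - by move=> y _; exact: mem_irr.
  - move=> y z u ya za /aE[s3 s3x s3u] yz zu.
    have [_ [K3 K3']] := ap _ _ s3u.
    have [s2 s2x [s23 s2z]] := K3' z zu.
    have [_ [_ K2']] := ap _ _ s2z.
    have [s1 s1x [s12 s1y]] := K2' y yz.
    have [y' y'u s1y'] := K3 s1 s1x (trs _ _ _ s1x s2x s3x s12 s23).
    by rewrite (uniq _ _ _ s1y s1y').
  - move=> s sa ns; have [y ys ymin] := mac_foundation mA ns.
    exists y => // z zs; case: (tota y z (sa _ ys) (sa _ zs)) => [yz|->|zy]; [by right|by left|].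
    by case: (ymin z zy).
have [|g gE] := @unif (fun y s => opair s y ∈ p) a; first by dfn.
exists a, p, g.
have gE' y : y ∈ a -> opair (app g y) y ∈ p.
  by move=> ya; apply: gE => //; have /aE[s _ H] := ya; exists s.
have pE s y : opair s y ∈ p -> app p s = y.
  by move=> syp; apply: app_eq => // y' sy'; apply: uniq sy' syp.
split=> // y.
  move=> yx; have [z yz] := pT y yx; have za : z ∈ a by apply/aE; exists y.
  by rewrite (pE _ _ yz); split=> //; apply: inj (gE' z za) yz.
by move=> ya; have H := gE' y ya; split; [have [] := ap _ _ H|exact: pE].
Qed.

Lemma TC_ex x : exists2 t, is_trans t & x ∈ t /\ forall u, is_trans u -> x ∈ u -> subs t u.
Proof.
have [t tt xt] := mac_tc mA (upair mA x x).
have {}xt : x ∈ t by apply: xt; apply/in_upair; left.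
pose tr u := forall y, y ∈ u -> subs y u.
have [|t' t'E] := @sep_ex _ mA (fun z => forall u, u ∈ pow mA t -> tr u -> x ∈ u -> z ∈ u) t.
  by rewrite /tr; dfn.
exists t'; first move=> y /t'E[yt H] z zy; last split.
- apply/t'E; split; first exact: (tt y).
  by move=> u up tu xu; apply: (tu y) => //; apply: H.
- by apply/t'E.
move=> u tu xu z /t'E[zt H].
(* The trace of [u] on [t] is transitive, contains [x] and lies in [pow t], over which the
   intersection was formed. *)
have [|v vE] := @sep_ex _ mA (fun z => z ∈ u) t; first by dfn.
have /vE[] // : z ∈ v.
apply: H; first by apply/in_pow => y /vE[].
  by move=> y /vE[yt yu] y' y'y; apply/vE; split; [apply: (tt y)|apply: (tu y)].
by apply/vE.
Qed.

End MostTheory.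

(** * Small sets of a cut *)

Section Cut.
Variables (M : structure) (mostM : MOST M) (I : set M) (cutI : H_cut I).
Let mM : Mac M := most_mac mostM.
Let mostI : MOST (substr I). Proof. by case: cutI. Qed.
Let mI : Mac (substr I) := most_mac mostI.
Implicit Types a b c f i p q r s t u v w x y z : M.
Local Notation opairI := (opair mI).
Local Notation upairI := (upair mI).
Local Notation opair := (opair mM).
Local Notation app := (app mM).
Local Notation un := (un mM).
Local Notation prod := (prod mM).
Local Notation pow := (pow mM).
Local Notation upair := (upair mM).

Lemma cut_mem x y : I y -> x ∈ y -> I x.
Proof. by case: cutI => -[H _] _ _; apply: H. Qed.

Lemma cut_sub x y : I y -> subs x y -> I x.
Proof. by case: cutI => -[_ H] _ _; apply: H. Qed.

(** Subsets of [x] in [M] already belong to [I], so the powerset computed in [I] includes the one of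
    [M]; the latter is then in [I] as a subset. *)
Lemma cut_pow x : I x -> I (pow x).
Proof.
move=> Ix; have [y yE] := mac_powerset mI (exist _ x Ix).
apply: (cut_sub (svalP y)) => z /in_pow zx; have Iz := cut_sub Ix zx.
by apply: (iffRL (yE (exist _ z Iz))) => u uz; apply: zx.
Qed.

Lemma cut_un x : I x -> I (un x).
Proof.
move=> Ix; have [y yE] := mac_union mI (exist _ x Ix).
apply: (cut_sub (svalP y)) => z /in_un[w wx zw].
have Iw := cut_mem Ix wx; have Iz := cut_mem Iw zw.
by apply: (iffRL (yE (exist _ z Iz))); exists (exist _ w Iw).
Qed.

Lemma cut_upair x y : I x -> I y -> I (upair x y).
Proof.
move=> Ix Iy; have [z zE] := mac_pairing mI (exist _ x Ix) (exist _ y Iy).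
apply: (cut_sub (svalP z)) => w /in_upair[]->.
  by apply: (iffRL (zE (exist _ x Ix))); left.
by apply: (iffRL (zE (exist _ y Iy))); right.
Qed.

Lemma cut_e0 : I (e0 mM).
Proof.
have [x _] := mac_emptyset mI.
by apply: (cut_sub (svalP x)) => z /in_e0.
Qed.

Lemma cut_prod x y : I x -> I y -> I (prod x y).
Proof.
move=> Ix Iy; apply: (@cut_sub _ (pow (pow (un2 mM x y)))).
  by do 2!apply: cut_pow; apply: cut_un; apply: cut_upair.
move=> p /prodP[a [b [-> ax bx]]]; apply/in_pow => u /in_upair[]->; apply/in_pow => z;
  by case/in_upair => ->; apply/in_un2; auto.
Qed.

Lemma cut_tups n x : I x -> I (tups mM n x).
Proof.
move=> Ix; elim: n => [|n IH] /=; last exact: cut_prod.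
by apply: cut_upair; apply: cut_e0.
Qed.

Lemma sval_upair (x y : substr I) : sval (upairI x y) = upair (sval x) (sval y).
Proof.
apply/(is_upairE mM) => w; split=> [wp|].
  have Iw := cut_mem (svalP _) wp.
  by case: (iffLR (in_upair mI (exist _ w Iw) x y) wp) => <-; [left|right].
by case=> ->; [apply: (iffRL (in_upair mI x x y)); left|apply: (iffRL (in_upair mI y x y)); right].
Qed.

Lemma sval_opair (x y : substr I) : sval (opairI x y) = opair (sval x) (sval y).
Proof. exact: etrans (sval_upair _ _) (congr2 upair (sval_upair _ _) (sval_upair _ _)). Qed.

(** Membership on [t] pulls back along [r] to a relation [E] on a subset [W] of [i]. Both lie in
    [I], so the relation can be collapsed inside [I], and the collapse has to return the elements of
    [t]. *)
Lemma cut_cover t i r : is_trans t -> I i ->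
  (forall z, z ∈ t -> exists2 s, s ∈ i & app r s = z) -> forall z, z ∈ t -> I z.
Proof.
move=> tt Ii cov.
have [|W WE] := @sep_ex _ mM (fun s => app r s ∈ t) i; first by dfn.
have [|E EE] := @sep_ex _ mM (fun p => exists s s', p = opair s s' /\ app r s ∈ app r s')
  (prod i i); first by dfn.
have IW : I W by apply: (cut_sub Ii) => s /WE[].
have IE : I E by apply: (cut_sub (cut_prod Ii Ii)) => s /EE[].
have {}EE s s' : s ∈ i -> s' ∈ i -> opair s s' ∈ E <-> app r s ∈ app r s'.
  move=> si s'i; rewrite EE in_prod; split=> [[_ [x [y [/opair_inj[-> ->]]]]]//|H].
  by split=> //; exists s, s'.
pose W' : substr I := exist _ W IW; pose E' : substr I := exist _ E IE.
(* Well-foundedness of [E] is verified in [M], through the images under [r]; the collapse itself is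
   that of the model [substr I]. *)
have [|p ap pT] := @collapse _ mostI W' E'.
  move=> u uW nu.
  have [|V VE] := @sep_ex _ mM (fun z => exists2 s, s ∈ sval u & app r s = z) t.
    by dfn.
  have uW' s : s ∈ sval u -> s ∈ W.
    by move=> su; exact: (uW (exist _ s (cut_mem (svalP u) su))).
  have [|z /VE[zt [s su sz]] zmin] := @mac_foundation _ mM V.
    move=> eV; apply: nu => s su; have /WE[si st] := uW' _ su.
    by apply: (eV (app r (sval s))); apply/VE; split=> //; exists (sval s).
  exists (exist _ s (cut_mem (svalP u) su)) => // s' s'u.
  rewrite /bin /= sval_opair /=.
  have /WE[si st] := uW' _ su; have /WE[s'i s't] := uW' _ s'u.
  rewrite EE // sz => H; apply: (zmin _ H); apply/VE; split=> //.
  by exists (sval s').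
have ap' s y : opair s y ∈ sval p -> s ∈ W /\
  ((forall s', s' ∈ W -> opair s' s ∈ E -> exists2 y', y' ∈ y & opair s' y' ∈ sval p) /\
   (forall y', y' ∈ y -> exists2 s', s' ∈ W & opair s' s ∈ E /\ opair s' y' ∈ sval p)).
  move=> syp; have Io := cut_mem (svalP p) syp.
  have Iu : I (upair s y) by apply: (cut_mem Io); apply/in_upair; right.
  have Is : I s by apply: (cut_mem Iu); apply/in_upair; left.
  have Iy : I y by apply: (cut_mem Iu); apply/in_upair; right.
  have [|sW [K1 K2]] := ap (exist _ s Is) (exist _ y Iy); first by rewrite /bin /= sval_opair.
  split=> //; split.
    move=> s' s'W; have Is' := cut_mem IW s'W.
    have := K1 (exist _ s' Is') s'W; rewrite {1}/bin /= sval_opair /= => K /K[y' y'y].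
    by rewrite /bin /= sval_opair; exists (sval y').
  move=> y' y'y; have Iy' := cut_mem Iy y'y.
  have [s' s'W] := K2 (exist _ y' Iy') y'y.
  by rewrite /bin /= !sval_opair /=; exists (sval s').
(* The bound [un (un (sval p))] on [y] makes this [delta0], as induction on [z] requires; it
   contains the components of all pairs in [p]. *)
have key : forall z, z ∈ t -> forall s, s ∈ W -> app r s = z ->
    forall y, y ∈ un (un (sval p)) -> opair s y ∈ sval p -> y = z.
  apply: (mem_ind mM); first by dfn.
  move=> z zt IH s sW sz y _ /ap'[_ [K1 K2]]; have /WE[si _] := sW.
  have IH' s' y' : s' ∈ W -> opair s' s ∈ E -> opair s' y' ∈ sval p -> y' = app r s'.
    move=> s'W s's s'y'; have /WE[s'i s't] := s'W.
    apply: (IH (app r s') _ s't s' s'W erefl y' _ s'y'); first by rewrite -sz; apply/EE.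
    apply/in_un; exists (upair s' y'); last by apply/in_upair; right.
    by apply/in_un; exists (opair s' y') => //; apply/in_upair; right.
  apply: (subs_anti mM) => x.
    move=> /K2[s' s'W [s's s'x]]; rewrite (IH' _ _ s'W s's s'x) -sz.
    by apply/EE => //; have /WE[] := s'W.
  move=> xz; have xt : x ∈ t by apply: (tt z).
  have [s' s'i s'x] := cov x xt.
  have s'W : s' ∈ W by apply/WE; rewrite s'x.
  have s's : opair s' s ∈ E by apply/EE => //; rewrite s'x sz.
  have [y' y'y s'y'] := K1 s' s'W s's.
  by rewrite -s'x -(IH' _ _ s'W s's s'y').
move=> z zt; have [s si sz] := cov z zt.
have sW : s ∈ W by apply/WE; rewrite sz.
have [y] := pT (exist _ s (cut_mem IW sW)) sW.
rewrite /bin /= sval_opair /= => syp.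
rewrite -(key z zt s sW sz (sval y)) //; first exact: svalP.
apply/in_un; exists (upair s (sval y)); last by apply/in_upair; right.
by apply/in_un; exists (opair s (sval y)) => //; apply/in_upair; right.
Qed.

(** Size by covering instead of bijection passes at once to subsets and images. *)
Definition small X := exists i r, I i /\ forall z, z ∈ X -> exists2 s, s ∈ i & app r s = z.

Lemma small_image X Y f : (forall y, y ∈ Y -> exists2 x, x ∈ X & app f x = y) ->
  small X -> small Y.
Proof.
move=> H [i [r [Ii cov]]].
have [|g gE] := @fun_ex _ mostM (fun s => app f (app r s)) i.
  by rewrite /good1; dfn.
exists i, g; split=> // y /H[x /cov[s si <-] <-].
by exists s => //; rewrite gE.
Qed.

Lemma small_sub X Y : subs Y X -> small X -> small Y.
Proof.
by move=> YX [i [r [Ii cov]]]; exists i, r; split=> // y /YX /cov.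
Qed.

Lemma topless_cut c : (forall x, x ∈ c -> I x /\ is_ordinal x) -> I c.
Proof.
case: cutI => _ [_ _ H] _ K; apply: H => x /K[Ix [tx [irr trs tot mn]]].
exists (exist _ x Ix) => //; split.
  by move=> y yx z zy; exact: (tx _ yx).
split.
- by move=> a; apply: irr.
- by move=> a b u; apply: trs.
- move=> a b ax bx; case: (tot _ _ ax bx) => [||]; [by constructor 1| |by constructor 3].
  by move=> e; constructor 2; apply: eq_sig_hprop => // ?; exact: Prop_irrelevance.
- move=> s sx ns; have [||a asv amin] := mn (sval s).
  + by move=> z zs; exact: (sx (exist _ z (cut_mem (svalP s) zs))).
  + by move=> es; apply: ns => z; exact: es.
  exists (exist _ a (cut_mem (svalP s) asv)) => // b bs.
  case: (amin _ bs) => [e|]; [left|by right].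
  by apply: eq_sig_hprop => // ?; exact: Prop_irrelevance.
Qed.

(** [cut_cover] puts the elements of [a] into [I], and toplessness then puts [a] itself there. *)
Lemma small_ord a : is_ordinal a -> small a -> I a.
Proof.
move=> oa [i [r [Ii cov]]]; apply: topless_cut => x xa; split; last exact: ord_in oa xa.
by case: (oa) => ta _; exact: (cut_cover ta Ii cov).
Qed.

Lemma small_by_ord X : small X -> exists a r, [/\ is_ordinal a, I a &
  forall z, z ∈ X -> exists2 s, s ∈ a & app r s = z].
Proof.
move=> [i [r [Ii cov]]]; have [a [f [g [oa fE gE]]]] := wo_bij mostM i.
have Ia : I a.
  apply: small_ord => //; exists i, f; split=> // z za.
  by have [? ?] := gE z za; exists (app g z).
have [|h hE] := @fun_ex _ mostM (fun s => app r (app g s)) a.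
  by rewrite /good1; dfn.
exists a, h; split=> // z /cov[s /fE[fa gf] <-].
by exists (app f s) => //; rewrite hE // gf.
Qed.

Lemma large_trans t d : is_trans t -> d ∈ t -> ~ I d -> ~ small t.
Proof. by move=> tt dt nI [i [r [Ii cov]]]; apply: nI; exact: (cut_cover tt Ii cov). Qed.

(** For [d] outside [I], the transitive closure of its singleton is large, and so is an ordinal in
    bijection with it. *)
Lemma large_ord_ex : exists2 c, is_ordinal c & ~ small c.
Proof.
have [d nd] : exists d, ~ I d.
  apply: contrapT => H; case: cutI => _ [_ nI _] _; apply: nI.
  by apply/seteqP; split=> // x _; apply: contrapT => nx; apply: H; exists x.
have [t tt [dt _]] := TC_ex mostM d.
have [c [f [g [oc fE gE]]]] := wo_bij mostM t.
exists c => // sc; apply: (large_trans tt dt nd); apply: (small_image (f := g)) sc => y /fE[? ?].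
by exists (app f y).
Qed.

Lemma large_remove X Y x : (forall y, y ∈ X -> y = x \/ y ∈ Y) -> ~ small X -> ~ small Y.
Proof.
move=> XY nX [i [r [Ii cov]]]; apply: nX.
(* The set [i] itself is the additional index, used for [x]; it differs from the old indices since
   [i] is not in [i]. *)
pose i' := un2 mM i (upair i i).
have [|g gE] := @unif _ mostM (fun s z => (s ∈ i /\ z = app r s) \/ (s = i /\ z = x)) i'.
  by dfn.
exists i', g; split; first by apply: cut_un; do 2?apply: cut_upair.
move=> y /XY[->|/cov[s si <-]].
  have ii : i ∈ i' by apply/in_un2; right; apply/in_upair; left.
  exists i => //; case: (gE i ii) => [|[/(mem_irr mM)]|[]//] //.
  by exists x; right.
have si' : s ∈ i' by apply/in_un2; left.
exists s => //; case: (gE s si') => [|[]|[e _]] //; first by exists (app r s); left.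
by rewrite e in si; case: (mem_irr mM si).
Qed.

(** Compare the order types of [X] and [t]. If that of [X] is not longer, all of [X] injects into
    [t]; otherwise an initial part of [X] is in bijection with [t], hence large. *)
Lemma large_inj c X d t : is_ordinal c -> subs X c -> ~ small X ->
  is_trans t -> d ∈ t -> ~ I d ->
  exists Y g, [/\ subs Y X, ~ small Y, forall y, y ∈ Y -> app g y ∈ t &
    forall y y', y ∈ Y -> y' ∈ Y -> app g y = app g y' -> y = y'].
Proof.
move=> oc Xc nX tt dt nd; have nt := large_trans tt dt nd.
have [a [f [g [oa fE gE]]]] := wo_bij mostM X.
have [b [f' [g' [ob fE' gE']]]] := wo_bij mostM t.
have [|h hE] := @fun_ex _ mostM (fun y => app g' (app f y)) X; first by rewrite /good1; dfn.
have [|Y YE] := @sep_ex _ mM (fun y => app f y ∈ b) X; first by dfn.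
exists Y, h; split.
- by move=> y /YE[].
- case: (ord_tricho mostM oa ob) => ab.
  + have XY : subs X Y.
      move=> y yX; apply/YE; split=> //; have [ya _] := fE y yX.
      exact: (ord_trans ob ab ya).
    by apply: contra_not nX; apply: small_sub.
  + have XY : subs X Y by move=> y yX; apply/YE; split=> //; have [ya _] := fE y yX; rewrite -ab.
    by apply: contra_not nX; apply: small_sub.
  apply: contra_not nt; apply: (small_image (f := h)) => y yt.
  have [yb gy] := fE' y yt; have [gX gf] := gE _ (ord_trans oa ab yb).
  exists (app g (app f' y)); first by apply/YE; rewrite gf.
  by rewrite hE // gf gy.
- by move=> y /YE[yX fb]; rewrite hE //; have [] := gE' _ fb.
- move=> y y' /YE[yX fb] /YE[y'X fb']; rewrite !hE // => e.
  have [_ e1] := gE' _ fb; have [_ e2] := gE' _ fb'.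
  have [_ <-] := fE y yX; have [_ <-] := fE y' y'X.
  by rewrite -e1 -e2 e.
Qed.

End Cut.

(** * The partition theorem *)

Section MapTuples.
Variables (M : structure) (mM : Mac M).
Local Notation opair := (opair mM).
Local Notation app := (app mM).
Local Notation tup := (tup mM).

Lemma allin_sub (P Q : M -> Prop) s : (forall y, P y -> Q y) -> allin P s -> allin Q s.
Proof. by move=> PQ; apply: sub_all => y /asboolP /PQ /asboolP. Qed.

Lemma allin_and (P Q : M -> Prop) s :
  allin P s -> allin Q s -> allin (fun y => P y /\ Q y) s.
Proof.
elim: s => //= y s IH /andP[/asboolP Py Ps] /andP[/asboolP Qy Qs].
by apply/andP; split; [apply/asboolP|exact: IH].
Qed.

Lemma tupof_sub n (P Q : M -> Prop) q : (forall y, P y -> Q y) ->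
  tupof mM n P q -> tupof mM n Q q.
Proof. by move=> PQ [s [sn Ps ->]]; exists s; split=> //; apply: allin_sub Ps. Qed.

Definition maptup n (r q q' : M) :=
  exists s, [/\ size s = n, q = tup s & q' = tup (map (app r) s)].

Lemma def_maptup n (G : ctx M) (r q q' : G -> M) : good r -> good q -> good q' ->
  def (fun e => maptup n (r e) (q e) (q' e)).
Proof.
elim: n G r q q' => [|n IH] G r q q' gr gq gq'.
  apply: (@def_iff _ _ _ (fun e => q e = e0 mM /\ q' e = e0 mM)); last by dfn.
  by move=> e; split=> [[[|x s] []//]|[? ?]]; exists [::].
apply: (@def_iff _ _ _ (fun e => exists a b, q e = opair a b /\ exists a' b',
  q' e = opair a' b' /\ (a' = app (r e) a /\ maptup n (r e) b b'))).
  move=> e; split=> [[[|x s] [//= [sn] qE q'E]]|[a [b [qE [a' [b' [q'E [aE [s [sn bE b'E]]]]]]]]]].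
    exists x, (tup s); split=> //.
    by exists (app (r e) x), (tup (map (app (r e)) s)); split=> //; split=> //; exists s.
  by exists (a :: s); split; rewrite /= ?sn // -?b'E -?aE -?bE.
by do 2!(apply: def_expair; first by good_tac);
  apply: def_and; [dfn|apply: IH; good_tac].
Qed.

End MapTuples.

Ltac dfn_hook ::= match goal with
  | |- def (fun _ => _ = upair _ _ _) => apply: def_upair
  | |- def (fun _ => _ = opair _ _ _) => apply: def_opair
  | |- def (fun _ => bin (opair _ _ _) _) => apply: def_opairin
  | |- def (fun _ => exists x y, _ = opair _ x y /\ _) => apply: def_expair
  | |- def (fun _ => tupof _ _ _ _) => apply: def_tupof
  | |- def (fun _ => maptup _ _ _ _ _) => apply: def_maptup
  end.

Section Partition.
Variables (M : structure) (mostM : MOST M) (I : set M) (cutI : H_cut I).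
Let mM : Mac M := most_mac mostM.
Implicit Types a b f i p q r t u v w x y z X Y Z : M.
Local Notation opair := (opair mM).
Local Notation app := (app mM).
Local Notation un := (un mM).
Local Notation prod := (prod mM).
Local Notation pow := (pow mM).
Local Notation upair := (upair mM).
Local Notation tup := (tup mM).
Local Notation tups := (tups mM).
Local Notation tupof := (tupof mM).
Local Notation maptup := (maptup mM).
Local Notation small := (small mostM I).

Variables (c : M) (oc : is_ordinal c) (nIc : ~ I c).

(** * The Erdős-Rado tree of a colouring *)

Section Tree.
Variables (n : nat) (X f i : M).
Hypotheses (Xc : subs X c) (Ii : I i).
Local Notation F z q := (app (app f z) q).
Hypothesis fval : forall x q, x ∈ X -> q ∈ tups n X -> F x q ∈ i.

Definition agree Z z x := forall q, q ∈ tups n X ->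
  tupof n (fun y => y ∈ Z /\ y ∈ z) q -> F z q = F x q.

(* [branch Z x x] says that [Z] is the set of predecessors of [x] in the
   Erdős–Rado tree of the colouring [F]. *)
Definition branch Z y x := subs Z X /\
  forall z, z ∈ X -> (z ∈ Z <-> z ∈ y /\ agree Z z x).

Lemma agree_sub Z Z' z x : (forall y, y ∈ z -> y ∈ Z' -> y ∈ Z) ->
  agree Z z x -> agree Z' z x.
Proof.
by move=> ZZ H q qX tq; apply: H => //; apply: tupof_sub tq => y [yZ yz]; split=> //; apply: ZZ.
Qed.

Lemma c_trans x y z : x ∈ c -> y ∈ x -> z ∈ y -> z ∈ x.
Proof. by move=> xc yx zy; exact: (ord_trans (ord_in oc xc) yx zy). Qed.

Lemma c_mem x y : x ∈ c -> y ∈ x -> y ∈ c.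
Proof. exact: ord_trans oc. Qed.

Lemma c_tricho x y : x ∈ c -> y ∈ c -> [\/ x ∈ y, x = y | y ∈ x].
Proof. by case: oc => _ [_ _ H _]; exact: H. Qed.

(** Whether [z] is on a branch depends only on the part of the branch below [z]. *)
Lemma branch_uniq Z Z' y y' x : y ∈ c -> y' ∈ c -> branch Z y x -> branch Z' y' x ->
  forall z, z ∈ c -> z ∈ y -> z ∈ y' -> (z ∈ Z <-> z ∈ Z').
Proof.
move=> yc y'c [ZX H] [ZX' H'].
apply: (mem_ind mM); first by dfn.
move=> z zc IH zy zy'.
case: (pselect (z ∈ X)) => [zX|nzX]; last by split=> [/ZX|/ZX'].
have E w : w ∈ z -> (w ∈ Z <-> w ∈ Z').
  move=> wz; apply: IH => //; [exact: c_mem wz|exact: c_trans wz|exact: c_trans wz].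
rewrite H // H' //; split=> -[_ K]; split=> //; apply: agree_sub K => w wz /E; exact.
Qed.

Lemma branch_ex x : x ∈ X -> forall y, y ∈ c -> exists2 Z, Z ∈ pow X & branch Z y x.
Proof.
move=> xX; apply: (mem_ind mM); first by rewrite /branch /agree; dfn.
move=> y yc IH.
have [|Z ZE] := @sep_ex _ mM (fun z => z ∈ y /\ exists2 Z', Z' ∈ pow X &
  branch Z' z x /\ agree Z' z x) X; first by rewrite /branch /agree; dfn.
exists Z; first by apply/in_pow => z /ZE[].
split=> [z /ZE[]//|z zX].
case: (pselect (z ∈ y)) => [zy|nzy]; last by split=> [/ZE[_ []]|[]].
have zc := c_mem yc zy; have [Zz _ bz] := IH z zy zc.
have E w : w ∈ z -> (w ∈ Z <-> w ∈ Zz).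
  move=> wz; have wc := c_mem zc wz; have wy := c_trans yc zy wz.
  case: (pselect (w ∈ X)) => [wX|nwX]; last first.
    by split=> [/ZE[]//|]; case: bz => bz _ /bz.
  have [_ bz'] := bz; rewrite bz' // ZE; split.
    move=> [_ [_ [Z' _ [bZ' aZ']]]]; split=> //; apply: agree_sub aZ' => u uw uZ.
    apply/(branch_uniq wc zc bZ' bz) => //; [exact: c_mem uw|exact: c_trans uw].
  move=> [_ aw]; split=> //; split=> //; have [Zw Zwp bw] := IH w wy wc.
  exists Zw => //; split=> //; apply: agree_sub aw => u uw uZ.
  apply/(branch_uniq wc zc bw bz) => //; [exact: c_mem uw|exact: c_trans uw].
rewrite ZE; split.
  move=> [_ [_ [Z' _ [bZ' aZ']]]]; split=> //; apply: agree_sub aZ' => u uz /E uZ.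
  by apply/(branch_uniq zc zc bZ' bz) => //; [exact: c_mem uz|exact: uZ].
move=> [_ aZ]; split=> //; split=> //.
have [Z' Zp bZ'] := IH z zy zc; exists Z' => //; split=> //.
apply: agree_sub aZ => u uz uZ; apply/E => //.
by apply/(branch_uniq zc zc bZ' bz) => //; exact: c_mem uz.
Qed.

Section Inject.
Variables (lam x x' Z Z' r r' : M).
Hypotheses (xX : x ∈ X) (xX' : x' ∈ X) (bZ : branch Z x x) (bZ' : branch Z' x' x').
Hypothesis cov : forall z, z ∈ Z -> exists2 s, s ∈ lam & app r s = z.
Hypothesis cov' : forall z, z ∈ Z' -> exists2 s, s ∈ lam & app r' s = z.
Hypothesis sameR : forall s s', s ∈ lam -> s' ∈ lam ->
  ((app r s ∈ Z /\ app r s' ∈ Z) /\ ~ app r s' ∈ app r s) <->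
  ((app r' s ∈ Z' /\ app r' s' ∈ Z') /\ ~ app r' s' ∈ app r' s).
Hypothesis sameT : forall q v, q ∈ tups n lam -> v ∈ i ->
  (exists2 q', q' ∈ tups n X & tupof n (fun y => y ∈ Z) q' /\ (maptup n r q q' /\ v = F x q'))
  <-> (exists2 q', q' ∈ tups n X &
    tupof n (fun y => y ∈ Z') q' /\ (maptup n r' q q' /\ v = F x' q')).

(** Membership is irreflexive, so the diagonal of the coded non-membership relation records which
    indices name points of the branch. *)
Let dom s : s ∈ lam -> (app r s ∈ Z <-> app r' s ∈ Z').
Proof.
move=> sl; have H := sameR sl sl; have ni := @mem_irr _ mM; split=> K.
  by have [[]] := iffLR H (conj (conj K K) (@ni _)).
by have [[]] := iffRL H (conj (conj K K) (@ni _)).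
Qed.

Let Zc z : z ∈ Z -> z ∈ c. Proof. by case: bZ => ZX _ /ZX /Xc. Qed.
Let Zc' z : z ∈ Z' -> z ∈ c. Proof. by case: bZ' => ZX _ /ZX /Xc. Qed.

Let lt s s' : s ∈ lam -> s' ∈ lam -> app r s ∈ Z -> app r s' ∈ Z ->
  (app r s' ∈ app r s <-> app r' s' ∈ app r' s).
Proof.
move=> sl s'l sZ s'Z; have H := sameR sl s'l.
have sZ' := iffLR (dom sl) sZ; have s'Z' := iffLR (dom s'l) s'Z.
split=> K; apply: contrapT => nK.
  by have [_] := iffRL H (conj (conj sZ' s'Z') nK).
by have [_] := iffLR H (conj (conj sZ s'Z) nK).
Qed.

(** A tuple from [P] is the image of one tuple of indices under both coverings, and [sameT] compares
    the colours attached to that index tuple. *)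
Let colour P : (forall z, P z -> z ∈ Z) ->
  (forall s, s ∈ lam -> P (app r s) -> app r' s = app r s) ->
  forall q, q ∈ tups n X -> tupof n P q -> F x q = F x' q.
Proof.
move=> PZ fixr q qX [ss [sn sP qE]].
have [us [usz ul uE ur']] : exists us, [/\ size us = n, allin (fun y => y ∈ lam) us,
    map (app r) us = ss & map (app r') us = ss].
  rewrite -sn; elim: ss sP {qE sn} => [|y ss IH] /=; first by exists [::].
  move=> /andP[/asboolP Py /IH[us [uz ul ur ur']]].
  have [t tl tE] := cov (PZ _ Py).
  exists (t :: us); split=> /=; rewrite ?uz ?ur ?ur' ?tE ?fixr ?tE //.
  by apply/andP; split=> //; apply/asboolP.
have /(iffLR (sameT (tup_in mM usz ul) (fval xX qX))) : exists2 q', q' ∈ tups n X &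
    tupof n (fun y => y ∈ Z) q' /\ (maptup n r (tup us) q' /\ F x q = F x q').
  exists q => //; split; first by exists ss; split=> //; apply: allin_sub sP.
  by split=> //; exists us; rewrite uE.
move=> [q' _ [_ [[us' [us'z /tup_inj e q'E] ->]]]].
by rewrite q'E -e ?usz ?us'z // ur' qE.
Qed.

(** Suppose the coverings agree below [z]. Then the two branches have the same part below [z] and
    below [z']. If [z] and [z'] differed, the smaller of them would meet the condition for lying on
    the other branch as well, and would then be an element of itself. *)
Let fixr : forall z, z ∈ Z -> forall s, s ∈ lam -> app r s = z -> app r' s = z.
Proof.
apply: (mem_ind mM); first by dfn.
move=> z zZ IH s sl sz; apply: contrapT => nz.
set z' := app r' s in nz *.
have sZ : app r s ∈ Z by rewrite sz.
have z'Z' : z' ∈ Z' by apply/dom.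
have zc := Zc zZ; have z'c := Zc' z'Z'.
have W y : (y ∈ Z /\ y ∈ z) <-> (y ∈ Z' /\ y ∈ z').
  split=> -[yZ yz].
    have [t tl ty] := cov yZ; have tE := IH y yz yZ t tl ty.
    have tZ : app r t ∈ Z by rewrite ty.
    split; first by rewrite -tE; apply/dom.
    by rewrite -tE; apply/(lt sl tl) => //; rewrite sz ty.
  have [t tl ty] := cov' yZ; have tZ : app r t ∈ Z by apply/dom; rewrite ?ty.
  have tz : app r t ∈ z by rewrite -sz; apply/lt => //; rewrite ty.
  by have := IH _ tz tZ t tl erefl; rewrite ty => ->.
have col q : q ∈ tups n X -> tupof n (fun y => y ∈ Z /\ y ∈ z) q -> F x q = F x' q.
  apply: colour => [y []//|t tl [tZ tz]]; exact: (IH _ tz tZ t tl).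
have [ZX bz] := bZ; have [ZX' bz'] := bZ'.
have zX := ZX z zZ; have z'X := ZX' z' z'Z'.
have [zx az] := iffLR (bz z zX) zZ.
have [z'x' az'] := iffLR (bz' z' z'X) z'Z'.
case: (c_tricho zc z'c) => [zz'|e|z'z]; last first.
- have z'Z : z' ∈ Z.
    apply/bz => //; split; first exact: c_trans (Xc xX) zx z'z.
    move=> q qX tq.
    have tq1 : tupof n (fun y => y ∈ Z /\ y ∈ z) q.
      by apply: tupof_sub tq => y [yZ yz']; split=> //; exact: c_trans zc z'z yz'.
    rewrite (col q) //; apply: az' => //.
    by apply: tupof_sub tq1 => y /W.
  have [|_ /(mem_irr mM)//] := iffLR (W z').
  by [].
- exact: nz.
have zZ' : z ∈ Z'.
  apply/bz' => //; split; first exact: c_trans (Xc xX') z'x' zz'.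
  move=> q qX tq.
  have tq1 : tupof n (fun y => y ∈ Z /\ y ∈ z) q.
    by apply: tupof_sub tq => y [yZ yz]; apply/W; split=> //; exact: c_trans z'c zz' yz.
  by rewrite -(col q) //; apply: az.
by have [|_ /(mem_irr mM)] := iffRL (W z).
Qed.

(** The branches coincide and [x], [x'] colour their tuples alike; so the smaller of the two points
    would belong to the branch of the other, hence to its own branch, which lies below it. *)
Lemma tree_inj : x = x'.
Proof.
have ZZ y : y ∈ Z <-> y ∈ Z'.
  split=> yZ.
    have [t tl ty] := cov yZ; have H := fixr yZ tl ty.
    by rewrite -H; apply/dom => //; rewrite ty.
  have [t tl ty] := cov' yZ.
  have tZ : app r t ∈ Z by apply/dom => //; rewrite ty.
  by have := fixr tZ tl erefl; rewrite ty => ->.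
have col q : q ∈ tups n X -> tupof n (fun y => y ∈ Z) q -> F x q = F x' q.
  by apply: colour => // t tl tZ; exact: fixr.
have [ZX bz] := bZ; have [ZX' bz'] := bZ'.
case: (c_tricho (Xc xX) (Xc xX')) => // H.
  suff /ZZ xZ : x ∈ Z' by have [] := iffLR (bz x xX) xZ; move/(mem_irr mM).
  apply/bz' => //; split=> // q qX tq; apply: col => //.
  by apply: tupof_sub tq => y [/ZZ].
suff /ZZ xZ : x' ∈ Z by have [] := iffLR (bz' x' xX') xZ; move/(mem_irr mM).
apply/bz => //; split=> // q qX tq; apply: esym; apply: col => //.
by apply: tupof_sub tq => y [].
Qed.

End Inject.

Lemma tree_large : ~ small X -> exists x Z, [/\ x ∈ X, branch Z x x & ~ small Z].
Proof.
move=> nX; apply: contrapT => no.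
have allsmall x Z : x ∈ X -> branch Z x x -> small Z.
  by move=> xX bZ; apply: contrapT => nZ; apply: no; exists x, Z.
(* Restricting coverings to subsets of [prod c c] makes this relation [delta0]. *)
pose covers e Z := exists2 r, r ∈ pow (prod c c) &
  forall z, z ∈ Z -> exists2 s, s ∈ e & app r s = z.
have dcov : def2 covers by rewrite /covers; dfn.
have ordc e : is_ordinal e -> I e -> e ∈ c.
  move=> oe Ie; case: (ord_tricho mostM oe oc) => // [e'|ce]; first by case: nIc; rewrite -e'.
  by case: nIc; exact: (cut_mem cutI Ie).
have covI x Z : x ∈ X -> branch Z x x -> exists e, [/\ e ∈ c, I e & covers e Z].
  move=> xX bZ; have [e [r [oe Ie cov]]] := small_by_ord cutI (allsmall x Z xX bZ).
  have ec := ordc e oe Ie.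
  exists e; split=> //.
  have [g gp gE] := restrict_ex mM r c c.
  exists g => // z zZ; have [s se sz] := cov z zZ; exists s => //.
  rewrite gE //; first exact: c_mem se.
  by rewrite sz; apply: Xc; case: bZ => ZX _; exact: ZX.
(* Only the least covering ordinal of each branch is collected: larger ordinals below [c] cover too,
   and some of these could be outside [I]. *)
have [|C CE] := @sep_ex _ mM (fun e => exists2 x, x ∈ X & exists2 Z, Z ∈ pow X &
  branch Z x x /\ (covers e Z /\ forall e', e' ∈ e -> ~ covers e' Z)) c.
  by rewrite /branch /agree; dfn.
have IC : I C.
  apply: (topless_cut cutI) => e /CE[ec [x xX [Z _ [bZ [_ emin]]]]]; split; last exact: ord_in oc ec.
  have [h [hc Ih ch]] := covI x Z xX bZ.
  case: (c_tricho ec hc) => [eh|->//|/emin//]; exact: (cut_mem cutI Ih).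
pose lam := un C; have Il : I lam by exact: (cut_un mostM cutI).
have lamc : subs lam c by move=> s /in_un[e /CE[ec _] se]; exact: c_mem ec se.
have covl x Z : x ∈ X -> branch Z x x -> exists2 r, r ∈ pow (prod c c) &
    forall z, z ∈ Z -> exists2 s, s ∈ lam & app r s = z.
  move=> xX bZ; have [h [hc Ih ch]] := covI x Z xX bZ.
  have [|S SE] := @sep_ex _ mM (fun e => covers e Z) c; first by dfn.
  have [|e /SE[ec [r rp cov]] emin] := @mac_foundation _ mM S.
    by move/(_ h); apply; apply/SE.
  exists r => // z /cov[s se sz]; exists s => //; apply/in_un; exists e => //.
  apply/CE; split=> //; exists x => //; exists Z; first by apply/in_pow; case: bZ.
  split=> //; split; first by exists r.
  by move=> e' e'e ce'; apply: (emin e' e'e); apply/SE; split=> //; exact: c_mem e'e.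
(* A code consists of the order pulled back to [lam] and the colouring pulled back to its tuples. By
   [tree_inj] it determines the point, so decoding covers [X] from [S]. *)
pose S := prod (pow (prod lam lam)) (pow (prod (tups n lam) i)).
have IS : I S.
  by apply: (cut_prod mostM cutI); apply: (cut_pow mostM cutI); apply: (cut_prod mostM cutI) => //; exact: (cut_tups mostM cutI).
pose codeR Z r R := forall s, s ∈ lam -> forall s', s' ∈ lam -> (opair s s' ∈ R <->
  ((app r s ∈ Z /\ app r s' ∈ Z) /\ ~ app r s' ∈ app r s)).
pose codeT x Z r T := forall q, q ∈ tups n lam -> forall v, v ∈ i -> (opair q v ∈ T <->
  exists2 q', q' ∈ tups n X & tupof n (fun y => y ∈ Z) q' /\ (maptup n r q q' /\ v = F x q')).
pose code p x := exists R T, p = opair R T /\ exists2 Z, Z ∈ pow X & branch Z x x /\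
  exists2 r, r ∈ pow (prod c c) & (forall z, z ∈ Z -> exists2 s, s ∈ lam & app r s = z) /\
  (codeR Z r R /\ codeT x Z r T).
have dcode : def2 (fun p x => x ∈ X /\ code p x).
  by rewrite /code /codeR /codeT /branch /agree; dfn.
have [g gE] := unif mostM S dcode.
apply: nX; exists S, g; split=> // x xX.
have [Z Zp bZ] := branch_ex xX (Xc xX).
have [r rp cov] := covl x Z xX bZ.
have [|R RE] := @sep_ex _ mM (fun p => exists s s', p = opair s s' /\
  ((app r s ∈ Z /\ app r s' ∈ Z) /\ ~ app r s' ∈ app r s)) (prod lam lam); first by dfn.
have [|T TE] := @sep_ex _ mM (fun p => exists q v, p = opair q v /\
  exists2 q', q' ∈ tups n X & tupof n (fun y => y ∈ Z) q' /\ (maptup n r q q' /\ v = F x q'))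
  (prod (tups n lam) i); first by dfn.
have cR : codeR Z r R.
  move=> s sl s' s'l; rewrite RE in_prod; split=> [[_ [u [u' [/opair_inj[-> ->]]]]]//|H].
  by split=> //; exists s, s'.
have cT : codeT x Z r T.
  move=> q ql v vi; rewrite TE in_prod; split=> [[_ [u [u' [/opair_inj[-> ->]]]]]//|H].
  by split=> //; exists q, v.
have pS : opair R T ∈ S.
  by apply/in_prod; split; apply/in_pow => p; [move/RE => []|move/TE => []].
exists (opair R T) => //.
have [|x'X] := gE _ pS.
  exists x; split=> //; exists R, T; split=> //; exists Z => //; split=> //.
  by exists r.
set x' := app g _ in x'X *.
move=> [R' [T' [/opair_inj[<- <-] [Z' Z'p [bZ' [r' r'p [cov' [cR' cT']]]]]]]].
apply: esym; apply: (tree_inj xX x'X bZ bZ' cov cov') => [s s' sl s'l|q v ql vi].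
  by rewrite -cR // -cR'.
by rewrite -cT // -cT'.
Qed.

End Tree.

Lemma curry f n : exists f1, forall z q, z ∈ c -> q ∈ tups n c ->
  app (app f1 z) q = app f (opair z q).
Proof.
have [|f1 fE] := @unif _ mostM (fun z g => forall q, q ∈ tups n c -> forall p, p ∈ tups n.+1 c ->
   p = opair z q -> app g q = app f p) c; first by dfn.
exists f1 => z q zc qc; apply: (fE z zc _ q qc) => //; last exact/in_prod.
have [|g gE] := @unif _ mostM (fun q v => exists2 p, p ∈ tups n.+1 c &
  p = opair z q /\ v = app f p) (tups n c); first by dfn.
exists g => q' q'c p pc pE; have [|p' _ [-> ->]] := gE q' q'c; last by rewrite pE.
by exists (app f p), p.
Qed.

Definition decr (s : seq M) := pairwise (fun x y => `[< y ∈ x >]) s.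

(** On a large branch [Z] of [x], the largest entry [b] of a decreasing tuple may be replaced by
    [x], since [b] agrees with [x] on tuples of [Z] below [b]. This leaves the colouring of
    [n]-tuples by [app f1 x]. *)
Theorem erdos_rado n f X i : subs X c -> ~ small X -> I i ->
  (forall q, q ∈ tups n X -> app f q ∈ i) ->
  exists Y v, [/\ subs Y X, ~ small Y & forall s, size s = n ->
    allin (fun x => x ∈ Y) s -> decr s -> app f (tup s) = v].
Proof.
move=> Xc nX Ii; elim: n f X Xc nX => [|n IH] f X Xc nX fval.
  by exists X, (app f (e0 mM)); split=> // -[].
have tXc m q : q ∈ tups m X -> q ∈ tups m c.
  by move=> /in_tups qX; apply/in_tups; apply: tupof_sub qX.
have [f1 f1E] := curry f n.
have fval1 x q : x ∈ X -> q ∈ tups n X -> app (app f1 x) q ∈ i.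
  by move=> xX qX; rewrite f1E; [apply: fval; apply/in_prod|exact: Xc|exact: tXc].
have [x [Z [xX [ZX bZ] nZ]]] := tree_large Xc Ii fval1 nX.
have Zc : subs Z c by move=> z /ZX /Xc.
have tZX m q : q ∈ tups m Z -> q ∈ tups m X.
  by move=> /in_tups qX; apply/in_tups; apply: tupof_sub qX.
have [|Y [v [YZ nY Yv]]] := IH (app f1 x) Z Zc nZ.
  by move=> q /tZX qX; exact: fval1.
exists Y, v; split=> //; first by move=> y /YZ /ZX.
case=> // b s [sn] /andP[/asboolP bY sY] /andP[bs ds].
have bX := ZX b (YZ b bY).
have sX : tup s ∈ tups n X by apply: tup_in => //; apply: allin_sub sY => y /YZ /ZX.
have [_ ab] := iffLR (bZ b bX) (YZ b bY).
rewrite /= -f1E; [|exact: Xc|exact: tXc].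
rewrite ab //; first exact: Yv.
by exists s; split=> //; apply: allin_and => //; apply: allin_sub sY => y /YZ.
Qed.

End Partition.

(** * A generic sequence of large sets *)

HB.instance Definition _ (A : structure) := gen_eqMixin (carrier A).

Section Select.
Variables (M : structure) (mostM : MOST M).
Let mM : Mac M := most_mac mostM.
Local Notation opair := (opair mM).
Local Notation app := (app mM).
Local Notation tup := (tup mM).
Local Notation tups := (tups mM).
Local Notation e0 := (e0 mM).

Definition nthtup N k (Q x : M) := exists s, [/\ size s = N, Q = tup s & x = nth e0 s k].

Lemma def_nthtup N k (G : ctx M) (Q x : G -> M) : good Q -> good x ->
  def (fun e => nthtup N k (Q e) (x e)).
Proof.
elim: N k G Q x => [|N IH] k G Q x gQ gx.
  apply: (@def_iff _ _ _ (fun e => Q e = e0 /\ x e = e0)); last by dfn.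
  by move=> e; split=> [[[|? ?] [] //]|[-> ->]]; [rewrite nth_nil|exists [::]; rewrite nth_nil].
case: k => [|k].
  apply: (@def_iff _ _ _ (fun e => exists a b, Q e = opair a b /\
    (a = x e /\ tupof mM N (fun y => y = y) b))); last by dfn.
  move=> e; split=> [[[|a s] [//= [sN] QE xE]]|[a [b [QE [aE [s [sN _ bE]]]]]]].
    exists a, (tup s); split=> //; split=> //; exists s; split=> //.
    by apply/allP => y _; apply/asboolP.
  by exists (a :: s); split=> /=; [rewrite sN|rewrite -bE|].
apply: (@def_iff _ _ _ (fun e => exists a b, Q e = opair a b /\ nthtup N k b (x e))).
  move=> e; split=> [[[|a s] [//= [sN] QE xE]]|[a [b [QE [s [sN bE xE]]]]]].
    by exists a, (tup s); split=> //; exists s.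
  by exists (a :: s); split=> /=; [rewrite sN|rewrite -bE|].
by apply: def_expair; [good_tac|apply: IH; good_tac].
Qed.

Definition seltup N ks (Q q : M) :=
  exists s, [/\ size s = N, Q = tup s & q = tup [seq nth e0 s k | k <- ks]].

Lemma def_seltup N ks (G : ctx M) (Q q : G -> M) : good Q -> good q ->
  def (fun e => seltup N ks (Q e) (q e)).
Proof.
elim: ks G Q q => [|k ks IH] G Q q gQ gq.
  apply: (@def_iff _ _ _ (fun e => q e = e0 /\ tupof mM N (fun y => y = y) (Q e))); last by dfn.
  move=> e; split=> [[s [sN QE qE]]|[qE [s [sN _ QE]]]].
    by split=> //; exists s; split=> //; apply/allP => y _; apply/asboolP.
  by exists s.
apply: (@def_iff _ _ _ (fun e => exists x y, q e = opair x y /\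
   (nthtup N k (Q e) x /\ seltup N ks (Q e) y))).
  move=> e; split=> [[s [sN QE qE]]|[x [y [qE [[s [sN QE xE]] [s' [sN' QE' yE]]]]]]].
    exists (nth e0 s k), (tup [seq nth e0 s k | k <- ks]); split=> //.
    by split; exists s.
  have e' : s' = s by apply: (@tup_inj _ mM); rewrite ?sN ?sN' -?QE.
  by exists s; split=> //=; rewrite -xE -{1}e' -yE.
by apply: def_expair => //; apply: def_and; [apply: def_nthtup; good_tac|apply: IH; good_tac].
Qed.

(** Used to rewrite terms over different index lists as functions of one common tuple; positions may
    be repeated, permuted or omitted. *)
Lemma recode f c N ks : all (fun k => k < N) ks ->
  exists g, forall s, size s = N -> allin (fun x => x ∈ c) s ->
    app g (tup s) = app f (tup [seq nth e0 s k | k <- ks]).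
Proof.
move=> /allP kN.
have [|g gE] := @unif _ mostM (fun Q v => exists2 q, q ∈ tups (size ks) c &
  seltup N ks Q q /\ v = app f q) (tups N c).
  apply: def_ex2; first by good_tac.
  by apply: def_and; [apply: def_seltup; good_tac|dfn].
exists g => s sN sc.
have sin : tup [seq nth e0 s k | k <- ks] ∈ tups (size ks) c.
  apply: tup_in; first by rewrite size_map.
  apply/allP => _ /mapP[k kks ->]; move/allP: sc; apply; apply: mem_nth.
  by rewrite sN; exact: kN.
have [|q _ [[s' [s'N /tup_inj e ->]] ->]] := gE _ (tup_in mM sN sc).
  by exists (app f (tup [seq nth e0 s k | k <- ks])), (tup [seq nth e0 s k | k <- ks]) => //;
     split=> //; exists s.
by rewrite e // s'N.
Qed.

End Select.

(** * Requirements on large sets of ordinals *)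

Section Requirements.
Variables (M : structure) (mostM : MOST M) (I : set M) (cutI : H_cut I).
Let mM : Mac M := most_mac mostM.
Implicit Types a b f i p q r t u v w x y z X Y Z : M.
Local Notation opair := (opair mM).
Local Notation app := (app mM).
Local Notation upair := (upair mM).
Local Notation tup := (tup mM).
Local Notation tups := (tups mM).
Local Notation e0 := (e0 mM).
Local Notation small := (small mostM I).

Variables (c : M) (oc : is_ordinal c) (nc : ~ small c).

Let nIc : ~ I c.
Proof.
move=> Ic; apply: nc.
have [|f fE] := @fun_ex _ mostM (fun x => x) c; first by rewrite /good1; dfn.
by exists c, f; split=> // z zc; exists z => //; exact: fE.
Qed.

Definition dlist n Y (s : seq M) := [/\ size s = n, allin (fun x => x ∈ Y) s & decr s].

Lemma dlist_sub n X Y s : subs Y X -> dlist n Y s -> dlist n X s.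
Proof. by move=> YX [sn sY ds]; split=> //; apply: allin_sub sY. Qed.

Lemma dlist_tups n X Y s : subs Y X -> dlist n Y s -> tup s ∈ tups n X.
Proof. by move=> YX [sn sY ds]; apply: tup_in => //; apply: allin_sub sY. Qed.

(** Least elements are removed one after another; removing one point preserves largeness, and each
    new point goes in front as the largest so far. *)
Lemma bottom n X : subs X c -> ~ small X -> exists s Y, [/\ dlist n X s, subs Y X, ~ small Y &
  forall y, y ∈ Y -> all (fun x => `[< x ∈ y >]) s].
Proof.
move=> Xc nX; elim: n => [|n [s [Y [[sn sX ds] YX nY sY]]]]; first by exists [::], X; split=> //; split.
have [|x xY xmin] := @mac_foundation _ mM Y.
  move=> eY; apply: nY; exists e0, e0; split; first exact: (cut_e0 mostM cutI).
  by move=> z /eY.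
have [|Y' YE] := @sep_ex _ mM (fun y => ~ y = x) Y; first by dfn.
exists (x :: s), Y'; split.
- split=> /=; first by rewrite sn.
    by apply/andP; split=> //; apply/asboolP; exact: YX.
  by apply/andP; split=> //; exact: sY.
- by move=> y /YE[/YX].
- apply: (large_remove cutI (x := x)) nY => y yY; case: (pselect (y = x)); first by left.
  by move=> nyx; right; apply/YE.
- move=> y /YE[yY nyx] /=; rewrite sY // andbT; apply/asboolP.
  case: (c_tricho oc (Xc _ (YX _ xY)) (Xc _ (YX _ yY))) => // [e|/xmin//].
  by case: nyx.
Qed.

Definition hom n b Y := (forall s, dlist n Y s -> tup s ∈ b) \/
  (forall s, dlist n Y s -> ~ tup s ∈ b).

Definition constant_on n f Y := exists v, forall s, dlist n Y s -> app f (tup s) = v.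

Definition const_or_sep n f Y := constant_on n f Y \/
  (forall s s', dlist n Y s -> dlist n Y s' -> decr (s ++ s') ->
    app f (tup s) <> app f (tup s')).

(** The second alternative speaks of all large subsets so that it survives further shrinking. *)
Definition const_or_unbounded n f Y := constant_on n f Y \/
  (forall Y', subs Y' Y -> ~ small Y' -> ~ exists2 i, I i &
    forall s, dlist n Y' s -> app f (tup s) ∈ i).

Definition tc d := projT1 (cid2 (TC_ex mostM d)).
Lemma tc_trans d : is_trans (tc d).
Proof. by rewrite /tc; case: cid2. Qed.
Lemma tc_in d : d ∈ tc d.
Proof. by rewrite /tc; case: cid2 => t ? []. Qed.
Lemma tc_min d u : is_trans u -> d ∈ u -> subs (tc d) u.
Proof. by rewrite /tc; case: cid2 => t ? [? H] /=; exact: H. Qed.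

Definition inj_tc d Y := ~ I d -> exists g, (forall y, y ∈ Y -> app g y ∈ tc d) /\
  forall y y', y ∈ Y -> y' ∈ Y -> app g y = app g y' -> y = y'.

Lemma hom_ex n b X : subs X c -> ~ small X -> exists Y, [/\ subs Y X, ~ small Y & hom n b Y].
Proof.
move=> Xc nX; pose one := upair e0 e0.
have [|f fE] := @unif _ mostM (fun q v => (q ∈ b /\ v = e0) \/ (~ q ∈ b /\ v = one)) (tups n X).
  by dfn.
have {}fE q : q ∈ tups n X -> (q ∈ b /\ app f q = e0) \/ (~ q ∈ b /\ app f q = one).
  move=> qX; apply: fE => //; case: (pselect (q ∈ b)) => H; [exists e0; left|exists one; right];
    by [].
have ne : one <> e0 by move=> e; apply: (@in_e0 _ mM e0); rewrite -{2}e; apply/in_upair; left.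
have [||Y [v [YX nY Yv]]] := @erdos_rado _ mostM I cutI c oc nIc n f X (upair e0 one) Xc nX.
- have I0 := cut_e0 mostM cutI; apply: (cut_upair mostM cutI) => //.
  exact: (cut_upair mostM cutI).
- by move=> q /fE[[_ ->]|[_ ->]]; apply/in_upair; [left|right].
exists Y; split=> //.
case: (pselect (v = e0)) => ve; [left|right] => s ds; have /fE := dlist_tups YX ds;
  have [s1 s2 s3] := ds; rewrite Yv //; first by case=> [[]//|[_]]; rewrite ve => /esym.
by case=> [[]//|[]].
Qed.

(** Make the statement that [f] agrees on the two halves of a [2n]-tuple homogeneous. If it holds
    throughout, comparison with a fixed tuple [w] from [bottom] shows that [f] is constant above
    [w]. *)
Lemma const_or_sep_ex n f X : subs X c -> ~ small X ->
  exists Y, [/\ subs Y X, ~ small Y & const_or_sep n f Y].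
Proof.
move=> Xc nX.
have [|f1 f1E] := @recode _ mostM f c (n + n) (iota 0 n).
  by apply/allP => k; rewrite mem_iota /= add0n => /leq_trans; apply; exact: leq_addr.
have [|f2 f2E] := @recode _ mostM f c (n + n) (iota n n).
  by apply/allP => k; rewrite mem_iota => /andP[].
have [|b bE] := @sep_ex _ mM (fun Q => app f1 Q = app f2 Q) (tups (n + n) c); first by dfn.
have key Y s s' : subs Y c -> dlist n Y s -> dlist n Y s' -> decr (s ++ s') ->
    dlist (n + n) Y (s ++ s') /\ (tup (s ++ s') ∈ b <-> app f (tup s) = app f (tup s')).
  move=> Yc ds ds' dss; have [sn sY _] := ds; have [sn' sY' _] := ds'.
  have dd : dlist (n + n) Y (s ++ s').
    by split=> //; [rewrite size_cat sn sn'|rewrite /allin all_cat; apply/andP].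
  split=> //; have [dn dY _] := dlist_sub Yc dd.
  have -> : tup (s ++ s') ∈ b <-> app f1 (tup (s ++ s')) = app f2 (tup (s ++ s')).
    by rewrite bE; split=> [[]//|H]; split=> //; exact: tup_in.
  rewrite f1E // f2E // map_nth_iota0 ?dn ?leq_addr // map_nth_iota ?dn ?addKn //.
  by rewrite take_size_cat // drop_size_cat // take_oversize // sn'.
have [Y [YX nY [hY|hY]]] := hom_ex (n + n) b Xc nX; last first.
  exists Y; split=> //; right=> s s' ds ds' dss.
  have Yc : subs Y c by move=> y /YX /Xc.
  by have [dd H] := key Y s s' Yc ds ds' dss; rewrite -H; exact: hY.
have Yc : subs Y c by move=> y /YX /Xc.
have [w [Y' [dw Y'Y nY' wY']]] := bottom n Yc nY.
exists Y'; split=> //; first by move=> y /Y'Y /YX.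
left; exists (app f (tup w)) => s ds.
have dss : decr (s ++ w).
  have [_ sY dds] := ds; have [_ _ ddw] := dw.
  rewrite /decr pairwise_cat; apply/and3P; split=> //; apply/allrelP => x y xs yw.
  have /asboolP xY : `[< x ∈ Y' >] by move/allP: sY; apply.
  by have /allP /(_ y yw) := wY' x xY.
have ds' := dlist_sub Y'Y ds.
by have [dd H] := key Y s w Yc ds' dw dss; apply/H; exact: hY.
Qed.

(** [erdos_rado] wants values in [i] on all tuples, while the hypothesis covers decreasing ones
    only; stray values are replaced by [i0], a value that does lie in [i]. *)
Lemma constant_ex n f i X : subs X c -> ~ small X -> I i ->
  (forall s, dlist n X s -> app f (tup s) ∈ i) ->
  exists Y, [/\ subs Y X, ~ small Y & constant_on n f Y].
Proof.
move=> Xc nX Ii fi; have [w [_ [dw _ _ _]]] := bottom n Xc nX.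
set i0 := app f (tup w); have i0i : i0 ∈ i by exact: fi.
have [|g gE] := @unif _ mostM (fun q v => (app f q ∈ i /\ v = app f q) \/
   (~ app f q ∈ i /\ v = i0)) (tups n X); first by dfn.
have {}gE q : q ∈ tups n X -> (app f q ∈ i /\ app g q = app f q) \/
   (~ app f q ∈ i /\ app g q = i0).
  move=> qX; apply: gE => //; case: (pselect (app f q ∈ i)) => H;
  [by exists (app f q); left|by exists i0; right].
have [||Y [v [YX nY Yv]]] := @erdos_rado _ mostM I cutI c oc nIc n g X i Xc nX => //.
  by move=> q /gE[[? ->]|[_ ->]].
exists Y; split=> //; exists v => s ds; have [s1 s2 s3] := ds; rewrite -(Yv s) //.
by case: (gE _ (dlist_tups YX ds)) => [[_ ->//]|[]]; case; exact: (fi s (dlist_sub YX ds)).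
Qed.

(** The single parameter [b] serves as a set of tuples, as a function and as a set with a transitive
    closure, so that one enumeration of pairs handles all requirements. *)
Definition meets n b Y :=
  [/\ hom n b Y, const_or_sep n b Y, const_or_unbounded n b Y & inj_tc b Y].

Lemma meets_ex n b X : subs X c -> ~ small X ->
  exists Y, [/\ subs Y X, ~ small Y & meets n b Y].
Proof.
move=> Xc nX.
have [Y1 [s1 n1 h1]] := hom_ex n b Xc nX.
have c1 : subs Y1 c by move=> y /s1 /Xc.
have [Y2 [s2 n2 h2]] := const_or_sep_ex n b c1 n1.
have c2 : subs Y2 c by move=> y /s2 /c1.
(* If no large subset makes [b] constant, [constant_ex] excludes every large subset on which [b] is
   bounded in [I]. *)
have [Y3 [s3 n3 h3]] : exists Y, [/\ subs Y Y2, ~ small Y & const_or_unbounded n b Y].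
  case: (pselect (exists Y, [/\ subs Y Y2, ~ small Y & constant_on n b Y])) => [[Y [? ? ?]]|no].
    by exists Y; split=> //; left.
  exists Y2; split=> //; right=> Y' Y'2 nY' [i Ii Hi]; apply: no.
  have [|Y [YY' nY cY]] := constant_ex _ nY' Ii Hi; first by move=> y /Y'2 /c2.
  by exists Y; split=> // y /YY' /Y'2.
have c3 : subs Y3 c by move=> y /s3 /c2.
have [Y4 [s4 n4 h4]] : exists Y, [/\ subs Y Y3, ~ small Y & inj_tc b Y].
  case: (pselect (I b)) => [Ib|nIb]; first by exists Y3; split.
  have [Y [g [YY nY g1 g2]]] := large_inj cutI oc c3 n3 (@tc_trans b) (@tc_in b) nIb.
  by exists Y; split=> // _; exists g.
have s41 : subs Y4 Y1 by move=> y /s4 /s3 /s2.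
have s42 : subs Y4 Y2 by move=> y /s4 /s3.
exists Y4; split=> //; first by move=> y /s41 /s1.
split=> //.
- by case: h1 => h; [left|right] => s /(dlist_sub s41)/h.
- case: h2 => [[v h]|h]; [left; exists v => s /(dlist_sub s42)/h //|right].
  by move=> s s' /(dlist_sub s42) ds /(dlist_sub s42); exact: h.
- case: h3 => [[v h]|h]; [left; exists v => s /(dlist_sub s4)/h //|right].
  by move=> Y' Y'4; apply: h => y /Y'4 /s4.
Qed.

Lemma generic_ex : countable [set: M] -> exists X : nat -> M,
  [/\ forall k, subs (X k) c, forall k, ~ small (X k),
      forall k k', k <= k' -> subs (X k') (X k) & forall n b, exists k, meets n b (X k)].
Proof.
move=> /countable_injP[num numI].
have step (kX : nat * M) : exists Y, subs kX.2 c -> ~ small kX.2 ->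
    [/\ subs Y kX.2, ~ small Y & forall n b, pickle (n, num b) = kX.1 -> meets n b Y].
  case: kX => k X /=.
  case: (pselect (subs X c /\ ~ small X)) => [[Xc nX]|no]; last first.
    by exists X => H1 H2; case: no.
  have [[n [b bk]]|no] := pselect (exists (n : nat) b, pickle (n, num b) = k); last first.
    by exists X => _ _; split=> // n b e; case: no; exists n, b.
  subst k; have [Y [YX nY mY]] := meets_ex n b Xc nX; exists Y => _ _; split=> // n' b'.
  move=> /(pcan_inj (@pickleK (nat * nat)%type))[-> e].
  by rewrite (numI b' b) ?inE.
have [nxt nxtE] := choice step.
(* [X 0] is [c], and the pair with code [k] is met by [X k.+1]. *)
pose X := nat_rect (fun=> carrier M) c (fun (m : nat) (x : M) => nxt (m, x)).
have XE k : subs (X k) c /\ ~ small (X k).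
  elim: k => [|k [H1 H2]] /=; first by split.
  have [H3 H4 _] := nxtE (k, X k) H1 H2.
  by split=> // y /H3 /H1.
exists X; split.
- by move=> k; case: (XE k).
- by move=> k; case: (XE k).
- move=> k k' /subnK <-; elim: (k' - k)%N => [|m IH] //.
  have [H1 H2] := XE (m + k); have [H3 _ _] := nxtE (m + k, X (m + k)) H1 H2.
  by move=> y /H3 /IH.
- move=> n b; exists (pickle (n, num b)).+1; have [H1 H2] := XE (pickle (n, num b)).
  by have [_ _] := nxtE (pickle (n, num b), X (pickle (n, num b))) H1 H2; apply.
Qed.

End Requirements.

(** * The iterated ultrapower *)

Section MoreMost.
Variables (M : structure) (mostM : MOST M).
Let mM : Mac M := most_mac mostM.
Local Notation app := (app mM).
Local Notation upair := (upair mM).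

(** A block of existential quantifiers contracts to one: [z] is any set containing the witnesses,
    for instance their unordered pair, and both are then sought inside [z]. *)
Lemma sigma1_def f : sigma1 f -> forall (G : ctx M) (t : nat -> G -> M),
  (forall i, good (t i)) -> exists P0 : G -> M -> Prop,
    @def _ (ext G) (fun e => P0 e.1 e.2) /\ forall e, sat (t^~ e) f <-> exists y, P0 e y.
Proof.
elim=> {f} [f df|x f _ IH] G t gt.
  exists (fun e _ => sat (t^~ e) f); split; first exact: def_fst (def_sat df gt).
  by move=> e; split=> [H|[]//]; exists (e0 mM).
have [|P0 [dP0 P0E]] := IH (ext G) (fun i e => if i == x then e.2 else t i e.1).
  by move=> i; case: (i == x); [exact: good_var0|exact: good_fst].
exists (fun e z => exists2 a, a ∈ z & exists2 y, y ∈ z & P0 (e, a) y); split.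
  do 2!(apply: def_ex2; first by good_tac).
  pose s (e : ext (ext (ext G))) : ext (ext G) := ((e.1.1.1, e.1.2), e.2).
  have ss : csub s.
    move=> u [->|[w [->|[z cz ->]] ->]]; left; first by left.
      by right; exists snd => //; left.
    right; exists (z \o fst \o fst) => //; right; exists (z \o fst) => //.
    by right; exists z.
  exact: (def_csub ss dP0).
move=> e; have E a : sat [eta t^~ e with x |-> a] f <-> exists y, P0 (e, a) y.
  by rewrite -P0E; apply: sat_eq => i /=.
split=> [[a /E[y H]]|[z [a _ [y _ H]]]]; last by exists a; apply/E; exists y.
exists (upair a y); exists a; first by apply/in_upair; left.
by exists y => //; apply/in_upair; right.
Qed.

(** [unif] needs a [delta0] relation, so [g] first selects a set containing suitable [x] and [z];
    with [z] bounded by that set, [x] can be selected. *)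
Lemma unif_sigma (P : M -> M -> M -> Prop) w :
  @def _ (ext (ext (ext (c0 M)))) (fun e => P e.1.1.2 e.1.2 e.2) ->
  exists f, forall q, q ∈ w -> (exists x z, P q x z) -> exists z, P q (app f q) z.
Proof.
move=> dP.
have dP' (G : ctx M) (a b d : G -> M) : good a -> good b -> good d ->
    def (fun e => P (a e) (b e) (d e)).
  move=> ga gb gd.
  apply: (good_subst (P := fun e z => P (a e) (b e) z)) => //.
  apply: (good_subst (G := ext G) (t := fun e => b e.1) (P := fun e y => P (a e.1) y e.2)).
    by good_tac.
  apply: (good_subst (G := ext (ext G)) (t := fun e => a e.1.1) (P := fun e x => P x e.2 e.1.2)).
    by good_tac.
  pose s (e : ext (ext (ext G))) : ext (ext (ext (c0 M))) := (tt, e.2, e.1.2, e.1.1.2).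
  have ss : csub s.
    move=> u [->|[v vv ->]]; left.
      by right; exists (snd \o fst) => //; right; exists snd => //; left.
    case: vv => [->|[z zz ->]]; first by right; exists snd => //; left.
    by case: zz => [->|[? []]]; left.
  exact: (def_csub ss dP).
have [|g gE] := @unif _ mostM (fun q W => exists2 x, x ∈ W & exists2 z, z ∈ W & P q x z) w.
  rewrite /def2; apply: def_ex2; first by dfn.
  cbv beta; apply: def_ex2; first by dfn.
  by cbv beta; apply: dP'; dfn.
have [|f fE] := @unif _ mostM (fun q x => exists2 z, z ∈ app g q & P q x z) w.
  rewrite /def2; apply: def_ex2; first by dfn.
  by cbv beta; apply: dP'; dfn.
exists f => q qw [x [z H]].
have [|x' x'g [z' z'g H']] := gE q qw.
  exists (upair x z); exists x; first by apply/in_upair; left.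
  by exists z => //; apply/in_upair; right.
have [|z'' _] := fE q qw; last by exists z''.
by exists x', z'.
Qed.

End MoreMost.

(** * Assignments, terms and the filter that decides them *)

Section Ultrapower.
Variables (M : structure) (mostM : MOST M) (c : M) (X : nat -> M) (L : structure).
Let mM : Mac M := most_mac mostM.
Hypothesis Xc : forall k, subs (X k) c.
Hypothesis Xmono : forall k k', k <= k' -> subs (X k') (X k).
Hypothesis Xlong : forall k n, exists s, dlist n (X k) s.
Hypothesis Xhom : forall n b, exists k, hom mostM n b (X k).
Hypothesis linL : linear_order L.
Local Notation opair := (opair mM).
Local Notation app := (app mM).
Local Notation un := (un mM).
Local Notation pow := (pow mM).
Local Notation prod := (prod mM).
Local Notation upair := (upair mM).
Local Notation tup := (tup mM).
Local Notation tups := (tups mM).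
Local Notation e0 := (e0 mM).

Definition desc : rel L := fun l l' => `[< bin l' l >].

Definition dsort (S : seq L) := sort (fun l l' => (l == l') || desc l l') (undup S).

Lemma mem_dsort S : dsort S =i S.
Proof. by move=> l; rewrite mem_sort mem_undup. Qed.

Lemma dsort_desc S : pairwise desc (dsort S).
Proof.
have [irr trs tot] := linL.
have tr : transitive (fun l l' : L => (l == l') || desc l l').
  move=> y x z /orP[/eqP->//|/asboolP xy] /orP[/eqP<-|/asboolP yz].
    by apply/orP; right; apply/asboolP.
  by apply/orP; right; apply/asboolP; exact: trs yz xy.
have to : total (fun l l' : L => (l == l') || desc l l').
  move=> x y; case: (tot x y) => [xy|->|yx]; last 1 first.
  - by apply/orP; left; apply/orP; right; apply/asboolP.
  - by apply/orP; right; apply/orP; right; apply/asboolP.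
  - by rewrite eqxx.
have := sort_sorted to (undup S); rewrite sorted_pairwise // -/(dsort S) => H1.
have : uniq (dsort S) by rewrite sort_uniq undup_uniq.
rewrite uniq_pairwise => H2.
have : pairwise [rel x y | (fun l l' : L => (l == l') || desc l l') x y &&
   (fun x y => x != y) x y] (dsort S) by rewrite pairwise_relI H1.
by apply: sub_pairwise => x y /= /andP[/orP[->//|]].
Qed.

Lemma dsort_uniq S : uniq (dsort S).
Proof. by rewrite sort_uniq undup_uniq. Qed.

Definition incr k (S : seq L) (a : L -> M) := [/\ forall l, a l ∈ c,
  forall l, l \in S -> a l ∈ X k &
  forall l l', l \in S -> l' \in S -> bin l l' -> a l ∈ a l'].

Lemma incr_sub k k' S S' a : k <= k' -> {subset S <= S'} -> incr k' S' a -> incr k S a.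
Proof.
move=> kk SS [ac aX ai]; split=> //; first by move=> l /SS /aX; exact: Xmono.
by move=> l l' /SS lS /SS; exact: ai.
Qed.

(** The filter generated by the sets of assignments that map a finite set of indices increasingly
    into some [X k]. *)
Definition ae (P : (L -> M) -> Prop) := exists k S, forall a, incr k S a -> P a.

Lemma ae_and P Q : ae P -> ae Q -> ae (fun a => P a /\ Q a).
Proof.
move=> [k [S H]] [k' [S' H']]; exists (maxn k k'), (S ++ S') => a ia; split.
  by apply: H; apply: incr_sub ia; rewrite ?leq_maxl // => l lS; rewrite mem_cat lS.
by apply: H'; apply: incr_sub ia; rewrite ?leq_maxr // => l lS; rewrite mem_cat lS orbT.
Qed.

Lemma ae_mono (P Q : (L -> M) -> Prop) :
  (forall a, (forall l, a l ∈ c) -> P a -> Q a) -> ae P -> ae Q.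
Proof. by move=> PQ [k [S H]]; exists k, S => a ia; have [ac _ _] := ia; apply: PQ => //; exact: H. Qed.

Lemma ae_mono2 (P Q R : (L -> M) -> Prop) :
  (forall a, (forall l, a l ∈ c) -> P a -> Q a -> R a) -> ae P -> ae Q -> ae R.
Proof. by move=> H p q; apply: ae_mono (ae_and p q) => a ac []; exact: H. Qed.

Lemma ae_all (P : (L -> M) -> Prop) : (forall a, (forall l, a l ∈ c) -> P a) -> ae P.
Proof. by move=> H; exists 0, [::] => a [ac _ _]; exact: H. Qed.

Lemma ae_iff (P Q : (L -> M) -> Prop) :
  (forall a, (forall l, a l ∈ c) -> (P a <-> Q a)) -> ae P <-> ae Q.
Proof. by move=> PQ; split; apply: ae_mono => a ac /(PQ a ac). Qed.

Lemma incr_dlist k S S' a : {subset S' <= S} -> pairwise desc S' -> incr k S a ->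
  dlist (size S') (X k) (map a S').
Proof.
move=> SS dS [ac aX ai]; split; first by rewrite size_map.
  by apply/allP => _ /mapP[l /SS /aX H ->]; apply/asboolP.
rewrite /decr pairwise_map; elim: S' SS dS => //= l S' IH SS /andP[/allP lS dS].
rewrite IH // ?andbT; last by move=> x xS; apply: SS; rewrite in_cons xS orbT.
apply/allP => l' l'S; apply/asboolP; apply: ai.
- by apply: SS; rewrite in_cons l'S orbT.
- by apply: SS; rewrite mem_head.
- by have /asboolP := lS l' l'S.
Qed.

Lemma dlist_incr k S s : uniq S -> pairwise desc S -> dlist (size S) (X k) s ->
  exists2 a, incr k S a & map a S = s.
Proof.
move=> uS dS [sS sX ds].
have [s1 [sz1 sX1 _]] := Xlong k 1.
case: s1 sz1 sX1 => // d s1 _ /andP[/asboolP dX _].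
(* Indices off [S] take the default [d], a point of [X k], which keeps the assignment inside [c]. *)
pose a l := nth d s (index l S).
have aX l : a l ∈ X k.
  rewrite /a; case: (ltnP (index l S) (size s)) => H; last by rewrite nth_default.
  by have /asboolP := allP sX _ (mem_nth d H).
exists a; last first.
  apply: (@eq_from_nth _ d); first by rewrite size_map sS.
  move=> i; rewrite size_map => iS; case: S uS iS sS {dS} @a aX => // l0 S uS iS sS a aX.
  by rewrite (nth_map l0) // /a index_uniq.
split=> //; first by move=> l; exact: Xc (aX l).
move=> l l' lS l'S ll'.
have [irr trs tot] := linL.
have il : index l S < size S by rewrite index_mem.
have il' : index l' S < size S by rewrite index_mem.
case: (ltngtP (index l S) (index l' S)) => H.
- have := pairwiseP l dS _ _ il il' H; rewrite !nth_index // => /asboolP ll.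
  by case: (irr l); exact: trs ll' ll.
- have := pairwiseP d ds (index l' S) (index l S); rewrite !inE sS => /(_ il' il H) H'.
  exact: H'.
- by move: ll'; rewrite -(nth_index l lS) H nth_index // => /irr.
Qed.

Lemma incr_ex k S : exists a, incr k S a.
Proof.
have [s ds] := Xlong k (size (dsort S)).
have [a ia _] := dlist_incr (dsort_uniq S) (dsort_desc S) ds.
by exists a; apply: incr_sub ia => // l; rewrite mem_dsort.
Qed.

Lemma ae_false : ~ ae (fun=> False).
Proof. by move=> [k [S H]]; have [a /H] := incr_ex k S. Qed.

Lemma ae_const (P : Prop) : ae (fun=> P) -> P.
Proof. by move=> H; apply: contrapT => nP; apply: ae_false; apply: ae_mono H. Qed.

Lemma map_select (a : L -> M) S s : {subset s <= S} ->
  map a s = [seq nth e0 (map a S) k | k <- [seq index l S | l <- s]].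
Proof.
move=> sS; rewrite -map_comp; apply/eq_in_map => l /sS lS /=.
by rewrite (nth_map l) ?index_mem // nth_index.
Qed.

Lemma allin_map (a : L -> M) S : (forall l, a l ∈ c) -> allin (fun x => x ∈ c) (map a S).
Proof. by move=> ac; apply/allP => _ /mapP[l _ ->]; apply/asboolP. Qed.

Lemma tup_map_in (a : L -> M) S : (forall l, a l ∈ c) -> tup (map a S) ∈ tups (size S) c.
Proof. by move=> ac; apply: tup_in; [rewrite size_map|exact: allin_map]. Qed.

Lemma lift f (s S : seq L) : {subset s <= S} -> exists g, forall a, (forall l, a l ∈ c) ->
  app g (tup (map a S)) = app f (tup (map a s)).
Proof.
move=> sS.
have [|g gE] := @recode _ mostM f c (size S) [seq index l S | l <- s].
  by apply/allP => _ /mapP[l /sS lS ->]; rewrite index_mem.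
exists g => a ac; rewrite gE ?size_map //; last exact: allin_map.
by rewrite -map_select.
Qed.

Lemma ultra b (S : seq L) : exists k, (forall a, incr k S a -> tup (map a S) ∈ b) \/
  (forall a, incr k S a -> ~ tup (map a S) ∈ b).
Proof.
(* With [f] the identity, [g] rebuilds the tuple over [S], possibly unsorted and with repetitions,
   from the decreasing one over [dsort S], to which homogeneity applies. *)
have [|f fE] := @fun_ex _ mostM (fun x => x) (tups (size S) c); first by rewrite /good1; dfn.
have [|g gE] := @lift f S (dsort S); first by move=> l; rewrite mem_dsort.
have [|b' bE] := @sep_ex _ mM (fun Q => app g Q ∈ b) (tups (size (dsort S)) c); first by dfn.
have key k a : incr k S a -> dlist (size (dsort S)) (X k) (map a (dsort S)) /\
    (tup (map a (dsort S)) ∈ b' <-> tup (map a S) ∈ b).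
  move=> ia; have [ac _ _] := ia; split.
    by apply: incr_dlist ia; [move=> l; rewrite mem_dsort|exact: dsort_desc].
  rewrite bE gE // fE; last exact: tup_map_in.
  by split=> [[]//|]; split=> //; exact: tup_map_in.
have [k [H|H]] := Xhom (size (dsort S)) b'; exists k; [left|right] => a ia;
  have [dl E] := key k a ia; first by apply/E; exact: H.
by move/E; exact: H.
Qed.

Definition raw := (M * seq L)%type.
Definition ev (t : raw) a := app t.1 (tup (map a t.2)).

Lemma common (v : nat -> raw) K : exists S f, forall i, i < K ->
  forall a, (forall l, a l ∈ c) -> ev (v i) a = app (f i) (tup (map a S)).
Proof.
pose S := flatten [seq (v i).2 | i <- iota 0 K].
have /choice[f fE] i : exists g, i < K -> forall a, (forall l, a l ∈ c) ->
    app g (tup (map a S)) = ev (v i) a.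
  case: (ltnP i K) => iK; last by exists c.
  have [|g gE] := @lift (v i).1 (v i).2 S; last by exists g.
  move=> l li; apply/flattenP; exists (v i).2 => //; apply/mapP; exists i => //.
  by rewrite mem_iota.
by exists S, f => i iK a ac; rewrite fE.
Qed.

(** [sigma1]-separation in [M] turns the truth set of the formula, as a set of tuples over a common
    index list, into an element of [M], which [ultra] decides. *)
Lemma dec_sat f (v : nat -> raw) : sigma1 f ->
  ae (fun a => sat (fun i => ev (v i) a) f) \/ ae (fun a => ~ sat (fun i => ev (v i) a) f).
Proof.
move=> sf; have [S [g gE]] := common v (bd f).
have [|P0 [dP0 P0E]] := sigma1_def mostM sf (G := ext (c0 M)) (t := fun i e => app (g i) e.2).
  by move=> i; dfn.
have [|b bE] := @sep_sigma _ mostM (fun q y => P0 (tt, q) y) (tups (size S) c).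
  by apply: def_iff dP0 => -[[[] q] y].
have key a : (forall l, a l ∈ c) -> (tup (map a S) ∈ b <-> sat (fun i => ev (v i) a) f).
  move=> ac; rewrite bE.
  have -> : sat (fun i => ev (v i) a) f <-> sat (fun i => app (g i) (tup (map a S))) f.
    by apply: sat_ext => i ib; exact: gE.
  have -> := P0E (tt, tup (map a S)).
  by split=> [[]//|]; split=> //; exact: tup_map_in.
have [k [H|H]] := ultra b S; [left|right]; exists k, S => a ia; have [ac _ _] := ia.
  by apply/key => //; exact: H.
by move/(key a ac); exact: H.
Qed.

Lemma wit_def (P : M -> M -> Prop) S : def2 P ->
  ae (fun a => exists y, P (tup (map a S)) y) ->
  exists f, ae (fun a => P (tup (map a S)) (ev (f, S) a)).
Proof.
move=> dP H; have [f fE] := unif mostM (tups (size S) c) dP.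
by exists f; apply: ae_mono H => a ac; apply: fE; exact: tup_map_in.
Qed.

Lemma wit_sat f (v : nat -> raw) x : sigma1 f ->
  ae (fun a => exists y, sat [eta (fun i => ev (v i) a) with x |-> y] f) ->
  exists u, ae (fun a => sat [eta (fun i => ev (v i) a) with x |-> ev u a] f).
Proof.
move=> sf H; have [S [g gE]] := common v (bd f).
have [|P0 [dP0 P0E]] := sigma1_def mostM sf (G := ext (ext (c0 M)))
    (t := fun i e => if i == x then e.2 else app (g i) e.1.2).
  by move=> i; case: (i == x); dfn.
have [|h hE] := @unif_sigma _ mostM (fun q x z => P0 (tt, q, x) z) (tups (size S) c).
  by apply: def_iff dP0 => -[[[[] q] y] z].
have key a y : (forall l, a l ∈ c) -> sat [eta (fun i => ev (v i) a) with x |-> y] f <->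
    exists z, P0 (tt, tup (map a S), y) z.
  move=> ac; rewrite -P0E; apply: sat_ext => i ib /=.
  by case: (i == x) => //; exact: gE.
exists (h, S); apply: ae_mono H => a ac [y /(key a y ac) [z Pz]].
apply/key => //; apply: hE; first exact: tup_map_in.
by exists y, z.
Qed.

(** * The ultrapower and Łoś's theorem *)

Definition eqc (t : raw) : set raw := [set u | ae (fun a => ev t a = ev u a)].

Lemma eqcP t u : eqc t = eqc u <-> ae (fun a => ev t a = ev u a).
Proof.
split=> [e|H]; last apply/seteqP; last split=> w.
- have : eqc u u by apply: ae_all.
  by rewrite -e.
- by apply: ae_mono2 H => a _ <-.
- by apply: ae_mono2 H => a _ ->.
Qed.

(** Classes instead of terms, since [sat] interprets equality by equality in the carrier. *)
Definition ucarrier := {T : set raw | exists t, T = eqc t}.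
Definition ucls (t : raw) : ucarrier := exist _ (eqc t) (ex_intro _ t erefl).

Definition ultrapower := @Structure ucarrier (fun x y => exists t u,
  [/\ x = ucls t, y = ucls u & ae (fun a => ev t a ∈ ev u a)]).
Local Notation N := ultrapower.
Definition cls (t : raw) : N := ucls t.

Lemma cls_surj (x : N) : exists t, x = cls t.
Proof.
case: x => T [t Tt]; exists t; apply: eq_sig_hprop => //= ?; exact: Prop_irrelevance.
Qed.

Lemma cls_eq t u : cls t = cls u <-> ae (fun a => ev t a = ev u a).
Proof.
rewrite -eqcP; split=> [[]//|e]; apply: eq_sig_hprop => //= ?; exact: Prop_irrelevance.
Qed.

Lemma cls_mem t u : cls t ∈ cls u <-> ae (fun a => ev t a ∈ ev u a).
Proof.
split=> [[t' [u' [/cls_eq H1 /cls_eq H2 H3]]]|H]; last by exists t, u.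
by apply: ae_mono2 (ae_and H1 H2) H3 => a _ [-> ->].
Qed.

Opaque ultrapower.

Lemma cls_update (v : nat -> raw) x u f :
  sat [eta (fun i => cls (v i)) with x |-> cls u] f <->
  sat (fun i => cls ([eta v with x |-> u] i)) f.
Proof. by apply: sat_eq => i /=; case: (i == x). Qed.

Lemma ev_update (v : nat -> raw) x u a f :
  sat [eta (fun i => ev (v i) a) with x |-> ev u a] f <->
  sat (fun i => ev ([eta v with x |-> u] i) a) f.
Proof. by apply: sat_eq => i /=; case: (i == x). Qed.

Lemma los_ex f x : sigma1 f -> (forall v, sat (fun i => cls (v i)) f <->
    ae (fun a => sat (fun i => ev (v i) a) f)) ->
  forall v, sat (fun i => cls (v i)) (fEx x f) <->
    ae (fun a => sat (fun i => ev (v i) a) (fEx x f)).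
Proof.
move=> sf IH v; split=> [[y]|H].
  have [u ->] := cls_surj y => /cls_update/IH.
  by apply: ae_mono => a _ H; exists (ev u a); apply/ev_update.
have [u Hu] := wit_sat sf H; exists (cls u); apply/cls_update; apply/IH.
by apply: ae_mono Hu => a _ /ev_update.
Qed.

Lemma los_not f : delta0 f -> (forall v, sat (fun i => cls (v i)) f <->
    ae (fun a => sat (fun i => ev (v i) a) f)) ->
  forall v, sat (fun i => cls (v i)) (fNot f) <->
    ae (fun a => sat (fun i => ev (v i) a) (fNot f)).
Proof.
move=> df IH v; split=> [/= H|H /IH H'].
  by case: (dec_sat v (sigma1_delta0 df)) => // /IH.
by apply: ae_false; apply: ae_mono2 H H' => a _; exact.
Qed.

(** Disjunction, implication and negation rest on [dec_sat], bounded existence on the witness terms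
    of [wit_sat]; the universal quantifier is treated as the negation of an existential one. *)
Lemma los0 f : delta0 f -> forall v, sat (fun i => cls (v i)) f <->
  ae (fun a => sat (fun i => ev (v i) a) f).
Proof.
elim=> {f}.
- by move=> i j v; exact: cls_mem.
- by move=> i j v; exact: cls_eq.
- by move=> f df IH; exact: los_not.
- move=> f g _ IHf _ IHg v /=; rewrite IHf IHg; split=> [[]|H]; first exact: ae_and.
  by split; apply: ae_mono H => a _ [].
- move=> f g df IHf dg IHg v /=; split=> [[/IHf|/IHg]|H].
  + by apply: ae_mono; left.
  + by apply: ae_mono; right.
  case: (dec_sat v (sigma1_delta0 df)) => [/IHf|nf]; [by left|right; apply/IHg].
  by apply: ae_mono2 H nf => a _ [].
- move=> f g df IHf dg IHg v /=; split=> [H|H /IHf Hf]; last first.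
    by apply/IHg; apply: ae_mono2 H Hf => a _; exact.
  case: (dec_sat v (sigma1_delta0 df)) => [/IHf/H/IHg|].
    by apply: ae_mono.
  by apply: ae_mono.
- move=> x y f xy df IH v; apply: los_ex.
    by do 2!constructor => //; constructor.
  move=> w /=; rewrite IH cls_mem; split=> [[]|H]; first exact: ae_and.
  by split; apply: ae_mono H => a _ [].
- move=> x y f xy df IH v.
  have dn : delta0 (fAnd (fMem x y) (fNot f)) by do !constructor.
  have := @los_not (fEx x (fAnd (fMem x y) (fNot f))).
  move=> /(_ (delta0_ex xy (delta0_not df))) K.
  have {}K H := K (los_ex x (sigma1_delta0 dn) H) v.
  have E (A : structure) (w : nat -> A) : sat w (fAll x (fImp (fMem x y) f)) <->
      sat w (fNot (fEx x (fAnd (fMem x y) (fNot f)))).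
    split=> [H [b [bm nb]]|H b bm]; first exact: nb (H b bm).
    by apply: contrapT => nb; apply: H; exists b.
  rewrite E K; first by apply: ae_iff => a _; rewrite E.
  move=> w; split.
    move=> [wm /(los_not df IH) nf]; move/cls_mem: wm; move: nf.
    by apply: ae_mono2 => a _ ? ?; split.
  move=> H; split; first by apply/cls_mem; apply: ae_mono H => a _ [].
  by apply/(los_not df IH); apply: ae_mono H => a _ [].
Qed.

Lemma los1 f : sigma1 f -> forall v, sat (fun i => cls (v i)) f <->
  ae (fun a => sat (fun i => ev (v i) a) f).
Proof.
elim=> {f} [f df|x f sf IH]; first exact: los0.
exact: los_ex.
Qed.

Lemma ex_cls f (v : nat -> raw) x : delta0 f ->
  ae (fun a => exists y, sat [eta (fun i => ev (v i) a) with x |-> y] f) ->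
  exists u, sat [eta (fun i => cls (v i)) with x |-> cls u] f.
Proof.
move=> df H; have [u Hu] := wit_sat (sigma1_delta0 df) H; exists u.
by apply/cls_update; apply/los0 => //; apply: ae_mono Hu => a _ /ev_update.
Qed.

(** * The axioms of [MOST] in the ultrapower *)

Ltac d0 := repeat first [done | constructor].

Lemma ultra_ext (x y : N) : (forall z, z ∈ x <-> z ∈ y) -> x = y.
Proof.
have [t ->] := cls_surj x; have [u ->] := cls_surj y => H.
pose f := fOr (fAnd (fMem 2 0) (fNot (fMem 2 1))) (fAnd (fMem 2 1) (fNot (fMem 2 0))).
apply/cls_eq; pose v i := nth t [:: t; u] i.
have dE : sigma1 (fEq 0 1) by d0.
case: (dec_sat v dE) => // ne.
have [||w] := @ex_cls f v 2; first by d0.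
  apply: ae_mono ne => a _ /= ne; apply: contrapT => nz; apply: ne.
  apply: (mac_ext mM) => z; split=> zin; apply: contrapT => nzin; apply: nz; exists z;
    by [left|right].
by case=> /= -[w1 []]; apply/H.
Qed.

Lemma ultra_pairing (x y : N) : exists z, is_upair z x y.
Proof.
have [t ->] := cls_surj x; have [u ->] := cls_surj y.
pose f := fAnd (fMem 0 2) (fAnd (fMem 1 2)
  (fAll 3 (fImp (fMem 3 2) (fOr (fEq 3 0) (fEq 3 1))))).
have [||w [/= H1 [H2 H3]]] := @ex_cls f (nth t [:: t; u]) 2; first by d0.
  apply: ae_all => a _; exists (upair (ev t a) (ev u a)); split=> /=.
    by apply/in_upair; left.
  split; first by apply/in_upair; right.
  by move=> z /in_upair.
by exists (cls w) => z; split=> [/H3//|[]->].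
Qed.

Definition fUP z x y w := fAnd (fMem x z) (fAnd (fMem y z)
  (fAll w (fImp (fMem w z) (fOr (fEq w x) (fEq w y))))).
Definition fOP := fAnd (fEx 3 (fAnd (fMem 3 0) (fUP 3 1 1 4)))
  (fAnd (fEx 3 (fAnd (fMem 3 0) (fUP 3 1 2 4)))
  (fAll 3 (fImp (fMem 3 0) (fOr (fUP 3 1 1 4) (fUP 3 1 2 4))))).

Lemma sat_fOP (A : structure) (v : nat -> A) :
  (forall x y : A, (forall z, z ∈ x <-> z ∈ y) -> x = y) ->
  (forall x y : A, exists z, is_upair z x y) ->
  sat v fOP <-> is_opair (v 0) (v 1) (v 2).
Proof.
move=> xt pr.
have U z x y : (x ∈ z /\ y ∈ z /\ forall w, w ∈ z -> w = x \/ w = y) <-> @is_upair A z x y.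
  split=> [[H1 [H2 H3]] w|H]; first by split=> [/H3//|[]->].
  by split; [apply/H; left|split; [apply/H; right|move=> w /H]].
have un1 z z' x y : @is_upair A z x y -> is_upair z' x y -> z = z'.
  by move=> H H'; apply: xt => w; rewrite H H'.
split=> /=.
  move=> [[z [z0 /U z1]] [[z' [z'0 /U z'1]] H]] w; split.
    by move=> /H[/U|/U]; [left|right].
  by case=> H'; [rewrite (un1 _ _ _ _ H' z1)|rewrite (un1 _ _ _ _ H' z'1)].
move=> H; have [z zE] := pr (v 1) (v 1); have [z' z'E] := pr (v 1) (v 2).
split; first by exists z; split; [apply/H; left|apply/U].
split; first by exists z'; split; [apply/H; right|apply/U].
by move=> w /H[/U|/U]; [left|right].
Qed.

Lemma cls_opair w t u : is_opair (cls w) (cls t) (cls u) <->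
  ae (fun a => ev w a = opair (ev t a) (ev u a)).
Proof.
have dOP : delta0 fOP by d0.
have := @los0 _ dOP (nth t [:: w; t; u]).
rewrite sat_fOP; [|exact: ultra_ext|exact: ultra_pairing].
move=> /= ->; apply: ae_iff => a _; rewrite -is_opairE.
by have := @sat_fOP M (fun i => ev (nth t [:: w; t; u] i) a); apply;
  [exact: (mac_ext mM)|exact: (mac_pairing mM)].
Qed.

Lemma cls_graph r t u : graph (cls r) (cls t) (cls u) <->
  ae (fun a => opair (ev t a) (ev u a) ∈ ev r a).
Proof.
split=> [[p]|H].
  have [w ->] := cls_surj p; rewrite cls_opair cls_mem.
  by apply: ae_mono2 => a _ ->.
have [S [g gE]] := common (nth t [:: t; u]) 2.
have [||f Hf] := @wit_def (fun q p => p = opair (app (g 0) q) (app (g 1) q)) S; first by dfn.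
  by apply: ae_all => a _; exists (opair (app (g 0) (tup (map a S))) (app (g 1) (tup (map a S)))).
have K : ae (fun a => ev (f, S) a = opair (ev t a) (ev u a)).
  by apply: ae_mono Hf => a ac ->; rewrite -(gE 0) // -(gE 1).
exists (cls (f, S)); first exact/cls_opair.
by apply/cls_mem; apply: ae_mono2 K H => a _ ->.
Qed.

Lemma cls_subs t u : subs (cls t) (cls u) <-> ae (fun a => subs (ev t a) (ev u a)).
Proof.
have df : delta0 (fSub 2 0 1) by d0.
exact: (@los0 _ df (nth t [:: t; u])).
Qed.

(** Quantifiers over elements or subsets of the values of a term become bounded by [U] or
    [pow U]. *)
Lemma bound_ex f s : exists U, forall a, (forall l, a l ∈ c) -> subs (ev (f, s) a) U.
Proof.
have [b bE] := range_ex mostM f (tups (size s) c).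
exists (un b) => a ac z zf; apply/in_un; exists (ev (f, s) a) => //.
by apply: bE; exact: tup_map_in.
Qed.

(** Separating one set [D] of pairs from [prod W U] performs the separation in all fibres
    simultaneously; what remains to be chosen for each tuple is [delta0] in [D]. *)
Lemma sep_cls f i (v : nat -> raw) t : sigma1 f -> exists u, ae (fun a => forall x,
  x ∈ ev u a <-> x ∈ ev t a /\ sat [eta (fun j => ev (v j) a) with i |-> x] f).
Proof.
move=> sf; have [S [g gE]] := common (fun k => if k is k'.+1 then v k' else t) (bd f).+1.
have [|P0 [dP0 P0E]] := sigma1_def mostM sf (G := ext (ext (c0 M)))
    (t := fun j e => if j == i then e.2 else app (g j.+1) e.1.2).
  by move=> j; case: (j == i); dfn.
have [U UE] := bound_ex (g 0) S.
pose W := tups (size S) c.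
have [|D DE] := @sep_sigma _ mostM (fun p z => exists q x, p = opair q x /\ P0 (tt, q, x) z)
    (prod W U).
  apply: def_expair; first by dfn.
  pose s (e : ext (ext (ext (ext (c0 M))))) : ext (ext (ext (c0 M))) :=
    (tt, e.1.2, e.2, e.1.1.2).
  have ss : csub s.
    move=> u [->|[w vv ->]]; left.
      by right; exists (snd \o fst) => //; right; exists snd => //; left.
    case: vv => [->|[z zz ->]]; first by left.
    by case: zz => [->|[? []]]; right; exists snd => //; left.
  exact: (def_csub ss dP0).
have {}DE q x : opair q x ∈ D <-> (q ∈ W /\ x ∈ U) /\ exists z, P0 (tt, q, x) z.
  rewrite DE in_prod; split; last by move=> [qx [z H]]; split=> //; exists z, q, x.
  move=> [qx [z [q' [x' [/opair_inj[e1 e2] H]]]]]; subst q' x'.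
  by split; [exact: qx|exists z; exact: H].
have [||h Hh] := @wit_def (fun q b => (forall x, x ∈ b -> x ∈ app (g 0) q /\ opair q x ∈ D) /\
   (forall x, x ∈ app (g 0) q -> opair q x ∈ D -> x ∈ b)) S; first by dfn.
  apply: ae_all => a _; set q := tup _.
  have [|b bE] := @sep_ex _ mM (fun x => opair q x ∈ D) (app (g 0) q); first by dfn.
  by exists b; split=> [x /bE//|x ? ?]; apply/bE.
exists (h, S); apply: ae_mono Hh => a ac [H1 H2] x.
have -> : ev t a = app (g 0) (tup (map a S)) by exact: (gE 0).
have -> : sat [eta (fun j => ev (v j) a) with i |-> x] f <->
    exists z, P0 (tt, tup (map a S), x) z.
  rewrite -P0E; apply: sat_ext => j jb /=; case: (j == i) => //.
  exact: (gE j.+1).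
split=> [/H1[xg /DE[_]]//|[xg H]]; apply: H2 => //; apply/DE; split=> //.
by split; [exact: tup_map_in|exact: UE xg].
Qed.

Lemma ultra_sep : separation N sigma1.
Proof.
move=> f i v' w sf.
have /choice[v vE] k := cls_surj (v' k).
have [t ->] := cls_surj w; have [u Hu] := sep_cls i v t sf.
exists (cls u) => x; have [s ->] := cls_surj x.
have -> : sat [eta v' with i |-> cls s] f <-> ae (fun a =>
    sat [eta (fun j => ev (v j) a) with i |-> ev s a] f).
  have -> : sat [eta v' with i |-> cls s] f <-> sat (fun j => cls ([eta v with i |-> s] j)) f.
    by rewrite -cls_update; apply: sat_eq => j /=; rewrite vE.
  by rewrite los1 //; apply: ae_iff => a _; rewrite ev_update.
rewrite !cls_mem; split=> [H|[H1 H2]].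
  by split; apply: ae_mono2 H Hu => a _ xu /(_ (ev s a)) /iffLR /(_ xu) [].
by apply: ae_mono2 (ae_and H1 H2) Hu => a _ [K1 K2] /(_ (ev s a)) E; apply/E.
Qed.

(** The hypothesis is a bounded universal quantifier over an existential one, so Łoś's theorem for
    [sigma1] does not transfer it directly. Separating the elements of [w] that have a witness gives
    a term [u] which extensionality in [N] identifies with [w]. Hence the hypothesis holds in [M]
    almost everywhere, and collection in [M] applies there. *)
Lemma ultra_coll : collection N delta0.
Proof.
move=> f i j v' w df ij H.
have /choice[v vE] k := cls_surj (v' k).
have [t tE] := cls_surj w.
have sf : sigma1 (fEx j f) by do 2!constructor.
have [u Hu] := sep_cls i v t sf.
(* [K] and [K.+1] are fresh variables, for the collecting set and for [w]. *)
pose K := maxn (bd f) (maxn i.+1 j.+1).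
have bK k : k < bd f -> k < K by move=> kb; rewrite leq_max kb.
have iK : i < K by rewrite !leq_max ltnSn orbT.
have jK : j < K by rewrite !leq_max ltnSn !orbT.
have ut : ae (fun a => ev u a = ev t a).
  apply/cls_eq; apply: ultra_ext => x; have [s ->] := cls_surj x; rewrite !cls_mem; split.
    by move=> H1; apply: ae_mono2 H1 Hu => a _ xu /(_ (ev s a)) /iffLR /(_ xu) [].
  move=> st; have [|y Hy] := H (cls s); first by rewrite tE; apply/cls_mem.
  have [r yE] := cls_surj y; subst y.
  have Hs : ae (fun a => sat [eta (fun j => ev (v j) a) with i |-> ev s a] (fEx j f)).
    have : sat (fun k => cls ([eta v with i |-> s, j |-> r] k)) f.
      by move: Hy; apply sat_eq => k /=; case: (k == i) => //; case: (k == j) => //; rewrite vE.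
    move/(los0 df); apply: ae_mono => a _ Hf; exists (ev r a).
    move: Hf; apply sat_eq => k /=; case: (k =P j) => [->|]; last by case: (k == i).
    by case: (j =P i) => // e; case: ij.
  by apply: ae_mono2 (ae_and st Hs) Hu => a _ [H1 H2] /(_ (ev s a)) E; apply/E.
pose g := fAll i (fImp (fMem i K.+1) (fEx j (fAnd (fMem j K) f))).
have neq k : k < K -> (k == K) = false /\ (k == K.+1) = false.
  by move=> kK; rewrite !ltn_eqF // ltnW.
have dg : delta0 g.
  apply: delta0_all; first by move=> e; move: iK; rewrite e ltnNge leqnSn.
  by apply: delta0_ex => // e; move: jK; rewrite e ltnn.
have gE (A : structure) (z : nat -> A) (w' b : A) :
    sat [eta [eta z with K.+1 |-> w'] with K |-> b] g <-> forall x, x ∈ w' ->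
      exists2 y, y ∈ b & sat [eta z with i |-> x, j |-> y] f.
  have [iK0 iK1] := neq i iK; have [jK0 jK1] := neq j jK.
  have ji : (j == i) = false by apply/eqP => e; apply: ij.
  have E x y : sat [eta [eta [eta [eta z with K.+1 |-> w'] with K |-> b] with i |-> x]
      with j |-> y] f <-> sat [eta z with i |-> x, j |-> y] f.
    apply: sat_ext => k /bK kK /=; have [-> ->] := neq k kK.
    by case: (k =P j) => // ->; rewrite ji.
  rewrite /= !eqxx !(eq_sym K) !(eq_sym K.+1) iK1 jK0 iK0 (ltn_eqF (ltnSn K)).
  split=> G x /G[y]; first by move=> [yb /E]; exists y.
  by move=> yb /E; exists y.
have [|b Hb] := @ex_cls g [eta v with K.+1 |-> t] K dg.
  apply: ae_mono2 Hu ut => a _ Hu ut.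
  have [|C CE] := @most_collection _ mostM f i j (fun k => ev (v k) a) (ev t a) df ij.
    move=> x xt; have [|_ [y Hy]] := iffLR (Hu x); first by rewrite ut.
    exists y; move: Hy; apply sat_eq => k /=; case: (k =P j) => [->|] //.
    by case: (j =P i) => // e; case: ij.
  exists C.
  have /(gE M (fun k => ev (v k) a) (ev t a) C) : forall x, x ∈ ev t a ->
      exists2 y, y ∈ C & sat [eta (fun k => ev (v k) a) with i |-> x, j |-> y] f by [].
  by apply sat_eq => k /=; case: (k == K) => //; case: (k == K.+1).
exists (cls b).
have /gE K' : sat [eta [eta (fun k => cls (v k)) with K.+1 |-> w] with K |-> cls b] g.
  by move: Hb; apply sat_eq => k /=; case: (k == K) => //; case: (k == K.+1).
move=> x /K'[y yb Hy]; exists y => //; move: Hy; apply sat_eq => k /=.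
by case: (k == i) => //; case: (k == j) => //; rewrite vE.
Qed.

Lemma ultra_powerset (x : N) : exists y, forall z, z ∈ y <-> subs z x.
Proof.
have [[f s] ->] := cls_surj x; have [U UE] := bound_ex f s.
have [||h Hh] := @wit_def (fun q y => (forall z, z ∈ y -> subs z (app f q)) /\
   (forall z, z ∈ pow U -> subs z (app f q) -> z ∈ y)) s; first by dfn.
  apply: ae_all => a _; exists (pow (app f (tup (map a s)))).
  by split=> [z /in_pow //|z _ zf]; apply/in_pow.
exists (cls (h, s)) => z; have [t ->] := cls_surj z; rewrite cls_mem cls_subs.
split=> H; first by apply: ae_mono2 Hh H => a _ [K _]; exact: K.
apply: ae_mono2 Hh H => a ac [_ K] ts; apply: K => //.
by apply/in_pow => y /ts; exact: UE.
Qed.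

Lemma dec_def (P : M -> Prop) (S : seq L) : def1 P ->
  ae (fun a => P (tup (map a S))) \/ ae (fun a => ~ P (tup (map a S))).
Proof.
move=> dP; have [b bE] := sep_ex mM (tups (size S) c) dP.
have [k [H|H]] := ultra b S; [left|right]; exists k, S => a ia; have [ac _ _] := ia.
  by have /bE[] := H a ia.
by move=> Pa; apply: (H a ia); apply/bE; split=> //; exact: tup_map_in.
Qed.

Lemma dec_graph r t u : ae (fun a => opair (ev t a) (ev u a) ∈ ev r a) \/
  ae (fun a => ~ opair (ev t a) (ev u a) ∈ ev r a).
Proof.
have [S [g gE]] := common (nth t [:: t; u; r]) 3.
have [|H|H] := @dec_def (fun q => opair (app (g 0) q) (app (g 1) q) ∈ app (g 2) q) S.
- by dfn.
- by left; apply: ae_mono H => a ac; rewrite -(gE 0) // -(gE 1) // -(gE 2).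
- by right; apply: ae_mono H => a ac; rewrite -(gE 0) // -(gE 1) // -(gE 2).
Qed.

Lemma ultra_wo (x : N) : exists r, well_orders (graph r) x.
Proof.
have [[f s] ->] := cls_surj x; have [U UE] := bound_ex f s.
(* Being well-ordered is put in [delta0] form: subsets range over [pow U], and non-emptiness is a
   negated bounded quantifier. *)
have [||h Hh] := @wit_def (fun q r =>
  ((forall a, a ∈ app f q -> ~ opair a a ∈ r) /\
   (forall a, a ∈ app f q -> forall b, b ∈ app f q -> forall d, d ∈ app f q ->
     opair a b ∈ r -> opair b d ∈ r -> opair a d ∈ r)) /\
  ((forall a, a ∈ app f q -> forall b, b ∈ app f q ->
     opair a b ∈ r \/ (a = b \/ opair b a ∈ r)) /\
   (forall y, y ∈ pow U -> subs y (app f q) -> ~ (forall z, z ∈ y -> ~ z = z) ->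
     exists2 a, a ∈ y & forall b, b ∈ y -> b = a \/ opair a b ∈ r))) s; first by dfn.
  apply: ae_all => a _; set z := app f _.
  have [r [irr trs tot mn]] := mac_wo mM z; exists r.
  have gE := graphE mM r.
  split; split.
  - by move=> b /irr; rewrite gE.
  - by move=> b bz d dz e ez; have := trs b d e bz dz ez; rewrite !gE.
  - move=> b bz d dz; case: (tot b d bz dz); rewrite ?gE; tauto.
  - move=> y _ yz ny; have [|b by' bmin] := mn y yz.
      by move=> ey; apply: ny => e /ey.
    by exists b => // d /bmin; rewrite gE.
exists (cls (h, s)); split.
- move=> a; have [t ->] := cls_surj a; rewrite cls_mem cls_graph => H1 H2.
  apply: ae_false; apply: ae_mono2 Hh (ae_and H1 H2) => b _ [[irr _] _] [K1 K2].
  exact: irr K1 K2.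
- move=> a b d; have [t ->] := cls_surj a; have [u ->] := cls_surj b.
  have [w ->] := cls_surj d; rewrite !cls_mem !cls_graph => H1 H2 H3 H4 H5.
  apply: ae_mono2 Hh (ae_and (ae_and H1 H2) (ae_and H3 (ae_and H4 H5))).
  move=> e _ [[_ trs] _] [[K1 K2] [K3 [K4 K5]]].
  exact: trs K4 K5.
- move=> a b; have [t ->] := cls_surj a; have [u ->] := cls_surj b.
  rewrite !cls_mem => H1 H2.
  case: (dec_graph (h, s) t u) => [/cls_graph|n1]; first by constructor 1.
  case: (dec_graph (h, s) u t) => [/cls_graph|n2]; first by constructor 3.
  constructor 2; apply/cls_eq; apply: ae_mono2 Hh (ae_and (ae_and H1 H2) (ae_and n1 n2)).
  by move=> e _ [_ [tot _]] [[K1 K2] [K3 K4]]; case: (tot _ K1 _ K2) => // -[].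
- move=> y; have [t ->] := cls_surj y; rewrite cls_subs => H1 H2.
  have ne : ae (fun a => exists z, z ∈ ev t a).
    have [z] : exists z : N, z ∈ cls t.
      by apply: contrapT => nz; apply: H2 => z zt; apply: nz; exists z.
    have [w ->] := cls_surj z; rewrite cls_mem; apply: ae_mono => a _.
    by exists (ev w a).
  (* The least element must itself be given by a term, so it is chosen uniformly in the tuple. *)
  have [S [g gE]] := common (nth t [:: t; (h, s)]) 2.
  have [||w Hw] := @wit_def (fun q e => e ∈ app (g 0) q /\
    forall b, b ∈ app (g 0) q -> b = e \/ opair e b ∈ app (g 1) q) S; first by dfn.
    apply: ae_mono2 Hh (ae_and H1 ne) => a ac [_ [_ mn]] [K1 [z zt]].
    rewrite -(gE 0) // -(gE 1) //=; have [|//||e et emin] := mn (ev t a).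
    - by apply/in_pow => x' /K1; exact: UE.
    - by move/(_ z zt); exact.
    by exists e.
  have {}Hw : ae (fun a => ev (w, S) a ∈ ev t a /\
      forall b, b ∈ ev t a -> b = ev (w, S) a \/ opair (ev (w, S) a) b ∈ ev (h, s) a).
    by apply: ae_mono Hw => a ac; rewrite -(gE 0) // -(gE 1).
  exists (cls (w, S)); first by apply/cls_mem; apply: ae_mono Hw => a _ [].
  move=> b; have [u ->] := cls_surj b; rewrite cls_mem cls_graph cls_eq => ub.
  case: (dec_graph (h, s) (w, S) u) => [|n1]; [by right|left].
  by apply: ae_mono2 Hw (ae_and ub n1) => a _ [_ K] [/K[]].
Qed.

Lemma ultra_most : MOST N.
Proof.
have t0 : raw := (c, [::]).
have Mext := mac_ext mM.
split; [split|exact: ultra_sep|exact: ultra_coll].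
- exact: ultra_ext.
- exact: ultra_pairing.
- pose f := fAll 1 (fImp (fMem 1 0) (fNot (fEq 1 1))).
  have [||u /= H] := @ex_cls f (fun=> t0) 0; first by d0.
    by apply: ae_all => a _; exists e0 => z /in_e0.
  by exists (cls u) => z /H.
- move=> x; have [t ->] := cls_surj x.
  pose f := fAnd (fAll 2 (fImp (fMem 2 1) (fEx 3 (fAnd (fMem 3 0) (fMem 2 3)))))
    (fAll 3 (fImp (fMem 3 0) (fAll 2 (fImp (fMem 2 3) (fMem 2 1))))).
  have [||u /= [H1 H2]] := @ex_cls f (fun=> t) 1; first by d0.
    apply: ae_all => a _; exists (un (ev t a)); split=> /=.
      by move=> z /in_un[w]; exists w.
    by move=> w wt z zw; apply/in_un; exists w.
  exists (cls u) => z; split=> [/H1[w []]|[w wt /(H2 w wt)]//]; by exists w.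
- pose f := fAnd (fEx 1 (fAnd (fMem 1 0) (fAll 2 (fImp (fMem 2 1) (fNot (fEq 2 2))))))
    (fAll 1 (fImp (fMem 1 0) (fEx 2 (fAnd (fMem 2 0) (fAnd (fMem 1 2)
      (fAnd (fAll 3 (fImp (fMem 3 1) (fMem 3 2)))
            (fAll 3 (fImp (fMem 3 2) (fOr (fMem 3 1) (fEq 3 1)))))))))).
  have [||u /= [H1 H2]] := @ex_cls f (fun=> t0) 0; first by d0.
    apply: ae_all => a _; have [x [[z ez zx] H]] := mac_infinity mM.
    exists x; split=> /=; first by exists z; split=> // w /ez.
    move=> y /H[s sy sx]; exists s; split=> //; split; first by apply/sy; right.
    by split=> w; [move=> wy; apply/sy; left|move/sy].
  exists (cls u); split.
    by case: H1 => z [zu ez]; exists z => // w /ez.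
  move=> y /H2[s [su [ys [H3 H4]]]]; exists s => // w.
  by split=> [/H4//|[/H3//|->]].
- exact: ultra_powerset.
- move=> x; have [t ->] := cls_surj x.
  pose f := fAnd (fAll 2 (fImp (fMem 2 1) (fAll 3 (fImp (fMem 3 2) (fMem 3 1)))))
    (fAll 2 (fImp (fMem 2 0) (fMem 2 1))).
  have [||u /= [H1 H2]] := @ex_cls f (fun=> t) 1; first by d0.
    apply: ae_all => a _; have [y ty xy] := mac_tc mM (ev t a); exists y; split=> /=.
      by move=> z zy w; exact: ty.
    by move=> z; exact: xy.
  by exists (cls u).
- by move=> f i v a df; apply: ultra_sep; constructor.
- move=> x; have [t ->] := cls_surj x => nx.
  have [z zt] : exists z : N, z ∈ cls t.
    by apply: contrapT => nz; apply: nx => z zt; apply: nz; exists z.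
  pose f := fAnd (fMem 1 0) (fAll 2 (fImp (fMem 2 1) (fNot (fMem 2 0)))).
  have [||u /= [H1 H2]] := @ex_cls f (fun=> t) 1; first by d0.
    move: zt; have [w ->] := cls_surj z; rewrite cls_mem; apply: ae_mono => a _ wt.
    have [|y yt ymin] := @mac_foundation _ mM (ev t a); first by move/(_ _ wt).
    by exists y; split.
  by exists (cls u).
- exact: ultra_wo.
Qed.

(** * Automorphisms induced by the index order *)

Definition act (j : aut L) (t : raw) : raw := (t.1, map j t.2).

Lemma ev_act j t a : ev (act j t) a = ev t (a \o j).
Proof. by rewrite /ev /= -map_comp. Qed.

(** All indices share the same sets [X k], so the filter depends on [L] through its order alone. *)
Lemma ae_act (j : aut L) P : ae P -> ae (fun a => P (a \o j)).
Proof.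
move=> [k [S H]]; exists k, (map j S) => a [ac aX ai]; apply: H; split=> /=.
- by move=> l; exact: ac.
- by move=> l lS; apply: aX; exact: map_f.
- by move=> l l' lS l'S ll'; apply: ai; [exact: map_f|exact: map_f|apply/aut_bin].
Qed.

Lemma ae_actE (j : aut L) P : ae (fun a => P (a \o j)) <-> ae P.
Proof.
split=> [/(ae_act (aut_V j))|]; last exact: ae_act.
apply: ae_mono => a _; congr P; apply/funext => l /=; by rewrite aut_funK.
Qed.

Definition actN (j : aut L) (x : N) : N := cls (act j (projT1 (cid (cls_surj x)))).

Lemma actN_cls j t : actN j (cls t) = cls (act j t).
Proof.
rewrite /actN; case: cid => u /= /cls_eq/(ae_act j) H.
by apply/cls_eq; apply: ae_mono H => a _; rewrite !ev_act.
Qed.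

Lemma actN_mul j j' x : actN (aut_mul j j') x = actN j (actN j' x).
Proof.
have [t ->] := cls_surj x; rewrite !actN_cls; congr cls.
by rewrite /act /= -map_comp.
Qed.

Lemma actN1 x : actN (aut_one L) x = x.
Proof. by have [[f s] ->] := cls_surj x; rewrite actN_cls /act /= map_id. Qed.

Lemma actNK j : cancel (actN j) (actN (aut_V j)).
Proof. by move=> x; rewrite -actN_mul aut_mulVg actN1. Qed.

Lemma actNVK j : cancel (actN (aut_V j)) (actN j).
Proof. by move=> x; rewrite -actN_mul aut_mulgV actN1. Qed.

Lemma actN_bin j x y : actN j x ∈ actN j y <-> x ∈ y.
Proof.
have [t ->] := cls_surj x; have [u ->] := cls_surj y; rewrite !actN_cls !cls_mem.
rewrite -(ae_actE j (fun a => ev t a ∈ ev u a)).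
by apply: ae_iff => a _; rewrite !ev_act.
Qed.

Definition lift_aut (j : aut L) : aut N := Aut (actNK j) (actNVK j) (actN_bin j).

Lemma const_code m : exists f, app f (tup [::]) = m.
Proof.
have [|f fE] := @fun_ex _ mostM (fun=> m) (tups 0 c); first by rewrite /good1; dfn.
by exists f; apply: fE; exact: tup_in.
Qed.

Definition emb (m : M) : N := cls (projT1 (cid (const_code m)), [::]).

Lemma emb_ev m a : ev (projT1 (cid (const_code m)), [::]) a = m.
Proof. by rewrite /ev /=; case: cid. Qed.

Lemma emb_eq t m : cls t = emb m <-> ae (fun a => ev t a = m).
Proof. by rewrite cls_eq; apply: ae_iff => a _; rewrite emb_ev. Qed.

Lemma mem_emb t m : cls t ∈ emb m <-> ae (fun a => ev t a ∈ m).
Proof. by rewrite cls_mem; apply: ae_iff => a _; rewrite emb_ev. Qed.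

Lemma emb_mem m t : emb m ∈ cls t <-> ae (fun a => m ∈ ev t a).
Proof. by rewrite cls_mem; apply: ae_iff => a _; rewrite emb_ev. Qed.

Lemma emb_cofinal : cofinal_embedding emb.
Proof.
split; first split.
- move=> m m' /emb_eq H; apply: ae_const; apply: ae_mono H => a _; by rewrite emb_ev.
- move=> m m'; rewrite mem_emb; split=> H.
    by apply: ae_const; apply: ae_mono H => a _; rewrite emb_ev.
  by apply: ae_all => a _; rewrite emb_ev.
move=> x; have [[f s] ->] := cls_surj x.
have [b bE] := range_ex mostM f (tups (size s) c).
by exists b; apply/mem_emb; apply: ae_all => a ac; apply: bE; exact: tup_map_in.
Qed.

Lemma actN_emb j m : actN j (emb m) = emb m.
Proof. by rewrite actN_cls; apply/emb_eq; apply: ae_all => a _; rewrite ev_act emb_ev. Qed.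

Lemma unary_code g : exists f, forall x, x ∈ c -> app f (tup [:: x]) = app g x.
Proof.
have [|f fE] := @unif _ mostM (fun q v => exists x y, q = opair x y /\ v = app g x) (tups 1 c).
  by dfn.
exists f => x xc; have [||x' [y [/opair_inj[-> _] ->]]] // := fE (tup [:: x]).
  by apply: tup_in => //=; rewrite /allin /= andbT; apply/asboolP.
by exists (app g x), x, e0.
Qed.

Lemma ae_bin l l' : bin l l' -> ae (fun a => a l ∈ a l').
Proof.
move=> ll'; exists 0, [:: l; l'] => a [_ _]; apply=> //; first by rewrite mem_head.
by rewrite !inE eqxx orbT.
Qed.

Lemma ae_neq (l l' : L) : l <> l' -> ae (fun a => a l <> a l').
Proof.
have [irr trs tot] := linL; case: (tot l l') => // [/ae_bin H|/ae_bin H] _;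
  by apply: ae_mono H => a _ + e; rewrite e => /(mem_irr mM).
Qed.

(** The terms consisting of a single index, read through the identity, already separate
    automorphisms. *)
Lemma lift_aut_inj : injective lift_aut.
Proof.
move=> j j' e; apply: aut_eq => l; apply: contrapT => ne.
have [|g gE] := @fun_ex _ mostM (fun x => x) c; first by rewrite /good1; dfn.
have [f fE] := unary_code g.
have : actN j (cls (f, [:: l])) = actN j' (cls (f, [:: l])) := congr1 (fun h : aut N => h _) e.
rewrite !actN_cls => /cls_eq H; apply: ae_false; apply: ae_mono2 (ae_neq ne) H => a ac n.
by rewrite /ev /= !fE // !gE.
Qed.

(** * Elements fixed by a fixed-point free automorphism *)

Section FixedPoints.
Hypothesis Xcs : forall n f, exists k, const_or_sep mostM n f (X k).
Variables (j : aut L) (nofix : forall l : L, j l <> l).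

(** The orbit of a moved point is strictly monotone, so no positive power of [j] has a fixed
    point. *)
Lemma iter_free d (l : L) : iter d.+1 j l <> l.
Proof.
have [irr trs tot] := linL.
case: (tot l (j l)) => [lt|/esym/nofix//|gt].
- have H : forall d, bin l (iter d.+1 j l).
    elim=> // m IH; exact: (trs l (j l) _ lt (iffRL (aut_bin j l (iter m.+1 j l)) IH)).
  by move=> e; apply: (irr l); rewrite -{2}e.
- have H : forall d, bin (iter d.+1 j l) l.
    elim=> // m IH; exact: (trs _ (j l) l (iffRL (aut_bin j (iter m.+1 j l) l) IH) gt).
  by move=> e; apply: (irr l); rewrite -{1}e.
Qed.

Lemma iter_leave (l l' : L) : exists m, forall d, m <= d -> iter d j l <> l'.
Proof.
case: (pselect (exists m, iter m j l = l')) => [[m e]|no]; last first.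
  by exists 0 => d _ e; apply: no; exists d.
exists m.+1 => d md ed; apply: (@iter_free (d - m.+1) l').
by rewrite -{1}e -iterD addSn -addnS subnK.
Qed.

Lemma iter_disjoint (S S' : seq L) : exists m, forall l, l \in S -> iter m j l \notin S'.
Proof.
suff [m H] : exists m, forall d, m <= d -> forall l, l \in S -> iter d j l \notin S'.
  by exists m; exact: H.
elim: S => [|l S [m IH]]; first by exists 0.
have [m' H] : exists m, forall d, m <= d -> iter d j l \notin S'.
  elim: S' {IH} => [|l' S' [m' IH]]; first by exists 0.
  have [m1 H1] := iter_leave l l'; exists (maxn m1 m') => d; rewrite geq_max => /andP[d1 d2].
  by rewrite inE negb_or IH // andbT; apply/eqP; exact: H1.
exists (maxn m m') => d; rewrite geq_max => /andP[d1 d2] l'; rewrite inE => /orP[/eqP->|l'S].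
  exact: H.
exact: IH.
Qed.

(* If [F] takes the same value on [S] and on a disjoint [S'], then moving the
   points of [S ++ S'] one at a time to lower positions, from the lowest one
   up, never changes the value of [F] on [S]. *)
Lemma fixed_separated k n g S S' : size S = n -> pairwise desc S ->
  (forall l, l \in S' -> l \notin S) ->
  (forall a, incr k (S ++ S') a -> app g (tup (map a S)) = app g (tup (map a S'))) ->
  exists s s', [/\ dlist n (X k) s, dlist n (X k) s', decr (s ++ s') &
    app g (tup s) = app g (tup s')].
Proof.
move=> Sn dS dis H; set U := S ++ S'; set V := dsort U; set B := size V.
have SU : {subset S <= U} by move=> l lS; rewrite mem_cat lS.
have S'U : {subset S' <= U} by move=> l lS; rewrite mem_cat lS orbT.
have [D [Dn DX dD]] := Xlong k (B + B).
have [s1 [sz1 sX1 _]] := Xlong k 1; case: s1 sz1 sX1 => // d s1 _ /andP[/asboolP dX _].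
(* [D] consists of an upper block of [B] entries followed by a lower one. [a t] puts the indices at
   positions below [t] in [V] into the upper block and the others into the lower, so [a B] lies
   entirely above [a 0]. *)
pose pos t l := if index l V < t then index l V else index l V + B.
pose a t l := nth d D (pos t l).
have aX t l : a t l ∈ X k.
  rewrite /a; case: (ltnP (pos t l) (size D)) => H'; last by rewrite nth_default.
  by have /asboolP := allP DX _ (mem_nth d H').
have idx l : l \in U -> index l V < B by rewrite -mem_dsort index_mem.
have nthlt p q : p < q -> q < B + B -> nth d D q ∈ nth d D p.
  move=> pq qB; have := pairwiseP d dD p q; rewrite !inE Dn.
  by move=> /(_ (ltn_trans pq qB) qB pq).
have posB t l : l \in U -> pos t l < B + B.
  move=> /idx H1; rewrite /pos; case: ifP => _; first exact: ltn_addr.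
  by rewrite ltn_add2r.
have inca t : incr k U (a t).
  split=> //; first by move=> l; exact: Xc (aX t l).
  move=> l l' lU l'U ll'; apply: nthlt; last exact: posB.
  have [irr trs tot] := linL.
  have lV : l \in V by rewrite mem_dsort.
  have l'V : l' \in V by rewrite mem_dsort.
  have lt : index l' V < index l V.
    case: (ltngtP (index l V) (index l' V)) => // [lt|e].
      have := pairwiseP l (dsort_desc U) _ _ (idx l lU) (idx l' l'U) lt.
      rewrite !nth_index // => /asboolP l'l.
      by case: (irr l); exact: trs ll' l'l.
    by move: ll'; rewrite -(nth_index l lV) e nth_index // => /irr.
  rewrite /pos; case: (ltnP (index l V) t) => h1.
    by rewrite (ltn_trans lt h1).
  case: ifP => _; first exact: leq_trans lt (leq_addr _ _).
  by rewrite ltn_add2r.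
have step t : app g (tup (map (a t.+1) S)) = app g (tup (map (a t) S)).
  have same l : index l V <> t -> a t.+1 l = a t l.
    by move=> ne; rewrite /a /pos ltnS leq_eqVlt; case: eqP.
  (* Only the index at position [t] moves, and it lies in at most one of [S] and [S']; the value of
     [g] is read off on the list that does not contain it. *)
  case: (pselect (exists2 l, l \in S' & index l V = t)) => [[l lS' lt]|no].
    congr (app g (tup _)); apply/eq_in_map => l' l'S; apply: same => e.
    have lV : l \in V by rewrite mem_dsort; exact: S'U.
    have l'V : l' \in V by rewrite mem_dsort; exact: SU.
    have ll : l = l' by rewrite -(nth_index l lV) -(nth_index l l'V) lt e.
    by have := dis l lS'; rewrite ll l'S.
  rewrite !H //; congr (app g (tup _)); apply/eq_in_map => l lS'; apply: same => e.
  by apply: no; exists l.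
exists (map (a B) S), (map (a 0) S); split.
- by rewrite -Sn; apply: incr_dlist (inca B).
- by rewrite -Sn; apply: incr_dlist (inca 0).
- have [_ _ d1] : dlist (size S) (X k) (map (a B) S) by apply: incr_dlist (inca B).
  have [_ _ d2] : dlist (size S) (X k) (map (a 0) S) by apply: incr_dlist (inca 0).
  rewrite /decr pairwise_cat; apply/and3P; split=> //.
  apply/allrelP => _ _ /mapP[l /SU lU ->] /mapP[l' /SU l'U ->]; apply/asboolP.
  apply: nthlt; last exact: posB.
  by rewrite /pos (idx l lU) ltn0; apply: leq_trans (idx l lU) (leq_addl _ _).
- have E t : app g (tup (map (a t) S)) = app g (tup (map (a 0) S)).
    by elim: t => // t IH; rewrite step.
  exact: E.
Qed.

Lemma support t : exists g S, [/\ uniq S, pairwise desc S &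
  forall a, (forall l, a l ∈ c) -> ev t a = app g (tup (map a S))].
Proof.
have [|g gE] := @lift t.1 t.2 (dsort t.2); first by move=> l; rewrite mem_dsort.
exists g, (dsort t.2); split; [exact: dsort_uniq|exact: dsort_desc|].
by move=> a ac; rewrite gE.
Qed.

Lemma constant_emb g S k : pairwise desc S -> constant_on mostM (size S) g (X k) ->
  exists m, cls (g, S) = emb m.
Proof.
move=> dS [v Hv]; exists v; apply/emb_eq; exists k, S => a ia; apply: Hv.
exact: incr_dlist ia.
Qed.

Lemma fixed_emb x : actN j x = x -> exists m, x = emb m.
Proof.
have [t ->] := cls_surj x; have [g [S [uS dS gE]]] := support t.
have -> : cls t = cls (g, S) by apply/cls_eq; apply: ae_all => a ac; rewrite gE.
move=> fx.
have fxm m : cls (g, map (iter m j) S) = cls (g, S).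
  elim: m => [|m IH]; first by rewrite map_id.
  have -> : map (iter m.+1 j) S = map j (map (iter m j) S) by rewrite -map_comp.
  by rewrite -[RHS]fx -IH actN_cls.
have [m Hm] := iter_disjoint S S.
have dis l : l \in map (iter m j) S -> l \notin S by move=> /mapP[l' /Hm ? ->].
have /cls_eq H := fxm m.
pose U := S ++ map (iter m j) S.
have [|g1 g1E] := @lift g S U; first by move=> l lS; rewrite mem_cat lS.
have [|g2 g2E] := @lift g (map (iter m j) S) U; first by move=> l lS; rewrite mem_cat lS orbT.
have [|b bE] := @sep_ex _ mM (fun q => app g1 q = app g2 q) (tups (size U) c); first by dfn.
have inb a : (forall l, a l ∈ c) -> (tup (map a U) ∈ b <->
    app g (tup (map a S)) = app g (tup (map a (map (iter m j) S)))).
  move=> ac; rewrite bE g1E // g2E //; split=> [[]//|]; split=> //; exact: tup_map_in.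
(* The finite set behind [H] may exceed [U]; [ultra] yields a stage where the equality holds for all
   assignments increasing on [U] alone. *)
have [k1 [Hk1|Hk1]] := ultra b U; last first.
  case: ae_false; apply: (@ae_mono2 _ (fun a => ~ tup (map a U) ∈ b)) H _; last by exists k1, U.
  by move=> a ac e; apply; apply/inb.
have [k2 Hk2] := Xcs (size S) g.
case: Hk2 => [|sep]; first exact: constant_emb.
pose k := maxn k1 k2.
have [||s [s' [ds ds' dss e]]] := @fixed_separated k (size S) g S (map (iter m j) S) erefl dS.
- exact: dis.
- move=> a ia; have [ac _ _] := ia; apply/inb => //; apply: Hk1.
  by apply: incr_sub ia => //; exact: leq_maxl.
have kk : subs (X k) (X k2) by apply: Xmono; exact: leq_maxr.
by case: (sep s s' (dlist_sub kk ds) (dlist_sub kk ds') dss).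
Qed.

End FixedPoints.

(** * The hereditarily fixed part *)

Section InitialFixed.
Variables (I : set M) (cutI : H_cut I).
Hypothesis Xcs : forall n f, exists k, const_or_sep mostM n f (X k).
Hypothesis XI : forall n f i k, I i -> (forall s, dlist n (X k) s -> app f (tup s) ∈ i) ->
  exists k', constant_on mostM n f (X k').
Hypothesis Xinj : forall d, exists k, inj_tc mostM I d (X k).
Variables (j : aut L) (nofix : forall l : L, j l <> l) (l0 : L).

Lemma cut_tc m : I m -> I (tc mostM m).
Proof.
move=> Im; have mI := most_mac (let: And3 _ _ H := cutI in H).
have Iu := cut_upair mostM cutI Im Im.
have [y ty uy] := mac_tc mI (exist _ _ Iu).
apply: (cut_sub cutI (svalP y)); apply: tc_min; last first.
  by apply: (uy (exist _ m Im)); apply/in_upair; left.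
move=> z zy w wz; have Iz := cut_mem cutI (svalP y) zy; have Iw := cut_mem cutI Iz wz.
exact: (ty (exist _ z Iz) zy (exist _ w Iw) wz).
Qed.

Lemma emb_trans T : is_trans T -> is_trans (emb T).
Proof.
move=> tT y; have [t ->] := cls_surj y; rewrite mem_emb => H z.
have [u ->] := cls_surj z; rewrite cls_mem mem_emb => H'.
by apply: ae_mono2 H H' => a _ K K'; exact: (tT _ K _ K').
Qed.

Lemma below_cut T x : I T -> x ∈ emb T -> exists m, x = emb m.
Proof.
move=> IT; have [t ->] := cls_surj x; have [g [S [uS dS gE]]] := support t.
have -> : cls t = cls (g, S) by apply/cls_eq; apply: ae_all => a ac; rewrite gE.
move=> /mem_emb H.
have [|b bE] := @sep_ex _ mM (fun q => app g q ∈ T) (tups (size S) c); first by dfn.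
(* Again [ultra] reduces the indices involved to [S]. Every decreasing tuple of [X k] is then the
   value of an assignment on [S], as [XI] requires. *)
have [k [Hk|Hk]] := ultra b S; last first.
  case: ae_false; apply: (@ae_mono2 _ (fun a => ~ tup (map a S) ∈ b)) H _; last by exists k, S.
  by move=> a ac gT; apply; apply/bE; split=> //; exact: tup_map_in.
have [|k' Hk'] := @XI (size S) g T k IT; last exact: constant_emb Hk'.
move=> s ds; have [a ia <-] := dlist_incr uS dS ds.
by have /bE[] := Hk a ia.
Qed.

(** Transitivity is [delta0], so [u] is transitive almost everywhere and the minimality of [tc] in
    [M] applies. *)
Lemma emb_TC m u : is_trans u -> emb m ∈ u -> subs (emb (tc mostM m)) u.
Proof.
have [t ->] := cls_surj u => tu /emb_mem mu z; have [w ->] := cls_surj z.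
pose f := fAll 1 (fImp (fMem 1 0) (fAll 2 (fImp (fMem 2 1) (fMem 2 0)))).
have df : delta0 f by d0.
have /(los0 df) Ht : sat (fun=> cls t) f by move=> y yt x; exact: (tu y yt).
rewrite mem_emb cls_mem => Hw; apply: ae_mono2 Ht (ae_and mu Hw) => a _ K [K1 K2].
by apply: (tc_min (d := m)) K2 => // y yt x; exact: (K y yt).
Qed.

Lemma Ifix_lift : Ifix (lift_aut j) = emb @` I.
Proof.
have mN := most_mac ultra_most.
apply/seteqP; split=> [x Hx|_ [m Im <-] y [s [t [su [tt st tmin] yt]]]].
  have [t tt [xt tmin]] := TC_ex ultra_most x.
  have [m xE] : exists m, x = emb m.
    apply: (fixed_emb Xcs nofix); apply: Hx.
    have [s sE] := mac_pairing mN x x; exists s, t; split=> //.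
    split=> //; first by move=> z /sE[]->.
    by move=> u tu su; apply: tmin => //; apply: su; apply/sE; left.
  subst x; exists m => //; apply: contrapT => nI.
  have [k Hk] := Xinj m; have [g [gT gI]] := Hk nI.
  have [f fE] := unary_code g.
  (* The index [l0] sent into [tc mostM m] by the injection; its image under the automorphism is the
     same function at [j l0], a different value. *)
  pose y := cls (f, [:: l0]).
  have H1 : ae (fun a => a l0 ∈ X k).
    by exists k, [:: l0] => a [_ aX _]; apply: aX; rewrite mem_head.
  have H2 : ae (fun a => a (j l0) ∈ X k).
    by exists k, [:: j l0] => a [_ aX _]; apply: aX; rewrite mem_head.
  have : lift_aut j y = y.
    have [s sE] := mac_pairing mN (emb m) (emb m).
    apply: Hx; exists s, (emb (tc mostM m)); split=> //.
    - split; first by apply: emb_trans; exact: tc_trans.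
        move=> z /sE[]->; apply/mem_emb; apply: ae_all => a _; rewrite emb_ev; exact: tc_in.
      by move=> u tu su; apply: emb_TC => //; apply: su; apply/sE; left.
    - by apply/mem_emb; apply: ae_mono H1 => a ac aX; rewrite /ev /= fE //; exact: gT.
  rewrite /= actN_cls => /cls_eq H3; apply: ae_false.
  apply: ae_mono2 (ae_neq (@nofix l0)) (ae_and H3 (ae_and H1 H2)) => a ac ne [e [K1 K2]].
  by apply: ne; apply: gI => //; move: e; rewrite /ev /= !fE.
have ts : subs t (emb (tc mostM m)).
  apply: tmin; first by apply: emb_trans; exact: tc_trans.
  move=> z /su[]->; apply/mem_emb; apply: ae_all => a _; rewrite emb_ev; exact: tc_in.
have [m' ->] := below_cut (cut_tc Im) (ts y yt).
exact: actN_emb.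
Qed.

Lemma fixpts_lift : fixpts (lift_aut j) = range emb.
Proof.
apply/seteqP; split=> [x Hx|_ [m _ <-]]; last exact: actN_emb.
by have [m ->] := fixed_emb Xcs nofix Hx; exists m.
Qed.

End InitialFixed.

Lemma lift_autM : {morph lift_aut : x y / (x * y)%g >-> (x * y)%g}.
Proof. by move=> x y; apply: aut_eq => z /=; exact: actN_mul. Qed.

HB.instance Definition _ := isMultiplicative.Build (aut L) (aut N) lift_aut lift_autM.

End Ultrapower.

Theorem theorem4p1 (M : structure) (I : set M) (L : structure)
  (countM : countable [set: M])
  (mostM : MOST M)
  (collM : collection M delta0P)
  (cutI : H_cut I)
  (linL : linear_order L)
  (inhL : [set: L] !=set0) :
  exists (N : structure) (e : M -> N) (h : {multiplicative aut L -> aut N}),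
    [/\ cofinal_embedding e, MOST N, injective h
      & forall j : aut L, (forall x : L, j x <> x) ->
          Ifix (h j) = e @` I /\ fixpts (h j) = range e].
Proof.
have [c oc nc] := large_ord_ex mostM cutI.
have [X [Xc Xl Xmono Xm]] := generic_ex cutI oc nc countM.
have Xlong k n : exists s, dlist n (X k) s.
  by have [s [_ [ds _ _ _]]] := bottom cutI oc n (Xc k) (Xl k); exists s.
have Xhom n b : exists k, hom mostM n b (X k) by have [k []] := Xm n b; exists k.
have Xcs n b : exists k, const_or_sep mostM n b (X k) by have [k []] := Xm n b; exists k.
have Xinj d : exists k, inj_tc mostM I d (X k) by have [k []] := Xm 0 d; exists k.
have XI n f i k : I i ->
    (forall s, dlist n (X k) s -> app (most_mac mostM) f (tup (most_mac mostM) s) ∈ i) ->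
    exists k', constant_on mostM n f (X k').
  (* At the later of the two stages, being bounded by [i] contradicts the second alternative, so [f]
     is constant at stage [k']. *)
  move=> Ii Hi; have [k' [_ _ [Hc|Hu] _]] := Xm n f; first by exists k'.
  exfalso; apply: (Hu (X (maxn k k'))) => //; first exact: Xmono (leq_maxr _ _).
  exists i => // s ds; apply: Hi; apply: dlist_sub ds; exact: Xmono (leq_maxl _ _).
(* An index from which to form the moved element of a transitive closure. *)
have [l0 _] := inhL.
exists (ultrapower mostM c X L), (emb mostM c X L), (lift_aut mostM c Xmono); split.
- exact: emb_cofinal.
- exact: ultra_most.
- exact: lift_aut_inj.
- by move=> j nofix; split; [exact: Ifix_lift|exact: fixpts_lift].
Qed.
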